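(* Let $D$ be a partial cube of VC-dimension at most $2$. Then $D$ is a pseudo-disk if and only if $D$ is a disk. In particular, for every partial cube $G$ of VC-dimension at most $2$ and every isometric cycle $C$ of $G$, the convex hull $\mathrm{conv}(C)$ is (the tope graph of) an affine oriented matroid (AOM) of rank $2$.
   Context: All graphs are finite, connected and simple. An induced subgraph $H$ of $G$ is isometric if distances in $H$ equal those in $G$. A partial cube is a graph isometrically embeddable in a hypercube $Q_m$ (vertices: subsets of $\{1,\dots,m\}$, adjacent iff their symmetric difference has size 1); it is identified with its image, hence with a set family. Its VC-dimension is the maximum size of a set $X$ with $\{X\cap S: S\in V(G)\}=2^X$. A set of vertices is convex if it contains all shortest paths between its vertices; $\mathrm{conv}(S)$ is the smallest convex set containing $S$. A halfspace of a partial cube $G\subseteq Q_m$ is the subgraph induced by the vertices containing (or by those not containing) a given element $i$, where both are nonempty. Pseudo-disk: a partial cube $D$ of VC-dimension at most $2$ containing an isometric cycle $C$ with $\mathrm{conv}(C)=D$; $K_1$ and $K_2$ are also admitted as pseudo-disks. Disk: a pseudoline arrangement is a finite (possibly empty) family of simple non-closed curves in the plane, extendable to infinity without introducing further crossings, such that every two curves intersect exactly once and cross there (several curves may pass through the same point). Its region graph has the connected components of the complement as vertices, two being adjacent iff separated by exactly one curve. A partial cube is a disk if it is the region graph of a pseudoline arrangement. AOM: an oriented matroid (OM) is a pair $(U,\mathcal L)$, $U$ finite, $\varnothing\neq\mathcal L\subseteq\{-1,0,+1\}^U$, such that, with $(X\circ Y)_e=X_e$ if $X_e\neq0$ and $(X\circ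 Y)_e=Y_e$ otherwise: $X\circ Y\in\mathcal L$ for all $X,Y\in\mathcal L$; $-\mathcal L=\mathcal L$; and for all $X,Y\in\mathcal L$ and $e$ with $X_eY_e=-1$ there is $Z\in\mathcal L$ with $Z_e=0$ and $Z_f=(X\circ Y)_f$ for all $f$ with $X_fY_f\ne-1$. It is simple if $\{X_e:X\in\mathcal L\}=\{-1,0,+1\}$ for each $e$ and for all $e\ne f$ there are $X,Y\in\mathcal L$ with $\{X_eX_f,Y_eY_f\}=\{+1,-1\}$; all OMs are assumed simple. Topes are the maximal elements of $\mathcal L$ in the product order with $0\le -1$, $0\le +1$; they are $\pm1$-vectors, and the tope graph is the subgraph of the hypercube $\{\pm1\}^U$ induced by them (it is a partial cube). A graph is (the tope graph of) an AOM if it is a halfspace of the tope graph of an OM. Its rank is its VC-dimension. *)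

(* Defs.v *)
From HB Require Import structures.
From mathcomp Require Import all_boot all_order all_algebra.
From mathcomp Require Import boolp classical_sets functions reals prodnormedzmodule topology normedtype.

Set Implicit Arguments.
Unset Strict Implicit.
Unset Printing Implicit Defensive.

Import Order.TTheory GRing.Theory Num.Theory.
Import numFieldNormedType.Exports.

Local Open Scope ring_scope.
Local Open Scope set_scope.

Section PartialCubes.
Variable U : finType.
Implicit Types (G C S F : {set {set U}}) (A B : {set U}).

Definition cube_adj A B : bool := #|(A :\: B) :|: (B :\: A)| == 1%N.

(* A family G of subsets of U stands for the subgraph of the hypercube on U
   that it induces; [set: {set U}] is the hypercube itself. *)

(* [walk G A B p] : A :: p is a walk of length [size p] from A to B in G. *)
Definition walk G A B (p : seq {set U}) : bool :=
  [&& path cube_adj A p, last A p == B & all (mem G) (A :: p)].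

(* The distance of A and B in G: the least length of a walk. As G has at most
   #|{set U}| vertices, all distances between connected vertices are below
   #|{set U}|, which is the value returned when there is no walk. *)
Definition gdist G A B : nat :=
  find (fun n => [exists p : n.-tuple {set U}, walk G A B p])
       (iota 0 #|{set U}|).

Definition isometric C G : Prop :=
  C \subset G /\ {in C &, forall A B, gdist C A B = gdist G A B}.

(* Isometry in the hypercube forces connectedness, as all distances in the
   hypercube are at most #|U| < #|{set U}|. *)
Definition partial_cube G : Prop := G != finset.set0 /\ isometric G [set: {set U}].

Definition shattered F A : bool := [set A :&: B | B in F] == powerset A.

Definition vcdim F : nat := \max_(A : {set U} | shattered F A) #|A|.

Definition is_convex G S : bool :=
  (S \subset G) &&
  [forall A in S, forall B in S, forall p : (gdist G A B).-tuple {set U},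
     walk G A B p ==> all (mem S) p].

(* Meant for S \subset G; then G itself takes part in the intersection. *)
Definition conv G S : {set {set U}} :=
  \bigcap_(K : {set {set U}} | is_convex G K && (S \subset K)) K.

Definition cycle_graph C : Prop :=
  exists c : seq {set U},
    [/\ (3 <= size c)%N, uniq c, C =i c &
        {in c &, forall A B,
           cube_adj A B = (next c A == B) || (next c B == A)}].

Definition isometric_cycle G C : Prop := cycle_graph C /\ isometric C G.

Definition halfspace G H : Prop :=
  exists i : U,
    let Gp := [set A in G | i \in A] in
    let Gm := [set A in G | i \notin A] in
    [/\ Gp != finset.set0, Gm != finset.set0 & H = Gp \/ H = Gm].

Definition pseudo_disk G : Prop :=
  [/\ partial_cube G, (vcdim G <= 2)%N &
      [\/ exists C, isometric_cycle G C /\ conv G C = G,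
          exists A, G = [set A]
        | exists A B, cube_adj A B /\ G = [set A; B]]].

End PartialCubes.

Definition graph_iso (U V : finType) (G : {set {set U}}) (H : {set {set V}}) : Prop :=
  exists phi : {set U} -> {set V},
    [/\ {in G &, injective phi}, phi @: G = H &
        {in G &, forall A B, cube_adj (phi A) (phi B) = cube_adj A B}].

Section OrientedMatroids.
Variable U : finType.

(* The three elements 0, 1, -1 of 'F_3 play the role of the signs: products and
   opposites of signs are those of 'F_3 (its addition is not used). *)
Definition signvec := {ffun U -> 'F_3}.
Implicit Types (L : {set signvec}) (X Y Z : signvec).

Definition sv_comp X Y : signvec := [ffun e => if X e != 0 then X e else Y e].

Definition sv_opp X : signvec := [ffun e => - X e].

Definition sv_le X Y : bool := [forall e, (X e == 0) || (X e == Y e)].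

Definition oriented_matroid L : Prop :=
  [/\ L != finset.set0,
      {in L &, forall X Y, sv_comp X Y \in L},
      [set sv_opp X | X in L] = L &
      {in L &, forall X Y (e : U), X e * Y e = -1 ->
         exists Z, [/\ Z \in L, Z e = 0 &
           forall f, X f * Y f <> -1 -> Z f = sv_comp X Y f]}].

Definition simple_om L : Prop :=
  (forall e : U, [set (X : signvec) e | X in L] = [set -1; 0; 1]) /\
  (forall e f : U, e != f -> exists X Y,
     [/\ X \in L, Y \in L & [set X e * X f; Y e * Y f] = [set 1; -1]]).

Definition topes L : {set signvec} :=
  [set X in L | [forall Y in L, sv_le X Y ==> (Y == X)]].

(* Topes are +1/-1 vectors, determined by their positive parts; adjacency in
   the hypercube of +1/-1 vectors becomes [cube_adj]. *)
Definition tope_graph L : {set {set U}} :=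
  [set [set e | (X : signvec) e == 1] | X in topes L].

End OrientedMatroids.

Definition AOM (U : finType) (G : {set {set U}}) : Prop :=
  exists (V : finType) (L : {set signvec V}) (H : {set {set V}}),
    [/\ oriented_matroid L, simple_om L, halfspace (tope_graph L) H & graph_iso G H].

Definition AOM_of_rank (U : finType) (r : nat) (G : {set {set U}}) : Prop :=
  AOM G /\ vcdim G = r.

Section Pseudolines.
Variable R : realType.
Local Open Scope classical_set_scope.

(* A simple curve, already extended to infinity in both directions: only the
   extended curves cut the plane into the regions of the arrangement. *)
Definition pseudoline (f : R -> R * R) : Prop :=
  [/\ continuous f, injective f,
      `|f t| @[t --> +oo%R] --> +oo%R & `|f t| @[t --> -oo%R] --> +oo%R].

(* Two points are on the same side of f when they lie in the same connected
   component of the complement of f. *)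
Definition separates (f : R -> R * R) (P Q : set (R * R)) : Prop :=
  forall p q, P p -> Q q -> ~ connected_component (~` range f) p q.

(* f and g have exactly one common point f s = g t, at which g passes from one
   side of f to the other. *)
Definition cross_once (f g : R -> R * R) : Prop :=
  exists s t, [/\ f s = g t,
    forall s' t', f s' = g t' -> s' = s /\ t' = t &
    separates f [set g u | u in [set u | u < t]] [set g u | u in [set u | t < u]]].

Definition pseudoline_arrangement (n : nat) (l : 'I_n -> R -> R * R) : Prop :=
  (forall i, pseudoline (l i)) /\ (forall i j, i != j -> cross_once (l i) (l j)).

Definition arrangement_complement (n : nat) (l : 'I_n -> R -> R * R) : set (R * R) :=
  [set p | forall i, ~ range (l i) p].

Definition regions (n : nat) (l : 'I_n -> R -> R * R) : set (set (R * R)) :=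
  [set connected_component (arrangement_complement l) p |
     p in arrangement_complement l].

Definition region_adj (n : nat) (l : 'I_n -> R -> R * R) (P Q : set (R * R)) : Prop :=
  exists! i, separates (l i) P Q.

Definition is_region_graph (U : finType) (G : {set {set U}})
    (n : nat) (l : 'I_n -> R -> R * R) : Prop :=
  exists phi : {set U} -> set (R * R),
    set_bij [set` G] (regions l) phi /\
    {in G &, forall A B, cube_adj A B <-> region_adj l (phi A) (phi B)}.

Definition disk (U : finType) (G : {set {set U}}) : Prop :=
  partial_cube G /\
  exists (n : nat) (l : 'I_n -> R -> R * R),
    pseudoline_arrangement l /\ is_region_graph G l.

End Pseudolines.

(* Main.v *)
(** Number the coordinates of a pseudo-disk in the order in which its boundary cycle crosses them. The
    disk becomes a family F of subsets of {0, ..., n-1} containing all initial and all final segments, and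
    VC-dimension at most 2 turns into strong separation of its members. Hence the maximal chains of F from
    the empty to the full set can be swept from the identity permutation to its reverse by reversals of
    ascending blocks, and F consists of the prefixes of the permutations met. Joining the successive
    positions of the elements by segments gives graphs of functions crossing pairwise once, that is, a
    pseudoline arrangement with region graph F. Conversely, a special case of Janiszewski's theorem shows
    that a region is determined by its sides and that the region graph is isometric; a pseudoline meets at
    most three of the four quadrants of two others, which bounds the VC-dimension, and the two ends of each
    pseudoline provide the antipodal edges from which the boundary cycle is recovered.

    For the oriented matroid, let one more line first sweep over all the others, and continue the positions
    antiperiodically: this gives pseudolines on a Moebius strip. Their position vectors, together with 0,
    satisfy the covector axioms since any two of the curves change order once per half turn, and the
    extra line cuts out F as a halfspace. *)

Require Import Defs.
From HB Require Import structures.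
From mathcomp Require Import all_boot all_order zify.
From mathcomp Require Import boolp.
Set Implicit Arguments.
Unset Strict Implicit.
Unset Printing Implicit Defensive.

(** The relation [separates] speaks of components of the complement of one curve without saying how
    many there are. That a curve has exactly two sides is read off from the graph: three sides would
    give three pairwise adjacent regions, and a hypercube has no triangles. This argument needs a
    second curve; with at most one curve all regions are pairwise adjacent, which leaves only K_1
    and K_2. Separation in the plane is handled through continuous angle functions on closed sets,
    so that a single winding number argument suffices. On the combinatorial side, strong separation
    makes the sum of the elements a linear order on the members of a given size. Maximal chains can
    then be compared level by level; a minimal chain above another one differs from it in a single
    interval of levels, and isometry forces a reversal there, because a geodesic between the two
    chains has to leave that interval. In the linear interpolation all pairs reversed in one step
    meet at the midpoint of the step, so several curves may cross there at the same abscissa without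
    any further member appearing. *)

Module CubeGraphs.

(** * Isometric families of sets *)

Section Cube.
Variable U : finType.
Implicit Types (A B C X Y : {set U}) (G H K S : {set {set U}}) (i j k : U).

Definition sdiff A B : {set U} := (A :\: B) :|: (B :\: A).
Definition flip A i : {set U} := sdiff A [set i].
Definition hdist A B : nat := #|sdiff A B|.

Lemma in_sdiff A B i : (i \in sdiff A B) = (i \in A) (+) (i \in B).
Proof. by rewrite !inE; do 2 case: (_ \in _). Qed.

Lemma in_flip A i j : (j \in flip A i) = (j \in A) (+) (j == i).
Proof. by rewrite in_sdiff inE. Qed.

Lemma sdiffC A B : sdiff A B = sdiff B A.
Proof. by apply/setP => i; rewrite !in_sdiff addbC. Qed.

Lemma sdiffA A B C : sdiff A (sdiff B C) = sdiff (sdiff A B) C.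
Proof. by apply/setP => i; rewrite !in_sdiff addbA. Qed.

Lemma sdiff0 A : sdiff A set0 = A.
Proof. by apply/setP => i; rewrite in_sdiff inE addbF. Qed.

Lemma sdiffv A : sdiff A A = set0.
Proof. by apply/setP => i; rewrite in_sdiff addbb inE. Qed.

Lemma sdiffK A B : sdiff A (sdiff A B) = B.
Proof. by rewrite sdiffA sdiffv sdiffC sdiff0. Qed.

Lemma sdiff_eq0 A B : (sdiff A B == set0) = (A == B).
Proof.
apply/eqP/eqP => [h|->]; last exact: sdiffv.
by rewrite -[RHS](sdiffK A) h sdiff0.
Qed.

Lemma flipK A i : flip (flip A i) i = A.
Proof. by rewrite /flip -sdiffA sdiffv sdiff0. Qed.

Lemma flip_notin A i : i \notin A -> flip A i = i |: A.
Proof. by move=> iA; apply/setP => j; rewrite in_flip !inE; case: eqP => [->|_]; rewrite ?(negbTE iA) ?addbF. Qed.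

Lemma flip_in A i : i \in A -> flip A i = A :\ i.
Proof. by move=> iA; apply/setP => j; rewrite in_flip !inE; case: eqP => [->|_]; rewrite ?iA ?addbF. Qed.

Lemma hdist_eq0 A B : (hdist A B == 0) = (A == B).
Proof. by rewrite cards_eq0 sdiff_eq0. Qed.

Lemma hdistC A B : hdist A B = hdist B A.
Proof. by rewrite /hdist sdiffC. Qed.

Lemma hdist_triangle B A C : hdist A C <= hdist A B + hdist B C.
Proof.
have -> : hdist A C = #|sdiff (sdiff A B) (sdiff B C)| by rewrite -sdiffA sdiffK.
apply: (@leq_trans #|sdiff A B :|: sdiff B C|); last by rewrite cardsU leq_subr.
by apply/subset_leq_card/subsetP => i; rewrite in_sdiff !inE; do 3 case: (_ \in _).
Qed.

(** The parity of the cardinal is additive under symmetric difference, that is, the hypercube is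
    bipartite. This excludes triangles and makes cycles even. *)
Lemma odd_hdist A B C : odd (hdist A C) = odd (hdist A B) (+) odd (hdist B C).
Proof.
have odd_sdiff X Y : odd #|sdiff X Y| = odd #|X| (+) odd #|Y|.
  rewrite -(cardsID Y X) -(cardsID X Y) /sdiff cardsU [Y :&: X]setIC.
  have -> : (X :\: Y) :&: (Y :\: X) = set0.
    by apply/setP => i; rewrite !inE; do 2 case: (_ \in _).
  by rewrite cards0 subn0 !oddD; do 3 case: (odd _).
by rewrite /hdist !odd_sdiff; do 3 case: (odd _).
Qed.

Lemma cube_adjE A B : cube_adj A B = (hdist A B == 1).
Proof. by []. Qed.

Lemma cube_adjC A B : cube_adj A B = cube_adj B A.
Proof. by rewrite !cube_adjE hdistC. Qed.

Lemma cube_adjP A B : reflect (exists i, B = flip A i) (cube_adj A B).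
Proof.
rewrite cube_adjE; apply: (iffP cards1P) => -[i h]; exists i.
  by rewrite /flip -h sdiffK.
by rewrite h /flip sdiffK.
Qed.

Lemma cube_adj_flip A i : cube_adj A (flip A i).
Proof. by apply/cube_adjP; exists i. Qed.

Lemma hdist_flip A B i : i \in sdiff A B -> hdist A B = (hdist (flip A i) B).+1.
Proof.
move=> iAB; have -> : hdist (flip A i) B = #|sdiff A B :\ i|.
  by rewrite -(flip_in iAB) /flip /hdist -!sdiffA [sdiff [set i] B]sdiffC.
by rewrite /hdist (cardsD1 i (sdiff A B)) iAB.
Qed.

Lemma no_cube_triangle A B C : cube_adj A B -> cube_adj B C -> cube_adj A C -> False.
Proof.
rewrite !cube_adjE => /eqP h1 /eqP h2 /eqP h3.
by have := odd_hdist A B C; rewrite h1 h2 h3.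
Qed.

Lemma walk_cons G A B C p : walk G A C (B :: p) = [&& A \in G, cube_adj A B & walk G B C p].
Proof. by rewrite /walk /=; case: (cube_adj A B); case: (_ == _); rewrite ?andbT ?andbF //=; case: (path _ _ _); rewrite ?andbF. Qed.

Lemma walk_nil G A B : walk G A B [::] = (A == B) && (A \in G).
Proof. by rewrite /walk /= andbT. Qed.

Lemma walk_cat G A B C p q : walk G A B p -> walk G B C q -> walk G A C (p ++ q).
Proof.
elim: p A => [|X p IH] A; first by rewrite walk_nil => /andP[/eqP->].
by rewrite cat_cons !walk_cons => /and3P[-> -> wp] wq /=; exact: IH.
Qed.

Lemma walk_in G A B p : walk G A B p -> {in A :: p, forall X, X \in G}.
Proof. by case/and3P => _ _ /allP. Qed.

Lemma walk_hdist G A B p : walk G A B p -> hdist A B <= size p.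
Proof.
elim: p A => [|X p IH] A; first by rewrite walk_nil => /andP[/eqP-> _]; rewrite leqn0 hdist_eq0.
rewrite walk_cons => /and3P[_ + /IH]; rewrite cube_adjE => /eqP h1 h2.
by rewrite (leq_trans (hdist_triangle X A B)) // h1.
Qed.

Lemma gdist_leq G A B p : walk G A B p -> gdist G A B <= size p.
Proof.
move=> w; rewrite /gdist; set s := iota _ _.
(* A walk at least as long as the default value of [gdist] satisfies the bound trivially, since
   [find] never exceeds the length of its list. *)
have [lt|] := ltnP (size p) #|{set U}|; last by apply: leq_trans; rewrite (leq_trans (find_size _ _)) // size_iota.
rewrite leqNgt; apply/negP => /(before_find 0); rewrite nth_iota // add0n => /existsP[].
by exists (in_tuple p).
Qed.

Lemma gdist_walk G A B : gdist G A B < #|{set U}| -> exists2 p, walk G A B p & size p = gdist G A B.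
Proof.
move=> lt; have h := lt; rewrite /gdist -[X in _ < X](size_iota 0 #|{set U}|) -has_find in h.
have := nth_find 0 h; rewrite nth_iota //.
by rewrite add0n => /existsP[p hp]; exists p => //; rewrite size_tuple.
Qed.

Lemma hdist_lt A B : hdist A B < #|{set U}|.
Proof. by rewrite -cardsT -powersetT card_powerset cardsT; apply: (leq_ltn_trans (max_card _)); exact: ltn_expl. Qed.

Lemma gdist_eq G A B p : walk G A B p -> size p = hdist A B -> gdist G A B = hdist A B.
Proof.
move=> w sp; apply/eqP; rewrite eqn_leq -{1}sp gdist_leq //=.
have lt : gdist G A B < #|{set U}| by apply: leq_ltn_trans (gdist_leq w) _; rewrite sp hdist_lt.
by have [q wq <-] := gdist_walk lt; exact: walk_hdist wq.
Qed.

(** Local form of isometry in the hypercube, equivalent to it by [partial_cubeP] and free of walks: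
    one step of progress is always possible, and geodesics follow by induction. *)
Definition steppable G := {in G &, forall A B, A != B -> exists2 i, i \in sdiff A B & flip A i \in G}.

Lemma steppable_walk G A B : steppable G -> A \in G -> B \in G ->
  exists2 p, walk G A B p & size p = hdist A B.
Proof.
move=> sG; move: {2}(hdist A B) (erefl (hdist A B)) => d.
elim: d A => [|d IH] A hd AG BG.
  by move/eqP: (hd); rewrite hdist_eq0 => /eqP ->; exists [::]; rewrite ?walk_nil ?eqxx ?BG //= (eqP (_ : hdist B B == 0)) // hdist_eq0.
have AB : A != B by rewrite -hdist_eq0 hd.
have [i iAB fG] := sG A B AG BG AB.
have hf : hdist (flip A i) B = d by apply/eqP; rewrite -eqSS -(hdist_flip iAB) hd.
have [p wp sp] := IH _ hf fG BG.
by exists (flip A i :: p); rewrite ?walk_cons ?AG ?cube_adj_flip //= sp hf hd.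
Qed.

Lemma gdistE G A B : steppable G -> A \in G -> B \in G -> gdist G A B = hdist A B.
Proof. by move=> sG AG BG; have [p wp sp] := steppable_walk sG AG BG; exact: gdist_eq wp sp. Qed.

Lemma steppable_setT : steppable [set: {set U}].
Proof.
move=> A B _ _; rewrite -sdiff_eq0 => /set0Pn[i iAB].
by exists i => //; rewrite inE.
Qed.

Lemma partial_cubeP G : partial_cube G <-> G != set0 /\ steppable G.
Proof.
split=> [[G0 [_ iso]]|[G0 sG]]; split => //; last first.
  split; first exact: subsetT.
  by move=> A B AG BG; rewrite !gdistE ?inE //; exact: steppable_setT.
move=> A B AG BG AB; have := iso A B AG BG.
rewrite (gdistE steppable_setT) ?inE // => d.
have [|p] := @gdist_walk G A B; first by rewrite d hdist_lt.
rewrite d; case: p => [|X p]; first by rewrite walk_nil (negbTE AB).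
rewrite walk_cons => /and3P[_ /cube_adjP[i ->] wp] sp.
have fG : flip A i \in G by apply: (walk_in wp); rewrite mem_head.
exists i => //; have := walk_hdist wp; rewrite -ltnS; have -> : (size p).+1 = hdist A B by [].
apply: contraLR => iAB; rewrite -leqNgt.
have -> // : hdist (flip A i) B = (hdist A B).+1.
by rewrite (@hdist_flip (flip A i) B i) ?flipK // in_sdiff in_flip eqxx addbT addNb -in_sdiff.
Qed.

Definition shatters G A := forall X, X \subset A -> exists2 B, B \in G & A :&: B = X.

Lemma shatteredP G A : reflect (shatters G A) (shattered G A).
Proof.
apply: (iffP eqP) => [h X|h].
  by rewrite -powersetE -h => /imsetP[B BG ->]; exists B.
apply/setP => X; rewrite powersetE; apply/imsetP/idP => [[B _ ->]|/h[B BG <-]]; first exact: subsetIl.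
by exists B.
Qed.

Lemma vcdim_leq G d : vcdim G <= d <-> (forall A, shatters G A -> #|A| <= d).
Proof.
split=> [h A /shatteredP sA|h]; first by apply: leq_trans h; rewrite (leq_bigmax_cond _ sA).
by apply/bigmax_leqP => A /shatteredP; exact: h.
Qed.

End Cube.

(** The two unbounded ends of the [j]-th pseudoline lie on opposite sides of every other one; the
    regions touching them form two edges of direction [j] with complementary endpoints. *)
Definition antipodal_edges (n : nat) (S : {set {set 'I_n}}) := forall j, exists X : {set 'I_n},
  [/\ X \in S, flip X j \in S, ~: X \in S & ~: (flip X j) \in S].

(** * Isomorphisms, convex hulls and normalized families *)

Section GraphIso.

Lemma graph_iso_trans (U V W : finType) (G : {set {set U}}) (H : {set {set V}}) (K : {set {set W}}) :
  graph_iso G H -> graph_iso H K -> graph_iso G K.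
Proof.
move=> [f [fi fG fa]] [g [gi gH ga]].
have fH A : A \in G -> f A \in H by move=> AG; rewrite -fG imset_f.
exists (g \o f); split.
- by move=> A B AG BG /= /gi gAB; apply: fi => //; apply: gAB; exact: fH.
- by rewrite imset_comp fG.
- by move=> A B AG BG /=; rewrite ga ?fH // fa.
Qed.

Lemma graph_iso_sym (U V : finType) (G : {set {set U}}) (H : {set {set V}}) :
  graph_iso G H -> graph_iso H G.
Proof.
move=> [f [fi fG fa]].
pose g B := odflt set0 [pick A in G | f A == B].
have gf A : A \in G -> g (f A) = A.
  move=> AG; rewrite /g; case: pickP => [A' /andP[A'G /eqP/fi->]//|/(_ A)].
  by rewrite AG eqxx.
have fg B : B \in H -> f (g B) = B /\ g B \in G.
  by rewrite -fG => /imsetP[A AG ->]; rewrite gf.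
exists g; split.
- by move=> B B' BH B'H gBB'; rewrite -(fg B BH).1 gBB' (fg B' B'H).1.
- apply/setP => A; apply/imsetP/idP => [[B BH ->]|AG]; first by case: (fg B BH).
  by exists (f A); rewrite ?gf // -fG imset_f.
- move=> B B' /fg[h1 h2] /fg[h3 h4]; by rewrite -fa // h1 h3.
Qed.

Lemma walk_map (U V : finType) (G : {set {set U}}) (H : {set {set V}}) (f : {set U} -> {set V}) A B p :
  {in G, forall X, f X \in H} -> {in G &, forall X Y, cube_adj X Y -> cube_adj (f X) (f Y)} ->
  walk G A B p -> walk H (f A) (f B) (map f p).
Proof.
move=> fH fa; elim: p A => [|X p IH] A; first by rewrite !walk_nil => /andP[/eqP-> /fH->]; rewrite eqxx.
rewrite /= !walk_cons => /and3P[AG AX wp]; rewrite fH // IH // andbT fa //.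
by apply: (walk_in wp); rewrite mem_head.
Qed.

(** Hamming distance is graph distance in both families, so an isomorphism preserves it even though
    it need not come from a bijection of coordinates. *)
Lemma iso_hdist (U V : finType) (G : {set {set U}}) (H : {set {set V}}) (f : {set U} -> {set V}) :
  steppable G -> steppable H -> {in G &, injective f} -> f @: G = H ->
  {in G &, forall A B, cube_adj (f A) (f B) = cube_adj A B} ->
  {in G &, forall A B, hdist (f A) (f B) = hdist A B}.
Proof.
move=> sG sH fi fG fa A B AG BG.
have fH X : X \in G -> f X \in H by move=> XG; rewrite -fG imset_f.
apply/eqP; rewrite eqn_leq; apply/andP; split.
  have [p wp <-] := steppable_walk sG AG BG.
  have : walk H (f A) (f B) (map f p).
    by apply: walk_map wp => // X Y XG YG; rewrite fa.
  by move/walk_hdist; rewrite size_map.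
have [p + <-] := steppable_walk sH (fH _ AG) (fH _ BG).
elim: p A AG => [|X p IH] A AG; first by rewrite walk_nil => /andP[/eqP/fi-> // _]; rewrite leqn0 hdist_eq0.
rewrite walk_cons => /and3P[_ AX wp].
have : X \in H by apply: (walk_in wp); rewrite mem_head.
rewrite -fG => /imsetP[Y YG XY]; move: AX wp; rewrite XY fa // => AY /(IH _ YG) YB.
move: AY; rewrite cube_adjE => /eqP AY.
by rewrite (leq_trans (hdist_triangle Y A B)) // AY.
Qed.

Lemma walk_rev (U : finType) (G : {set {set U}}) A B p : walk G A B p ->
  exists2 q, walk G B A q & size q = size p.
Proof.
elim: p A => [|X p IH] A; first by rewrite walk_nil => /andP[/eqP<- AG]; exists [::]; rewrite ?walk_nil ?eqxx.
rewrite walk_cons => /and3P[AG AX wp]; have [q wq sq] := IH _ wp.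
exists (q ++ [:: A]); last by rewrite size_cat sq addn1.
apply: walk_cat wq _; rewrite walk_cons walk_nil eqxx AG cube_adjC AX /= andbT.
by apply: (walk_in wp); rewrite mem_head.
Qed.

End GraphIso.

Section Convex.
Variable U : finType.
Implicit Types (A B X : {set U}) (G C K : {set {set U}}).

Lemma card_sdiff A B : #|sdiff A B| + 2 * #|A :&: B| = #|A| + #|B|.
Proof.
rewrite /sdiff cardsU -(cardsID B A) -(cardsID A B) [B :&: A]setIC.
have -> : (A :\: B) :&: (B :\: A) = set0.
  by apply/setP => i; rewrite !inE; do 2 case: (_ \in _).
by rewrite cards0; lia.
Qed.

(** A coordinate changed both before and after [X] would cancel in the total: a geodesic crosses
    each coordinate at most once. *)
Lemma hdist_between A X B i : hdist A X + hdist X B <= hdist A B -> i \in sdiff A X -> i \notin sdiff X B.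
Proof.
move=> h iAX; apply/negP => iXB.
have := card_sdiff (sdiff A X) (sdiff X B); rewrite -sdiffA sdiffK -/(hdist A B) -/(hdist A X) -/(hdist X B).
have : 0 < #|sdiff A X :&: sdiff X B| by apply/card_gt0P; exists i; rewrite inE iAX.
move: h; lia.
Qed.

Lemma walk_between G A B p X : walk G A B p -> X \in A :: p -> hdist A X + hdist X B <= size p.
Proof.
move=> wp; rewrite in_cons => /predU1P[->|Xp].
  by rewrite (eqP (_ : hdist A A == 0)) ?hdist_eq0 //; exact: walk_hdist wp.
case/splitPr: Xp wp => p1 p2 /and3P[] + + /allP allG.
rewrite cat_path last_cat /= => /and3P[a1 a2 a3] lB.
have w1 : walk G A X (rcons p1 X).
  apply/and3P; split; first by rewrite rcons_path a1 a2.
    by rewrite last_rcons.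
  apply/allP => Y; rewrite in_cons mem_rcons in_cons => h; apply: allG; rewrite in_cons mem_cat in_cons.
    by case/or3P: h => ->; rewrite ?orbT.
have w2 : walk G X B p2.
  by apply/and3P; split => //; apply/allP => Y h; apply: allG; rewrite in_cons mem_cat h !orbT.
have := walk_hdist w1; have := walk_hdist w2; rewrite size_rcons size_cat /=; lia.
Qed.

Lemma convexP G K : steppable G -> reflect (K \subset G /\ {in K &, forall A B p X, walk G A B p ->
  size p = hdist A B -> X \in p -> X \in K}) (is_convex G K).
Proof.
move=> sG; apply: (iffP andP) => -[KG h]; split => //.
  move=> A B AK BK p X wp sp Xp.
  have dG : size p == gdist G A B by rewrite sp gdistE // (subsetP KG).
  have /forallP/(_ (Tuple dG)) := forall_inP (forall_inP h A AK) B BK.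
  by rewrite wp => /allP; apply.
apply/forall_inP => A AK; apply/forall_inP => B BK; apply/forallP => p; apply/implyP => wp.
apply/allP => X; apply: h wp _ => //; by rewrite size_tuple gdistE // (subsetP KG).
Qed.

Lemma convex_self G : steppable G -> is_convex G G.
Proof.
move=> sG; apply/convexP => //; split => // A B _ _ p X wp _ Xp.
by apply: (walk_in wp); rewrite in_cons Xp orbT.
Qed.

Lemma conv_sub G C : steppable G -> C \subset G -> conv G C \subset G.
Proof. by move=> sG CG; apply: bigcap_inf; rewrite convex_self. Qed.

Lemma sub_conv G C : C \subset conv G C.
Proof. by apply/bigcapsP => K /andP[]. Qed.

Lemma conv_walk G C A B p X : steppable G -> C \subset G -> A \in conv G C -> B \in conv G C ->
  walk G A B p -> size p = hdist A B -> X \in p -> X \in conv G C.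
Proof.
move=> sG CG AC BC wp sp Xp; apply/bigcapP => K /[dup] hK /andP[/(convexP _ sG)[KG hcK] CK].
have sub : conv G C \subset K by exact: bigcap_inf.
by apply: hcK wp sp Xp; exact: (subsetP sub).
Qed.

(** The first step of a geodesic of [G] stays in the hull by convexity, and being on a geodesic it
    flips a coordinate that has to change. *)
Lemma conv_steppable G C : steppable G -> C \subset G -> steppable (conv G C).
Proof.
move=> sG CG A B AC BC AB.
have sub := subsetP (conv_sub sG CG).
have [p wp sp] := steppable_walk sG (sub _ AC) (sub _ BC).
case: p => [|X p] in wp sp *; first by move: wp; rewrite walk_nil (negbTE AB).
have XC : X \in conv G C by apply: conv_walk wp sp (mem_head _ _).
have := walk_between wp (_ : X \in A :: X :: p); rewrite !in_cons eqxx orbT => /(_ isT).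
rewrite sp => hb; move: wp; rewrite walk_cons => /and3P[_ /cube_adjP[i Xi] _]; rewrite Xi in XC hb.
exists i => //; have := @hdist_between _ _ _ i hb.
by rewrite !in_sdiff !inE eqxx !addbT; do 2 case: (_ \in _) => // /(_ isT).
Qed.

(** Halfspaces are convex. Hence the hull of a cycle uses no coordinate beyond those crossed by the
    cycle. *)
Lemma conv_coord G C A B i : steppable G -> C \subset G -> A \in conv G C -> B \in C ->
  {in C, forall X, (i \in X) = (i \in B)} -> (i \in A) = (i \in B).
Proof.
move=> sG CG AC BC hC.
pose K := [set X in G | (i \in X) == (i \in B)].
suff : conv G C \subset K by move/subsetP/(_ _ AC); rewrite inE => /andP[_ /eqP].
apply: bigcap_inf; apply/andP; split; last first.
  by apply/subsetP => X XC; rewrite inE (subsetP CG) //= hC.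
apply/convexP => //; split; first by apply/subsetP => X; rewrite inE => /andP[].
move=> X Y; rewrite !inE => /andP[XG /eqP Xi] /andP[YG /eqP Yi] p Z wp sp Zp.
have ZX : Z \in X :: p by rewrite in_cons Zp orbT.
rewrite inE (walk_in wp ZX) /=; have hb := walk_between wp ZX; rewrite sp in hb.
have := @hdist_between _ _ _ i hb.
by rewrite !in_sdiff Xi Yi; case: (_ \in B); case: (_ \in Z) => // /(_ isT).
Qed.

End Convex.

Section Normalize.
Variables (U : finType) (n : nat).
Implicit Types (A B X : {set U}) (G : {set {set U}}) (F : {set {set 'I_n}}).

Definition init (k : nat) : {set 'I_n} := [set i : 'I_n | i < k].
Definition fin (k : nat) : {set 'I_n} := [set i : 'I_n | k <= i].

(* The initial and final segments form the boundary cycle of a pseudo-disk. *)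
Definition normal_family F := [/\ steppable F, forall Y : {set 'I_n}, shatters F Y -> #|Y| <= 2,
  forall k, k <= n -> init k \in F & forall k, k <= n -> fin k \in F].

Variables (X0 : {set U}) (e : 'I_n -> U).
(** The translation moves [X0] to the empty set, and [e] names the coordinates that remain in
    use. *)
Definition nmap A : {set 'I_n} := [set k | e k \in sdiff X0 A].

Lemma in_nmap A k : (k \in nmap A) = (e k \in X0) (+) (e k \in A).
Proof. by rewrite inE in_sdiff. Qed.

Variable G : {set {set U}}.
Hypothesis e_inj : injective e.
Hypothesis G_coord : {in G &, forall A B i, i \in sdiff A B -> exists k, e k = i}.

Lemma in_sdiff_nmap A B k : (k \in sdiff (nmap A) (nmap B)) = (e k \in sdiff A B).
Proof. by rewrite !in_sdiff !in_nmap; do 3 case: (_ \in _). Qed.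

Lemma nmap_sdiff A B : A \in G -> B \in G -> e @: sdiff (nmap A) (nmap B) = sdiff A B.
Proof.
move=> AG BG; apply/setP => i; apply/imsetP/idP => [[k]|iAB].
  by rewrite in_sdiff_nmap => h ->.
by have [k ki] := G_coord AG BG iAB; exists k; rewrite ?in_sdiff_nmap ki.
Qed.

Lemma nmap_hdist A B : A \in G -> B \in G -> hdist (nmap A) (nmap B) = hdist A B.
Proof. by move=> AG BG; rewrite /hdist -(nmap_sdiff AG BG) card_imset. Qed.

Lemma nmap_flip A k : nmap (flip A (e k)) = flip (nmap A) k.
Proof. by apply/setP => j; rewrite in_flip !in_nmap in_flip (inj_eq e_inj) addbA. Qed.

Lemma nmap_graph_iso : graph_iso G (nmap @: G).
Proof.
exists nmap; split => //.
- by move=> A B AG BG AB; apply/eqP; rewrite -hdist_eq0 -nmap_hdist // AB hdist_eq0.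
- by move=> A B AG BG; rewrite !cube_adjE nmap_hdist.
Qed.

Lemma nmap_steppable : steppable G -> steppable (nmap @: G).
Proof.
move=> sG _ _ /imsetP[A AG ->] /imsetP[B BG ->] AB.
have [|i iAB fG] := sG A B AG BG; first by apply: contra_neq AB => ->.
have [k ki] := G_coord AG BG iAB; exists k; first by rewrite in_sdiff_nmap ki.
by rewrite -nmap_flip imset_f // ki.
Qed.

Lemma nmap_shatters Y : shatters (nmap @: G) Y -> shatters G (e @: Y).
Proof.
move=> sY X XY.
have [|_ /imsetP[B BG ->] hB] := sY [set k in Y | (e k \in X0) (+) (e k \in X)].
  by apply/subsetP => k; rewrite inE => /andP[].
exists B => //; apply/setP => i; rewrite inE; apply/andP/idP => [[/imsetP[k kY ->]]|iX].
  by move/setP/(_ k) : hB; rewrite in_setI in_nmap [X in _ = X]inE kY /=; do 3 case: (_ \in _).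
have /imsetP[k kY ik] := subsetP XY _ iX; subst i; split; first by rewrite imset_f.
by move/setP/(_ k) : hB; rewrite in_setI in_nmap [X in _ = X]inE kY iX /=; do 2 case: (_ \in _).
Qed.

Lemma nmap_shatters_leq d : (forall A, shatters G A -> #|A| <= d) ->
  forall Y : {set 'I_n}, shatters (nmap @: G) Y -> #|Y| <= d.
Proof. by move=> h Y /nmap_shatters/h; rewrite card_imset. Qed.

End Normalize.

(** * Isometric cycles *)

Section Cycle.
Variable U : finType.
Implicit Types (A B X : {set U}) (G C K : {set {set U}}).

Lemma cycle_graphI C N (f : nat -> {set U}) : 3 <= N ->
  (forall i j, i < N -> j < N -> f i = f j -> i = j) ->
  (forall A, reflect (exists2 i, i < N & A = f i) (A \in C)) ->
  (forall i j, i < N -> j < N -> cube_adj (f i) (f j) = (j == i.+1 %% N) || (i == j.+1 %% N)) ->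
  cycle_graph C.
Proof.
move=> N3 f_inj fC fadj; exists (mkseq f N).
have uc : uniq (mkseq f N) by apply/mkseq_uniqP => i j; rewrite !inE; exact: f_inj.
have nextE i : i < N -> next (mkseq f N) (f i) = f (i.+1 %% N).
  move=> iN; rewrite -(nth_mkseq set0 f iN) next_nth mem_nth ?size_mkseq //.
  case E : (mkseq f N) => [|y p]; first by move/(congr1 size): E; rewrite size_mkseq /= => N0; move: N3; rewrite N0.
  rewrite -E index_uniq ?size_mkseq //.
  have sp : (size p).+1 = N by rewrite -[LHS]/(size (y :: p)) -E size_mkseq.
  have y0 : y = f 0 by rewrite -[y]/(nth set0 (y :: p) 0) -E nth_mkseq // (leq_trans _ N3).
  have [iN1|iN1] := ltnP i.+1 N.
    rewrite modn_small // (set_nth_default set0); last by rewrite -ltnS sp.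
    by rewrite -[nth _ p i]/(nth set0 (y :: p) i.+1) -E nth_mkseq.
  have -> : i.+1 = N by apply/eqP; rewrite eqn_leq iN.
  by rewrite modnn nth_default // -ltnS sp.
have mem A : (A \in C) = (A \in mkseq f N).
  apply/idP/idP => [/fC[i iN ->]|/mapP[i + ->]]; first by apply/mapP; exists i; rewrite ?mem_iota.
  by rewrite mem_iota => iN; apply/fC; exists i.
split=> //; first by rewrite size_mkseq.
move=> A B; rewrite -!mem => /fC[i iN ->] /fC[j jN ->].
have mN k : k.+1 %% N < N by rewrite ltn_mod; case: (N) N3.
rewrite !nextE // fadj //; congr (_ || _); apply/eqP/eqP => [->//|/f_inj-> //].
Qed.

(** Indexing the cycle by all of [nat] with period [N] turns [next] into the successor and leaves
    the wrap-around to congruences. *)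
Lemma cycle_graphE C : cycle_graph C -> exists N (f : nat -> {set U}),
  [/\ 3 <= N, forall i, f (i + N) = f i, forall A, A \in C <-> exists i, A = f i,
      forall i j, f i = f j -> i = j %[mod N] &
      forall i j, cube_adj (f i) (f j) -> j = i.+1 %[mod N] \/ i = j.+1 %[mod N]] /\
      forall i, cube_adj (f i) (f i.+1).
Proof.
move=> [c [c3 uc mem adj]]; pose N := size c; pose f i := nth set0 c (i %% N).
have N0 : 0 < N by apply: leq_trans c3.
have fc i : f i \in c by rewrite mem_nth // ltn_mod.
have f_inj i j : f i = f j -> i = j %[mod N].
  by move/eqP; rewrite nth_uniq ?ltn_mod // => /eqP.
have nextE i : next c (f i) = f i.+1.
  rewrite next_nth fc /f; case E : c => [|y p]; first by move: c3; rewrite E.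
  rewrite -!E index_uniq ?ltn_mod // -/N; have nthE k : nth set0 c k.+1 = nth set0 p k by rewrite E.
  have sp : (size p).+1 = N by rewrite /N E.
  have im : i %% N < N by rewrite ltn_mod.
  have [h|h] := ltnP (i %% N).+1 N.
    rewrite -[in RHS]addn1 -[in RHS]modnDml addn1 [in RHS]modn_small // nthE (set_nth_default set0) //.
    by rewrite -ltnS sp.
  have e : (i %% N).+1 = N by apply/eqP; rewrite eqn_leq im.
  rewrite -[in RHS]addn1 -[in RHS]modnDml addn1 e modnn nth_default; last by rewrite -ltnS sp e.
  by rewrite E.
exists N, f; split; first split => //.
- by move=> i; rewrite /f modnDr.
- move=> A; rewrite mem; split=> [Ac|[i ->]//].
  by exists (index A c); rewrite /f modn_small ?index_mem // nth_index.
- move=> i j; rewrite adj ?mem // !nextE => /orP[]/eqP/f_inj; [left|right]; exact: esym.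
- by move=> i; rewrite adj ?mem // nextE eqxx.
Qed.

End Cycle.

Lemma card_init n k : k <= n -> #|init n k| = k.
Proof.
move=> kn; have -> : init n k = [set widen_ord kn i | i in 'I_k].
  apply/setP => i; rewrite inE; apply/idP/imsetP => [ik|[j _ ->]]; last by rewrite /= ltn_ord.
  by exists (Ordinal ik) => //; apply: ord_inj.
by rewrite card_imset ?card_ord // => i j /(congr1 val) /= /ord_inj.
Qed.

(** Lower bound for the rank: segments cut the first two elements in all four ways. *)
Lemma normal_family_shatters n (F : {set {set 'I_n}}) : 1 < n -> normal_family F ->
  exists2 Y : {set 'I_n}, #|Y| = 2 & shatters F Y.
Proof.
move=> n1 [_ _ Fi Ff]; pose a := Ordinal (ltnW n1); pose b := Ordinal n1.
have ab : a != b by [].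
exists [set a; b]; first by rewrite cards2 ab.
have wit (X B : {set 'I_n}) : X \subset [set a; b] -> B \in F -> (a \in X) = (a \in B) -> (b \in X) = (b \in B) ->
    exists2 B, B \in F & [set a; b] :&: B = X.
  move=> XY BF ha hb; exists B => //; apply/setP => i; rewrite !inE.
  have [->|ia] /= := eqVneq i a; first by rewrite ha.
  have [->|ib] /= := eqVneq i b; first by rewrite hb.
  by apply/esym/negP => /(subsetP XY); rewrite !inE (negbTE ia) (negbTE ib).
move=> X XY; case ha: (a \in X); case hb: (b \in X).
- by apply: (wit X _ XY (Fi n (leqnn n))); rewrite ?ha ?hb inE //= ltnW.
- by apply: (wit X _ XY (Fi 1 (ltnW n1))); rewrite ?ha ?hb inE.
- by apply: (wit X _ XY (Ff 1 (ltnW n1))); rewrite ?ha ?hb inE.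
- by apply: (wit X _ XY (Fi 0 (leq0n n))); rewrite ?ha ?hb inE.
Qed.

Section CycleHull.
Variables (U : finType) (G C : {set {set U}}).
Hypotheses (sG : steppable G) (cC : isometric_cycle G C).

(** Opposite vertices of an isometric cycle of length [2 * n] are at distance [n]. So its first [n]
    steps cross distinct coordinates, listed by [e] in this order, and the other [n] steps cross
    them again in the same order. *)
Lemma isometric_cycle_coords : exists n (f : nat -> {set U}) (e : 'I_n -> U),
  [/\ 1 < n, injective e, forall A, A \in C -> exists k, A = f k,
    forall k, k <= n -> f k \in C /\ f (n + k) \in C &
    forall k, k <= n -> sdiff (f 0) (f k) = e @: init n k /\ sdiff (f 0) (f (n + k)) = e @: fin n k]
    /\ forall k, exists2 j, j < 2 * n & f k = f j.
Proof.
have [/cycle_graphE[N [f [[N3 fN fC f_inj fadj] fstep]]] [CG iso]] := cC.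
have N0 : 0 < N by apply: leq_trans N3.
have fm i : f (i %% N) = f i.
  by rewrite [in RHS](divn_eq i N) addnC; elim: (i %/ N) => [|k IH]; rewrite ?mul0n ?addn0 // mulSn addnA addnAC fN.
have fCi i : f i \in C by apply/fC; exists i.
(* The walk makes [a] steps forwards and [b] backwards; a step backwards is written as [N.-1] steps
   forwards to avoid subtraction. *)
have walkC i B p : walk C (f i) B p -> exists a b, a + b = size p /\ B = f (i + a + (N.-1) * b).
  elim: p i => [|X p IH] i; first by rewrite walk_nil => /andP[/eqP<- _]; exists 0, 0; rewrite muln0 !addn0.
  rewrite walk_cons => /and3P[_ iX wp].
  have /fC[j Xj] : X \in C by apply: (walk_in wp); rewrite mem_head.
  rewrite Xj in iX wp; have [a [b [ab Bab]]] := IH j wp.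
  have shift k k' c : k = k' %[mod N] -> f (k + c) = f (k' + c).
    by move=> kk'; rewrite -[LHS]fm -[RHS]fm -modnDml kk' modnDml.
  case: (fadj _ _ iX) => ij.
    exists a.+1, b; split; first by rewrite addSn ab.
    by rewrite Bab -addnA (shift _ _ _ ij) addnA addSnnS.
  exists a, b.+1; split; first by rewrite addnS ab.
  have ji : j = i + N.-1 %[mod N].
    apply/eqP; rewrite -(eqn_modDr 1) addn1 -addnA addn1 prednK // modnDr; exact/eqP/esym.
  by rewrite Bab -addnA (shift _ _ _ ji); congr f; rewrite mulnS; lia.
have hd_le i d : hdist (f i) (f (i + d)) <= d.
  elim: d => [|d IH]; first by rewrite addn0 leqn0 hdist_eq0.
  rewrite (leq_trans (hdist_triangle (f (i + d)) _ _)) // addnS -[X in _ <= X]addn1 leq_add //.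
  by have := fstep (i + d); rewrite cube_adjE => /eqP ->.
have hd_ge i d : d <= N -> minn d (N - d) <= hdist (f i) (f (i + d)).
  move=> dN; have := iso (f i) (f (i + d)) (fCi _) (fCi _).
  rewrite (gdistE sG) ?(subsetP CG) // => gd.
  have [|p wp sp] := @gdist_walk _ C (f i) (f (i + d)); first by rewrite gd hdist_lt.
  rewrite -gd -sp; have [a [b [ab /f_inj]]] := walkC _ _ _ wp; rewrite -ab => e.
  have e2 : a = d + b %[mod N].
    apply/eqP; rewrite -(eqn_modDl i) !addnA -(modnMDl b (i + a)).
    have -> : b * N + (i + a) = i + a + N.-1 * b + b by lia.
    by rewrite eqn_modDr; exact/eqP/esym.
  have [adb|/ltnW dba] := leqP (d + b) a; first by rewrite geq_min; lia.
  move/eqP: e2; rewrite eq_sym eqn_mod_dvd // => /dvdnP[[|q] hq]; rewrite geq_min; first by lia.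
  by have : N <= d + b - a; [rewrite hq mulSn leq_addr|lia].
(* Each step changes the parity of the distance to [f 0], and [N] steps lead back to [f 0]: the
   length [N] is even. *)
have odd0 k : odd (hdist (f 0) (f k)) = odd k.
  elim: k => [|k IH]; first by rewrite (eqP (_ : hdist (f 0) (f 0) == 0)) ?hdist_eq0.
  rewrite (odd_hdist _ (f k)) IH /=; have := fstep k; rewrite cube_adjE => /eqP ->.
  by rewrite addbT.
have oddN : ~~ odd N.
  by rewrite -odd0 -[N]add0n fN (eqP (_ : hdist (f 0) (f 0) == 0)) ?hdist_eq0.
pose n := N./2; have Nn : N = n + n by rewrite addnn even_halfK.
have n1 : 1 < n by lia.
have hd i d : d <= n -> hdist (f i) (f (i + d)) = d.
  move=> dn; apply/eqP; rewrite eqn_leq hd_le /=; apply: leq_trans (hd_ge i d _); last by lia.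
  by rewrite leq_min; lia.
pose A k := sdiff (f 0) (f k).
have cA k : k <= n -> #|A k| = k by move=> kn; have := hd 0 k kn; rewrite add0n.
have step k : exists x, f k.+1 == flip (f k) x by have /cube_adjP[x ->] := fstep k; exists x.
have [e he] : exists e : 'I_n -> U, forall k : 'I_n, f k.+1 = flip (f k) (e k).
  by exists (fun k : 'I_n => xchoose (step k)) => k; exact/eqP/(xchooseP (step k)).
have Ae (k : 'I_n) : A k.+1 = flip (A k) (e k).
  by rewrite /A he /flip sdiffA.
have eA (k : 'I_n) : e k \notin A k.
  apply/negP => h; have := cA k.+1 (ltn_ord k); rewrite Ae flip_in //.
  by have := cardsD1 (e k) (A k); rewrite h cA; [lia|exact: ltnW].
have AS (k : 'I_n) : A k.+1 = e k |: A k by rewrite Ae flip_notin.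
have Asub k k' : k <= k' -> k' <= n -> A k \subset A k'.
  elim: k' => [|k' IH]; first by rewrite leqn0 => /eqP ->.
  rewrite leq_eqVlt => /predU1P[->//|kk' kn].
  by rewrite (AS (Ordinal kn)) (subset_trans (IH kk' (ltnW kn))) // subsetUr.
have e_inj : injective e.
  suff lt (j k : 'I_n) : j < k -> e j != e k.
    by move=> j k jk; case: (ltngtP j k) => [/lt|/lt|/ord_inj //]; rewrite jk eqxx.
  move=> jk; apply: contraNneq (eA k) => <-.
  by apply: (subsetP (Asub j.+1 k jk (ltnW (ltn_ord k)))); rewrite AS setU11.
have Ainit k : k <= n -> A k = e @: init n k.
  move=> kn; apply/esym/eqP; rewrite eqEcard card_imset // cA //.
  apply/andP; split.
    apply/subsetP => _ /imsetP[j + ->]; rewrite inE => jk.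
    by apply: (subsetP (Asub j.+1 k jk kn)); rewrite AS setU11.
  by rewrite card_init.
(* The distances from [f (n + k)] to [f 0], [f n] and [f k] give the size of [A (n + k)], its
   inclusion in [A n] and its disjointness from [A k]. *)
have Afin k : k <= n -> A (n + k) = e @: fin n k.
  move=> kn.
  have c1 : #|A (n + k)| = n - k.
    have := hd (n + k) (n - k) (leq_subr _ _); rewrite hdistC -addnA subnKC // -Nn.
    by rewrite -{1}[N]add0n fN.
  have c2 : #|sdiff (A n) (A (n + k))| = k.
    have := hd n k kn; rewrite /hdist /A => {2}<-; congr #|pred_of_set _|.
    by rewrite [sdiff (f 0) (f n)]sdiffC -sdiffA sdiffK.
  have c3 : #|sdiff (A k) (A (n + k))| = n.
    have := hd k n (leqnn n); rewrite /hdist /A addnC => {2}<-; congr #|pred_of_set _|.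
    by rewrite [sdiff (f 0) (f k)]sdiffC -sdiffA sdiffK.
  have s1 := card_sdiff (A n) (A (n + k)); rewrite c1 c2 cA // in s1.
  have s2 := card_sdiff (A k) (A (n + k)); rewrite c1 c3 cA // in s2.
  have k1 : A n :&: A (n + k) = A (n + k).
    by apply/eqP; rewrite eqEcard subsetIr /=; lia.
  have k2 : A k :&: A (n + k) = set0 by apply/eqP; rewrite -cards_eq0; lia.
  have k3 : A (n + k) \subset A n :\: A k.
    rewrite subsetD -{1}k1 subsetIl /= -setI_eq0 setIC; exact/eqP.
  have -> : A (n + k) = A n :\: A k.
    apply/eqP; by rewrite eqEcard k3 c1 cardsD (setIidPr (Asub k n kn (leqnn n))) !cA //=.
  rewrite !Ainit //; apply/setP => x; rewrite in_setD; apply/andP/imsetP.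
    move=> [nx /imsetP[j _ xj]]; exists j => //; rewrite inE leqNgt.
    by apply: contra nx => jk; rewrite xj imset_f // inE.
  move=> [j + ->]; rewrite inE => kj; split; last by rewrite imset_f // inE ltn_ord.
  by apply/negP => /imsetP[j' + /e_inj jj']; rewrite -jj' inE ltnNge kj.
exists n, f, e; split; first split => //.
- by move=> X /fC.
- by move=> k kn; rewrite -Ainit // -Afin.
- move=> k; exists (k %% N); last by rewrite fm.
  by rewrite (leq_trans (ltn_pmod _ _)) // Nn; lia.
Qed.

Lemma cycle_hull_normal : vcdim G <= 2 -> exists n (F : {set {set 'I_n}}),
  [/\ 1 < n, normal_family F, graph_iso (conv G C) F & 2 <= vcdim (conv G C)].
Proof.
move=> /vcdim_leq v2.
have [n [f [e [[n1 e_inj Cf fC fA] fmod]]]] := isometric_cycle_coords.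
have CG : C \subset G by case: cC => _ [].
pose D := conv G C.
have DG := subsetP (conv_sub sG CG).
have f0C : f 0 \in C by have [] := fC 0 (leq0n n).
have coordC A i : A \in C -> i \in sdiff (f 0) A -> exists k, e k = i.
  move=> /Cf[k ->]; have [j jn ->] := fmod k.
  have [jn'|jn'] := leqP j n.
    by rewrite (fA j jn').1 => /imsetP[x _ ->]; exists x.
  have -> : j = n + (j - n) by lia.
  by rewrite (fA (j - n) _).2; [move=> /imsetP[x _ ->]; exists x|lia].
have coord0 A i : A \in D -> i \in sdiff (f 0) A -> exists k, e k = i.
  move=> AD iA; have [/existsP[k /eqP]|/existsPn h] := boolP [exists k, e k == i]; first by exists k.
  have := @conv_coord _ G C A (f 0) i sG CG AD f0C.
  move: iA; rewrite in_sdiff => /[swap] -> //; first by rewrite addbb.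
  move=> X XC; apply/eqP/negPn/negP => ne.
  have [|k ek] := coordC X i XC; first by rewrite in_sdiff addbC -negb_eqb.
  by have := h k; rewrite ek eqxx.
have coord : {in D &, forall A B i, i \in sdiff A B -> exists k, e k = i}.
  move=> A B AD BD i; rewrite in_sdiff => iAB.
  have [h|h] := boolP (i \in sdiff (f 0) A); first exact: coord0 h.
  by apply: (coord0 B) => //; move: iAB h; rewrite !in_sdiff; do 3 case: (_ \in _).
have CD := subsetP (sub_conv G C).
have nF : normal_family (nmap (f 0) e @: D); last first.
  exists n, (nmap (f 0) e @: D); split => //; first exact: nmap_graph_iso.
  have [Y Y2 /nmap_shatters/shatteredP sY] := normal_family_shatters n1 nF.
  by rewrite -Y2 -(card_imset _ e_inj); exact: leq_bigmax_cond.
split.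
- by apply: nmap_steppable => //; exact: conv_steppable.
- apply: nmap_shatters_leq => // A sA; apply: v2 => X /sA[B BD AB].
  by exists B => //; exact: DG.
- move=> k kn; apply/imsetP; exists (f k); first by apply: CD; have [] := fC k kn.
  by apply/setP => x; rewrite [in RHS]inE (fA k kn).1 mem_imset.
- move=> k kn; apply/imsetP; exists (f (n + k)); first by apply: CD; have [] := fC k kn.
  by apply/setP => x; rewrite [in RHS]inE (fA k kn).2 mem_imset.
Qed.

End CycleHull.

(** * The rim of a normalized family as an isometric cycle *)

Section BoundaryCycle.
Variables (n : nat) (n1 : 1 < n).

(* For [k < n] this is [init k], for [n <= k < 2n] it is [fin (k - n)]. *)
Definition rim (k : nat) : {set 'I_n} := [set i : 'I_n | i < k %% (n + n) <= i + n].

Lemma modn_bound k : k %% (n + n) < n + n.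
Proof. by rewrite ltn_mod; lia. Qed.

Lemma rim_mod k : rim (k %% (n + n)) = rim k.
Proof. by apply/setP => i; rewrite !inE modn_mod. Qed.

Lemma rim_init k : k <= n -> rim k = init n k.
Proof. by move=> kn; apply/setP => i; rewrite !inE modn_small; lia. Qed.

Lemma rim_fin k : k <= n -> rim (n + k) = fin n k.
Proof.
move=> kn; apply/setP => i; rewrite !inE; have := ltn_ord i.
have [->|kn'] := eqVneq k n; first by rewrite modnn; lia.
by rewrite modn_small; lia.
Qed.

Lemma rim_opposite k : rim (k + n) = ~: rim k.
Proof.
apply/setP => i; rewrite !inE -modnDml; have := ltn_ord i; have := modn_bound k.
move: (k %% _) => {}k kb.
have [h|h] := ltnP (k + n) (n + n); first by rewrite modn_small //; lia.
have -> : k + n = (k - n) + (n + n) by lia.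
by rewrite modnDr modn_small; lia.
Qed.

Lemma rim_step k : cube_adj (rim k) (rim k.+1).
Proof.
apply/cube_adjP; rewrite -(rim_mod k) -(rim_mod k.+1) -(addn1 k) -modnDml addn1.
have := modn_bound k; move: (k %% _) => {}k kb.
have xn : k %% n < n by rewrite ltn_mod; lia.
exists (Ordinal xn); apply/setP => i; rewrite in_flip !inE -val_eqE /=; have ib := ltn_ord i.
have -> : k %% (n + n) = k by rewrite modn_small.
have -> : k %% n = if k < n then k else k - n.
  case: ifP => h; first by rewrite modn_small.
  have -> : k = (k - n) + n by lia.
  by rewrite modnDr modn_small; lia.
have [h|h] := ltnP k.+1 (n + n).
  by rewrite !modn_small //; case: ifP => h'; lia.
have -> : k.+1 = n + n by lia.
by rewrite modnn mod0n; case: ifP => h'; lia.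
Qed.

(** Counting steps bounds the distance from above; the lower bound is the triangle inequality
    towards the opposite vertex, which is the complement and so has distance [n]. *)
Lemma rim_hdist k d : d <= n -> hdist (rim k) (rim (k + d)) = d.
Proof.
have le j c : hdist (rim j) (rim (j + c)) <= c.
  elim: c => [|c IH]; first by rewrite addn0 leqn0 hdist_eq0.
  rewrite (leq_trans (hdist_triangle (rim (j + c)) _ _)) // addnS -[X in _ <= X]addn1 leq_add //.
  by have := rim_step (j + c); rewrite cube_adjE => /eqP ->.
move=> dn; apply/eqP; rewrite eqn_leq le /=.
have full : hdist (rim k) (rim (k + n)) = n.
  rewrite rim_opposite /hdist (_ : sdiff _ _ = setT) ?cardsT ?card_ord //.
  by apply/setP => i; rewrite in_sdiff !inE; case: (_ && _).
have := hdist_triangle (rim (k + d)) (rim k) (rim (k + n)); rewrite full.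
by have := le (k + d) (n - d); rewrite -addnA subnKC //; lia.
Qed.

Variables (U : finType) (D : {set {set U}}) (F : {set {set 'I_n}}).
Hypotheses (sD : steppable D) (nF : normal_family F) (FD : graph_iso F D).

(** The rim contains the empty and the full set, and every member of [F] lies on a geodesic between
    these two; so the hull of the rim is everything. *)
Lemma normal_isometric_cycle : exists C, isometric_cycle D C /\ conv D C = D.
Proof.
have [g [g_inj gF g_adj]] := FD; have [sF _ Finit Ffin] := nF.
have gD A : A \in F -> g A \in D by move=> AF; rewrite -gF imset_f.
have g_hdist := iso_hdist sF sD g_inj gF g_adj.
pose N := n + n.
have rimF k : rim k \in F.
  rewrite -rim_mod; have := modn_bound k; move: (k %% _) => {}k kb.
  have [kn|kn] := leqP k n; first by rewrite rim_init // Finit.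
  have -> : k = n + (k - n) by lia.
  by rewrite rim_fin ?Ffin //; lia.
pose C := [set g (rim (k : 'I_N)) | k in 'I_N].
have inC A : reflect (exists2 k, k < N & A = g (rim k)) (A \in C).
  apply: (iffP imsetP) => [[k _ ->]|[k kN ->]]; first by exists k.
  by exists (Ordinal kN).
have rimC k : g (rim k) \in C.
  by apply/inC; exists (k %% N); [exact: modn_bound|rewrite rim_mod].
have CD : C \subset D by apply/subsetP => _ /inC[k _ ->]; exact/gD/rimF.
have rim_adj i j : i < N -> j < N -> cube_adj (rim i) (rim j) = (j == i.+1 %% N) || (i == j.+1 %% N).
  have main a b : a <= b -> b < N -> cube_adj (rim a) (rim b) = (b == a.+1 %% N) || (a == b.+1 %% N).
    move=> ab bN.
    have d1 : hdist (rim a) (rim b) = minn (b - a) (N - (b - a)).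
      have [h|h] := leqP (b - a) n.
        have := rim_hdist a h; rewrite subnKC // => ->; symmetry; apply/minn_idPl; rewrite /N; lia.
      have h2 : N - (b - a) <= n by rewrite /N; lia.
      have := rim_hdist b h2.
      have -> : rim (b + (N - (b - a))) = rim a.
        have -> : b + (N - (b - a)) = a + N by lia.
        by rewrite -rim_mod modnDr rim_mod.
      by rewrite hdistC => ->; symmetry; apply/minn_idPr; rewrite /N in h2 *; lia.
    rewrite cube_adjE d1; have -> : a.+1 %% N = if a.+1 == N then 0 else a.+1.
      by case: eqP => [->|h]; [rewrite modnn|rewrite modn_small //; lia].
    have -> : b.+1 %% N = if b.+1 == N then 0 else b.+1.
      by case: eqP => [->|h]; [rewrite modnn|rewrite modn_small //; lia].
    have N4 : 4 <= N by rewrite /N; lia.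
    by clear -N4 bN ab; case: (a.+1 =P N) => ha; case: (b.+1 =P N) => hb; lia.
  move=> iN jN; have [ij|/ltnW ji] := leqP i j; first exact: main.
  by rewrite cube_adjC main // orbC.
have rim_inj i j : i < N -> j < N -> rim i = rim j -> i = j.
  have main a b : a < b -> b < N -> rim a = rim b -> False.
    move=> ab bN e; have [h|h] := leqP (b - a) n.
      by have := rim_hdist a h; rewrite subnKC ?(ltnW ab) // e (eqP (_ : hdist _ _ == 0)) ?hdist_eq0 //; lia.
    have h2 : N - (b - a) <= n by rewrite /N; lia.
    have := rim_hdist b h2.
    have -> : b + (N - (b - a)) = a + N by lia.
    rewrite -(rim_mod (a + N)) modnDr rim_mod e (eqP (_ : hdist _ _ == 0)) ?hdist_eq0 //; lia.
  by move=> iN jN e; case: (ltngtP i j) => // [/main|/main] h; exfalso; apply: h.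
have walkC k d : walk C (g (rim k)) (g (rim (k + d))) [seq g (rim j) | j <- iota k.+1 d].
  elim: d k => [|d IH] k; first by rewrite addn0 walk_nil eqxx rimC.
  rewrite /= walk_cons rimC g_adj ?rimF // rim_step /= addnS -addSn; exact: IH.
have geoC A B : A \in C -> B \in C -> exists2 p, walk C A B p & size p = hdist A B.
  have main a b : a <= b -> b < N -> exists2 p, walk C (g (rim a)) (g (rim b)) p & size p = hdist (g (rim a)) (g (rim b)).
    move=> ab bN; rewrite g_hdist ?rimF //; have [h|h] := leqP (b - a) n.
      have := walkC a (b - a); rewrite subnKC // => w.
      exists [seq g (rim j) | j <- iota a.+1 (b - a)] => //.
      by rewrite size_map size_iota -[in RHS](subnKC ab) rim_hdist.
    have h2 : N - (b - a) <= n by rewrite /N; lia.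
    have e : rim (b + (N - (b - a))) = rim a.
      have -> : b + (N - (b - a)) = a + N by lia.
      by rewrite -rim_mod modnDr rim_mod.
    have /walk_rev[p wp sp] := walkC b (N - (b - a)); rewrite e in wp; exists p => //.
    by rewrite sp size_map size_iota hdistC -[in RHS]e rim_hdist.
  move=> /inC[i iN ->] /inC[j jN ->]; have [ij|/ltnW ji] := leqP i j; first exact: main.
  have [p /walk_rev[q wq sq] sp] := main j i ji iN; exists q => //.
  by rewrite sq sp hdistC.
have iC : isometric_cycle D C.
  split; last split => //.
    apply: (@cycle_graphI _ C N (fun k => g (rim k))) => //; first by rewrite /N; lia.
      by move=> i j iN jN /g_inj e; apply: rim_inj => //; apply: e; exact: rimF.
    by move=> i j iN jN; rewrite g_adj ?rimF // rim_adj.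
  move=> A B AC BC; have [p wp sp] := geoC A B AC BC.
  by rewrite (gdist_eq wp sp) gdistE // (subsetP CD).
exists C; split => //; apply/eqP; rewrite eqEsubset conv_sub //=.
apply/subsetP => A AD; have /imsetP[X XF ->] : A \in g @: F by rewrite gF.
have F0 : init n 0 \in F by exact: Finit.
have FT : init n n \in F by exact: Finit.
have E0 : init n 0 = set0 by apply/setP => i; rewrite !inE.
have ET : init n n = setT by apply/setP => i; rewrite !inE ltn_ord.
have [p wp sp] := steppable_walk sF F0 XF; have [q wq sq] := steppable_walk sF XF FT.
have wg Y Z r : walk F Y Z r -> walk D (g Y) (g Z) (map g r).
  by apply: walk_map => // Y' Z' Y'F Z'F; rewrite g_adj.
have gC k : k <= n -> g (init n k) \in C by move=> kn; rewrite -rim_init.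
have sub := subsetP (sub_conv D C).
have hX : hdist (init n 0) X + hdist X (init n n) = n.
  rewrite /hdist E0 ET sdiffC sdiff0.
  have -> : sdiff X setT = ~: X by apply/setP => i; rewrite in_sdiff !inE addbT.
  by rewrite cardsC card_ord.
have [->|X0] := eqVneq X (init n 0); first exact: (sub _ (gC 0 (leq0n n))).
have wpq := walk_cat (wg _ _ _ wp) (wg _ _ _ wq).
apply: (conv_walk sD CD (sub _ (gC 0 _)) (sub _ (gC n _)) wpq) => //.
  rewrite g_hdist // size_cat !size_map sp sq hX.
  by rewrite /hdist E0 ET sdiffC sdiff0 cardsT card_ord.
rewrite mem_cat; apply/orP; left; case/and3P: wp => _ /eqP <- _; apply: map_f.
case: (p) sp => [|Y r] /=; last by rewrite mem_last.
by move/esym/eqP; rewrite hdist_eq0 eq_sym (negbTE X0).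
Qed.

End BoundaryCycle.

(** * A linear order from antipodal edges *)

Section SignFamily.
Variables (n : nat) (S : {set {set 'I_n}}).
Hypotheses (n0 : 0 < n) (sS : steppable S) (aS : antipodal_edges S)
  (vS : forall Y : {set 'I_n}, shatters S Y -> #|Y| <= 2).
Implicit Types (A Z : {set 'I_n}) (i j k : 'I_n).

(** After translation by [X0], each direction [j] yields a set [s j] avoiding [j] such that [s j],
    its complement and both flipped at [j] are in the family. Membership of [i] in [s j] is to mean
    that [i] precedes [j]. A failure of totality, antisymmetry or transitivity would shatter three
    elements. In the resulting order the [s j] are initial segments and their complements final
    ones. *)
Lemma normal_iso : exists F : {set {set 'I_n}}, normal_family F /\ graph_iso S F.
Proof.
pose j0 := Ordinal n0; have [X0 [X0S X1S X2S X3S]] := aS j0.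
pose P A := sdiff X0 A \in S.
pose Q j Z := [&& P Z, P (flip Z j), P (~: Z) & P (~: (flip Z j))].
have sdC A : sdiff X0 (~: A) = ~: sdiff X0 A by apply/setP => i; rewrite !in_setC !in_sdiff in_setC addbN.
have flC A j : ~: flip A j = flip (~: A) j by apply/setP => i; rewrite in_flip !in_setC in_flip addNb.
have sdF A j : sdiff X0 (flip A j) = flip (sdiff X0 A) j by rewrite /flip sdiffA.
have Qf j Z : Q j Z -> Q j (flip Z j) by rewrite /Q flipK => /and4P[-> -> -> ->].
have Qc j Z : Q j Z -> Q j (~: Z) by rewrite /Q -!flC !setCK => /and4P[-> -> -> ->].
have Q0 : Q j0 set0 by rewrite /Q /P !sdC !sdF sdiff0 X0S X1S X2S X3S.
(* Two of the four sets supplied for direction [j] avoid [j], and they are complementary elsewhere;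
   choosing the one without [j0] makes [j0] the last element of the order. *)
have [s hs] : exists s : 'I_n -> {set 'I_n}, forall j, [/\ Q j (s j), j \notin s j &
    if j == j0 then s j == ~: [set j0] else j0 \notin s j].
  suff h j : exists Z, [&& Q j Z, j \notin Z & if j == j0 then Z == ~: [set j0] else j0 \notin Z].
    by exists (fun j => xchoose (h j)) => j; have /and3P := xchooseP (h j).
  have [->|jj0] := eqVneq j j0.
    have f0 : flip set0 j0 = [set j0] by rewrite /flip sdiffC sdiff0.
    by exists (~: flip set0 j0); rewrite Qc ?Qf //= f0 in_setC in_set1 eqxx /=.
  have [Z [QZ jZ]] : exists Z, Q j Z /\ j \notin Z.
    have [X [XS X1 X2 X3]] := aS j; pose Z := sdiff X0 X.
    have QZ : Q j Z by rewrite /Q /P !(sdC, sdF) /Z sdiffK XS X1 X2 X3.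
    have [jZ|jZ] := boolP (j \in Z); last by exists Z.
    by exists (flip Z j); split; [exact: Qf|rewrite in_flip jZ eqxx].
  have [j0Z|j0Z] := boolP (j0 \in Z); last by exists Z; rewrite QZ jZ.
  exists (~: flip Z j); rewrite Qc ?Qf //= !in_setC !in_flip eqxx (negbTE jZ) j0Z /=.
  by rewrite eq_sym (negbTE jj0).
have s0 i : (i \in s j0) = (i != j0).
  by have [_ _] := hs j0; rewrite eqxx => /eqP ->; rewrite !inE.
have j0s j : j0 \notin s j.
  by have [->|jj0] := eqVneq j j0; [rewrite s0 eqxx|have [_ _] := hs j; rewrite (negbTE jj0)].
have js j : j \notin s j by case: (hs j).
have pat j b1 b2 : exists A, [/\ P A, (j \in A) = b1 & forall i, i != j -> (i \in A) = (i \in s j) (+) b2].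
  have [/and4P[q1 q2 q3 q4] jsj _] := hs j; have jf := negbTE jsj.
  have nf i : i != j -> (i == j) = false by move/negbTE.
  case: b1 b2 => [] [].
  - by exists (~: s j); rewrite in_setC jf; split => // i _; rewrite in_setC addbT.
  - by exists (flip (s j) j); rewrite in_flip jf eqxx; split => // i /nf ij; rewrite in_flip ij.
  - by exists (~: flip (s j) j); rewrite in_setC in_flip jf eqxx; split => // i /nf ij; rewrite in_setC in_flip ij addbF addbT.
  - by exists (s j); rewrite jf; split => // i _; rewrite addbF.
have no8 i j k : i != j -> j != k -> k != i -> ~ forall x y z : bool, exists A,
    [/\ P A, (i \in A) = x, (j \in A) = y & (k \in A) = z].
  move=> ij jk ki h; have c3 : #|[set i; j; k]| = 3.
    by rewrite -setUA cardsU1 cards2 !inE negb_or ij [i == k]eq_sym ki jk.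
  suff sh : shatters S [set i; j; k] by have := vS sh; rewrite c3.
  move=> Y YS.
  have [A [PA Ai Aj Ak]] := h ((i \in X0) (+) (i \in Y)) ((j \in X0) (+) (j \in Y)) ((k \in X0) (+) (k \in Y)).
  exists (sdiff X0 A) => //; apply/setP => x; rewrite in_setI in_sdiff.
  have [xs|xs] := boolP (x \in [set i; j; k]); last by rewrite (contraNF (subsetP YS x) xs).
  by move: xs; rewrite !inE -orbA => /or3P[] /eqP ->; rewrite ?Ai ?Aj ?Ak addbA addbb.
(* Otherwise the edges of directions [j0], [i] and [j] show all eight patterns on these three
   elements; direction [j0] serves the patterns in which [i] and [j] agree. *)
have tour i j : i != j -> (i \in s j) (+) (j \in s i).
  move=> ij; have ji : j != i by rewrite eq_sym.
  have [ij0|ij0] := eqVneq i j0; first by rewrite ij0 (negbTE (j0s j)) s0 -ij0 ji.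
  have [jj0|jj0] := eqVneq j j0; first by rewrite jj0 (negbTE (j0s i)) s0 -jj0 ij.
  apply: contraT => /negbTE e; have {}e : (i \in s j) = (j \in s i) by move: e; do 2 case: (_ \in _).
  exfalso; apply: (no8 j0 i j) => //; first by rewrite eq_sym.
  move=> x y z; have [yz|yz] := eqVneq y z.
    have [A [PA A0 Ai]] := pat j0 x (~~ y); exists A.
    by split; rewrite // Ai // s0 ?ij0 ?jj0 -?yz /= negbK.
  have [h|h] := eqVneq ((i \in s j) (+) x) z.
    have [A [PA A0 Ai]] := pat i y x; exists A; split => //; last by rewrite Ai // -e h.
    by rewrite Ai 1?eq_sym // (negbTE (j0s i)).
  have [A [PA A0 Ai]] := pat j z x; exists A; split => //.
    by rewrite Ai 1?eq_sym // (negbTE (j0s j)).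
  by rewrite Ai //; move: h yz; case: (_ (+) _); case: (y); case: (z).
(* A failure is a cyclic triple, on which the edges of directions [i], [j] and [j0] again show all
   eight patterns. *)
have trans i j k : i \in s j -> j \in s k -> i \in s k.
  move=> ij jk.
  have nij : i != j by apply: contraTneq ij => ->.
  have njk : j != k by apply: contraTneq jk => ->.
  have ji : j \notin s i by have := tour i j nij; rewrite ij.
  have kj : k \notin s j by have := tour j k njk; rewrite jk.
  have nik : k != i by apply: contraNneq kj => ->.
  apply: contraT => ik; have ki : k \in s i by have := tour k i nik; rewrite (negbTE ik) addbF.
  have i0 : i != j0 by apply: contraTneq ij => ->; rewrite j0s.
  have j0' : j != j0 by apply: contraTneq jk => ->; rewrite j0s.
  have k0 : k != j0 by apply: contraTneq ki => ->; rewrite j0s.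
  exfalso; apply: (no8 i j k) => // x y z.
  have [yz|yz] := eqVneq y z; last first.
    have [A [PA A0 Ai]] := pat i x y; exists A; split => //.
      by rewrite Ai 1?eq_sym // (negbTE ji).
    by rewrite Ai // ki; move: yz; case: (y); case: (z).
  have [xy|xy] := eqVneq x y.
    have [A [PA A0 Ai]] := pat j0 true (~~ x); exists A; split => //.
    - by rewrite Ai // s0 i0 /= negbK.
    - by rewrite Ai // s0 j0' /= negbK.
    - by rewrite Ai // s0 k0 /= negbK -yz.
  have [A [PA A0 Ai]] := pat j y z; exists A; split => //.
    by rewrite Ai // ij -yz; move: xy; case: (x); case: (y).
  by rewrite Ai 1?eq_sym // (negbTE kj).
have rlt j : #|s j| < n.
  by rewrite -[X in _ < X](card_ord n) -cardsT; apply: proper_card; rewrite properE subsetT; apply/subsetPn; exists j; rewrite ?inE.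
pose r j := Ordinal (rlt j).
have rmono i j : i \in s j -> r i < r j.
  move=> ij; apply: proper_card; rewrite properE; apply/andP; split.
    by apply/subsetP => k ki; exact: trans ki ij.
  by apply/subsetPn; exists i.
have rE i j : (i \in s j) = (r i < r j).
  apply/idP/idP; first exact: rmono.
  apply: contraTT => nij; rewrite -leqNgt; have [->//|ij] := eqVneq i j.
  by apply/ltnW/rmono; have := tour i j ij; rewrite (negbTE nij).
have r_inj : injective r.
  move=> i j rij; apply/eqP; apply: contraT => /tour.
  by rewrite !rE rij ltnn.
pose e := invF r_inj.
have re k : r (e k) = k by exact: f_invF.
have er j : e (r j) = j by exact: invF_f.
have e_inj : injective e by exact: (can_inj re).
have coord : {in S &, forall A B i, i \in sdiff A B -> exists k, e k = i} by move=> A B _ _ i _; exists (r i).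
exists (nmap X0 e @: S); split; last exact: nmap_graph_iso.
have mem A (Y : {set 'I_n}) : P A -> (forall x, (e x \in A) = (x \in Y)) -> Y \in nmap X0 e @: S.
  move=> PA h; apply/imsetP; exists (sdiff X0 A) => //.
  by apply/setP => x; rewrite inE sdiffK h.
have es x y : (e x \in s (e y)) = (x < y) by rewrite rE !re.
have n1 : n.-1 < n by rewrite prednK.
split; [exact: nmap_steppable|exact: nmap_shatters_leq| |] => k; rewrite leq_eqVlt => /predU1P[->|kn].
- have [A [PA Aj Ai]] := pat (e (Ordinal n1)) true false; apply: (mem A _ PA) => x; rewrite inE ltn_ord.
  have [->//|xk] := eqVneq x (Ordinal n1); rewrite Ai ?(inj_eq e_inj) // es addbF /=.
  by move: xk; rewrite -val_eqE /=; have := ltn_ord x; lia.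
- have [A [PA Aj Ai]] := pat (e (Ordinal kn)) false false; apply: (mem A _ PA) => x; rewrite inE.
  have [->|xk] := eqVneq x (Ordinal kn); first by rewrite Aj ltnn.
  by rewrite Ai ?(inj_eq e_inj) // es addbF.
- have [A [PA Aj Ai]] := pat (e (Ordinal n1)) false true; apply: (mem A _ PA) => x; rewrite inE leqNgt ltn_ord.
  have [->//|xk] := eqVneq x (Ordinal n1); rewrite Ai ?(inj_eq e_inj) // es addbT /=.
  by move: xk; rewrite -val_eqE /=; have := ltn_ord x; lia.
- have [A [PA Aj Ai]] := pat (e (Ordinal kn)) true true; apply: (mem A _ PA) => x; rewrite inE.
  have [->|xk] := eqVneq x (Ordinal kn); first by rewrite Aj leqnn.
  by rewrite Ai ?(inj_eq e_inj) // es addbT -leqNgt.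
Qed.

End SignFamily.

(** * Sweeping a normalized family *)

Section Sweep.
Variables (n : nat) (F : {set {set 'I_n}}).
Hypothesis nF : normal_family F.
Implicit Types (A B C X Y Z : {set 'I_n}) (i j : 'I_n) (k l : nat).

Let sF : steppable F. Proof. by case: nF. Qed.
Let initF k : k <= n -> init n k \in F. Proof. by case: nF => _ _ + _; apply. Qed.
Let finF k : k <= n -> fin n k \in F. Proof. by case: nF => _ _ _; apply. Qed.

(* With the six traces of the initial and final segments on [{i, j, k}], the traces [{i, k}] of [A] and
   [{j}] of [B] would shatter it. *)
Lemma strongly_separated A B (i j k : 'I_n) : A \in F -> B \in F -> i < j -> j < k ->
  i \in A -> i \notin B -> k \in A -> k \notin B -> j \in B -> j \notin A -> False.
Proof.
move=> AF BF ij jk iA iB kA kB jB jA.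
have vF : forall Y : {set 'I_n}, shatters F Y -> #|Y| <= 2 by case: nF.
have ne (x y : 'I_n) : x < y -> x != y by apply: contraTneq => ->; rewrite ltnn.
have := vF [set i; j; k]; have -> : #|[set i; j; k]| = 3.
  by rewrite -setUA cardsU1 cards2 !inE negb_or (ne i j) // (ne j k) // (ne i k) // (ltn_trans ij).
move=> H; suff /H : shatters F [set i; j; k] by [].
move=> Y YS.
suff [C CF [Ci Cj Ck]] : exists2 C, C \in F & [/\ (i \in C) = (i \in Y), (j \in C) = (j \in Y) & (k \in C) = (k \in Y)].
  exists C => //; apply/setP => x; rewrite in_setI.
  have [xs|xs] := boolP (x \in [set i; j; k]); last by rewrite (contraNF (subsetP YS x) xs).
  by move: xs; rewrite !inE -orbA => /or3P[] /eqP ->; rewrite ?Ci ?Cj ?Ck.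
have := ltn_ord i; have := ltn_ord j; have := ltn_ord k => kn jn iN.
case iY : (i \in Y); case jY : (j \in Y); case kY : (k \in Y).
- by exists (init n n); rewrite ?initF // !inE kn jn iN.
- by exists (init n k); rewrite ?initF ?(ltnW kn) // !inE ltnn jk (ltn_trans ij).
- by exists A; rewrite ?iA ?kA ?(negbTE jA).
- by exists (init n j); rewrite ?initF ?(ltnW jn) // !inE ltnn ij ltnNge (ltnW jk).
- by exists (fin n j); rewrite ?finF ?(ltnW jn) // !inE leqnn leqNgt ij (ltnW jk).
- by exists B; rewrite ?jB ?(negbTE iB) ?(negbTE kB).
- by exists (fin n k); rewrite ?finF ?(ltnW kn) // !inE leqnn (leqNgt k j) (leqNgt k i) jk (ltn_trans ij).
- by exists (init n 0); rewrite ?initF // !inE.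
Qed.

(** Otherwise three elements would lie alternately in [A :\: B] and [B :\: A]. *)
Lemma separated_lt A B (x y x' y' : 'I_n) : A \in F -> B \in F ->
  x \in A -> x \notin B -> y \in B -> y \notin A -> x < y ->
  x' \in A -> x' \notin B -> y' \in B -> y' \notin A -> x' < y'.
Proof.
move=> AF BF xA xB yB yA xy x'A x'B y'B y'A.
have lt (u v : 'I_n) : u \in A -> v \notin A -> ~~ (u < v) -> v < u.
  move=> uA vA; rewrite -leqNgt leq_eqVlt => /predU1P[vu|//].
  by move: vA; rewrite (ord_inj vu) uA.
have x'y : x' < y.
  by apply: contraT => /(lt _ _ x'A yA) h; exfalso; apply: (strongly_separated AF BF xy h).
apply: contraT => /(lt _ _ x'A y'A) h; exfalso; exact: (strongly_separated BF AF h x'y).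
Qed.

(* Strong separation makes the weight injective on the members of [F] of a given size. *)
Definition weight A := \sum_(i in A) i.

Lemma weight_diff A B : weight A + weight (B :\: A) = weight B + weight (A :\: B).
Proof.
rewrite /weight (big_setID B) /= [in RHS](big_setID A) /= setIC.
by rewrite -!addnA [X in _ + X]addnC.
Qed.

Lemma weight_lt A B (x y : 'I_n) : A \in F -> B \in F -> #|A| = #|B| ->
  x \in A -> x \notin B -> y \in B -> y \notin A -> x < y -> weight A < weight B.
Proof.
move=> AF BF AB xA xB yB yA xy.
have cD : #|A :\: B| = #|B :\: A| by have := cardsID B A; have := cardsID A B; rewrite setIC AB; lia.
have [m mA mmax] := @arg_maxnP _ x (fun i => i \in A :\: B) val (introT setDP (conj xA xB)).
have /setDP[mA' mB'] := mA.
have hA : weight (A :\: B) <= #|A :\: B| * m.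
  by rewrite /weight -sum_nat_const; apply: leq_sum => i iA; exact: mmax.
have hB : #|B :\: A| * m.+1 <= weight (B :\: A).
  rewrite /weight -sum_nat_const; apply: leq_sum => i /setDP[iB iA].
  exact: (separated_lt AF BF xA xB yB yA xy mA' mB' iB iA).
have : 0 < #|B :\: A| by apply/card_gt0P; exists y; rewrite inE yA.
have := weight_diff A B; move: hA hB; rewrite cD; clear; nia.
Qed.

Lemma same_card_diff A B : #|A| = #|B| -> A != B -> exists x y, [/\ x \in A, x \notin B, y \in B & y \notin A].
Proof.
move=> AB nAB.
have h X Y : #|X| = #|Y| -> X != Y -> exists2 x, x \in X & x \notin Y.
  by move=> cXY nXY; apply/subsetPn; apply: contra nXY => s; rewrite eqEcard s cXY /=.
have nBA : B != A by rewrite eq_sym.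
have [x xA xB] := h _ _ AB nAB; have [y yB yA] := h _ _ (esym AB) nBA.
by exists x, y.
Qed.

Lemma weight_ltP A B (x y : 'I_n) : A \in F -> B \in F -> #|A| = #|B| -> weight A < weight B ->
  x \in A -> x \notin B -> y \in B -> y \notin A -> x < y.
Proof.
move=> AF BF AB wAB xA xB yB yA; rewrite ltnNge leq_eqVlt; apply/negP => /predU1P[/ord_inj yx|yx].
  by move: yA; rewrite yx xA.
by have := ltn_trans wAB (weight_lt BF AF (esym AB) yB yA xA xB yx); rewrite ltnn.
Qed.

Lemma weight_inj A B : A \in F -> B \in F -> #|A| = #|B| -> weight A = weight B -> A = B.
Proof.
move=> AF BF AB wAB; apply/eqP; apply: contraT => /(same_card_diff AB)[x [y [xA xB yB yA]]].
case: (ltngtP x y) => [xy|yx|/ord_inj xy].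
- by have := weight_lt AF BF AB xA xB yB yA xy; rewrite wAB ltnn.
- by have := weight_lt BF AF (esym AB) yB yA xA xB yx; rewrite wAB ltnn.
- by move: yA; rewrite -xy xA.
Qed.

(* Edges between consecutive levels do not cross. *)
Lemma weight_mono A A' B B' : A \in F -> A' \in F -> B \in F -> B' \in F ->
  A \subset A' -> B \subset B' -> #|A| = #|B| -> #|A'| = #|A|.+1 -> #|B'| = #|B|.+1 ->
  weight A < weight B -> weight A' <= weight B'.
Proof.
move=> AF A'F BF B'F AA' BB' AB cA' cB' wAB; rewrite leqNgt; apply/negP => wBA'.
have cBA : #|B'| = #|A'| by rewrite cA' cB' AB.
have one X X' z t : X \subset X' -> #|X'| = #|X|.+1 -> z \in X' -> z \notin X -> t \in X' -> t \notin X -> z = t.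
  move=> XX' cX zX' zX tX' tX; have : #|X' :\: X| <= 1.
    by rewrite cardsD (setIidPr XX') cX subSnn.
  by move/card_le1_eqP; apply; rewrite inE ?zX ?tX.
have nBA : B' != A' by apply: contraTneq wBA' => ->; rewrite ltnn.
have [v [u [vB' vA' uA' uB']]] := same_card_diff cBA nBA.
have vu := weight_ltP B'F A'F cBA wBA' vB' vA' uA' uB'.
have nAB : A != B by apply: contraTneq wAB => ->; rewrite ltnn.
have [x [y [xA xB yB yA]]] := same_card_diff AB nAB.
have xy := weight_ltP AF BF AB wAB.
have sA := subsetP AA'; have sB := subsetP BB'.
have vA : v \notin A by apply: contra vA'; exact: sA.
have uB : u \notin B by apply: contra uB'; exact: sB.
(* The order [x < y] on the lower level conflicts with [v < u] on the upper one. Whether [u] and [v]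
   are inherited or newly added decides how: two contradictory comparisons, or three alternating
   elements. *)
have [uA|uA] := boolP (u \in A); have [vB|vB] := boolP (v \in B).
- by have := ltn_trans vu (xy _ _ uA uB vB vA); rewrite ltnn.
- apply: (strongly_separated B'F AF vu (xy _ _ uA uB yB yA)) => //; exact: sB.
- apply: (strongly_separated A'F BF (xy _ _ xA xB vB vA) vu) => //; exact: sA.
- have xB' : x \notin B'.
    apply/negP => xB'; have xv := one _ _ _ _ BB' cB' xB' xB vB' vB.
    by move: vA'; rewrite -xv sA.
  have yA' : y \notin A'.
    apply/negP => yA'; have yu := one _ _ _ _ AA' cA' yA' yA uA' uA.
    by move: uB'; rewrite -yu sB.
  have := weight_ltP B'F A'F cBA wBA' (sB _ yB) yA' (sA _ xA) xB'.
  by move/(ltn_trans (xy _ _ xA xB yB yA)); rewrite ltnn.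
Qed.

Definition chain (a : nat -> {set 'I_n}) :=
  (forall k, k <= n -> a k \in F /\ #|a k| = k) /\ (forall k, k < n -> a k \subset a k.+1).

Lemma chain_sub a k l : chain a -> k <= l -> l <= n -> a k \subset a l.
Proof.
move=> [_ h]; elim: l => [|l IH]; first by rewrite leqn0 => /eqP ->.
rewrite leq_eqVlt => /predU1P[->//|kl] ln.
exact: subset_trans (IH kl (ltnW ln)) (h l ln).
Qed.

Lemma chain_mono a b k : chain a -> chain b -> k < n -> weight (a k) < weight (b k) ->
  weight (a k.+1) <= weight (b k.+1).
Proof.
move=> [ha sa] [hb sb] kn; have [aF ca] := ha k (ltnW kn); have [bF cb] := hb k (ltnW kn).
have [a'F ca'] := ha _ kn; have [b'F cb'] := hb _ kn.
by apply: weight_mono => //; rewrite ?sa ?sb ?ca ?cb ?ca' ?cb'.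
Qed.

Lemma chain_eq a b k : chain a -> chain b -> k <= n -> weight (a k) = weight (b k) -> a k = b k.
Proof.
move=> [ha _] [hb _] kn; have [aF ca] := ha k kn; have [bF cb] := hb k kn.
by apply: weight_inj => //; rewrite ca cb.
Qed.

Definition chain_min (a b : nat -> {set 'I_n}) k := if weight (a k) <= weight (b k) then a k else b k.
Definition chain_max (a b : nat -> {set 'I_n}) k := if weight (a k) <= weight (b k) then b k else a k.

(** Two chains can exchange their order only at a common member, where they may be recombined;
    [cross] lists the possibilities between consecutive levels. *)
Lemma chain_minmax a b : chain a -> chain b -> chain (chain_min a b) /\ chain (chain_max a b).
Proof.
move=> ca cb; have [ha sa] := ca; have [hb sb] := cb.
have cross k : k < n -> [\/ weight (a k) <= weight (b k) /\ weight (a k.+1) <= weight (b k.+1),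
    weight (b k) < weight (a k) /\ weight (b k.+1) < weight (a k.+1), a k = b k | a k.+1 = b k.+1].
  move=> kn; have m1 := chain_mono ca cb kn; have m2 := chain_mono cb ca kn.
  have e1 := @chain_eq _ _ k.+1 ca cb kn; have e2 := @chain_eq _ _ k ca cb (ltnW kn).
  case: (ltngtP (weight (a k)) (weight (b k))) => [h|h|/e2]; last by constructor 3.
    by constructor 1; split => //; exact: m1.
  have := m2 h; rewrite leq_eqVlt => /predU1P[/esym/e1|]; first by constructor 4.
  by constructor 2.
split; split=> k kn; rewrite /chain_min /chain_max.
- by case: ifP => _; [exact: ha|exact: hb].
- have Sa := sa k kn; have Sb := sb k kn.
  have [[-> ->]|[h1 h2]|e|e] := cross k kn => //; first by rewrite (leqNgt (weight (a k))) (leqNgt (weight (a k.+1))) h1 h2.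
    by rewrite e leqnn; case: ifP => // _; rewrite -e.
  by rewrite e leqnn -e; case: ifP => // _; rewrite e.
- by case: ifP => _; [exact: hb|exact: ha].
- have Sa := sa k kn; have Sb := sb k kn.
  have [[-> ->]|[h1 h2]|e|e] := cross k kn => //; first by rewrite (leqNgt (weight (a k))) (leqNgt (weight (a k.+1))) h1 h2.
    by rewrite e leqnn; case: ifP => // _; rewrite -e.
  by rewrite e leqnn -e; case: ifP => // _; rewrite e.
Qed.

(** Steps towards the empty set remove one element at a time, and steps towards the full set add
    one. *)
Lemma chain_through A : A \in F -> exists2 a, chain a & a #|A| = A.
Proof.
move=> AF.
pose dn X := if [pick x in X | X :\ x \in F] is Some x then X :\ x else X.
pose up X := if [pick x | (x \notin X) && (x |: X \in F)] is Some x then x |: X else X.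
have dnP X : X \in F -> X != set0 -> [/\ dn X \in F, #|X| = #|dn X|.+1 & dn X \subset X].
  move=> XF X0; rewrite /dn; case: pickP => [x /andP[xX xF]|h].
    by split => //; [rewrite (cardsD1 x X) xX|exact: subD1set].
  have F0 : set0 \in F.
    by have := initF (leq0n n); have -> : init n 0 = set0 by apply/setP => i; rewrite !inE.
  have [x] := sF XF F0 X0; rewrite sdiff0 => xX; rewrite flip_in // => xF.
  by have := h x; rewrite xX xF.
have upP X : X \in F -> X != setT -> [/\ up X \in F, #|up X| = #|X|.+1 & X \subset up X].
  move=> XF XT; rewrite /up; case: pickP => [x /andP[xX xF]|h].
    by split => //; [rewrite cardsU1 xX|exact: subsetUr].
  have FT : setT \in F.
    by have := initF (leqnn n); have -> : init n n = setT by apply/setP => i; rewrite !inE ltn_ord.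
  have [x] := sF XF FT XT; rewrite in_sdiff inE addbT => xX; rewrite flip_notin // => xF.
  by have := h x; rewrite xX xF.
have cAn : #|A| <= n by rewrite -[X in _ <= X]card_ord max_card.
have dnI m : m <= #|A| -> iter m dn A \in F /\ #|iter m dn A| = #|A| - m.
  elim: m => [|m IH] mA; first by rewrite subn0.
  have [mF cm] := IH (ltnW mA); have [|h1 h2 _] := dnP _ mF; first by rewrite -card_gt0 cm subn_gt0.
  by split => //; rewrite iterS; lia.
have upI m : m + #|A| <= n -> iter m up A \in F /\ #|iter m up A| = m + #|A|.
  elim: m => [|m IH] mA //.
  have [mF cm] := IH (ltnW mA); have [|h1 h2 _] := upP _ mF; last by rewrite iterS h2 cm.
  by apply: contraTneq mA => e; move: cm; rewrite e cardsT card_ord addSn => <-; rewrite ltnn.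
exists (fun k => if k <= #|A| then iter (#|A| - k) dn A else iter (k - #|A|) up A); last by rewrite leqnn subnn.
split=> k kn; case: (leqP k #|A|) => h.
- by have [-> ->] := dnI (#|A| - k) (leq_subr _ _); rewrite subKn.
- by have [|-> ->] := upI (k - #|A|); rewrite subnK // ltnW.
- case: (ltnP k #|A|) => h'.
    have -> : #|A| - k = (#|A| - k.+1).+1 by lia.
    rewrite iterS; have [mF cm] := dnI (#|A| - k.+1) (leq_subr _ _).
    by have [|_ _ //] := dnP _ mF; rewrite -card_gt0 cm subKn.
  have -> : k = #|A| by lia.
  rewrite subnn subSnn /=; have [|_ _ //] := upP _ AF.
  by apply: contraTneq h' => ->; rewrite cardsT card_ord -ltnNge.
- have -> : k < #|A| = false by lia.
  have -> : k.+1 - #|A| = (k - #|A|).+1 by lia.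
  rewrite iterS; have [|mF cm] := upI (k - #|A|); first by rewrite subnK // ltnW.
  have [|_ _ //] := upP _ mF.
  by apply: contraTneq kn => e; move: cm; rewrite e cardsT card_ord; lia.
Qed.

End Sweep.

(** * Minimal steps between maximal chains *)

Section Step.
Variables (n : nat) (F : {set {set 'I_n}}).
Hypothesis nF : normal_family F.
Implicit Types (A B C X Y Z : {set 'I_n}) (i j : 'I_n) (k l : nat) (a b : nat -> {set 'I_n}).

Let sF : steppable F. Proof. by case: nF. Qed.
Let initF k : k <= n -> init n k \in F. Proof. by case: nF => _ _ + _; apply. Qed.
Let finF k : k <= n -> fin n k \in F. Proof. by case: nF => _ _ _; apply. Qed.

(** A maximal chain is a permutation: [pos a i] is the place at which [i] enters it. *)
Definition pos a i := find (fun k => i \in a k.+1) (iota 0 n).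

Lemma in_chain a i k : chain F a -> k <= n -> (i \in a k) = (pos a i < k).
Proof.
move=> ca; case: k => [|k] kn.
  have [_ c0] := ca.1 0 (leq0n n); move/eqP: c0; rewrite cards_eq0 => /eqP ->; by rewrite inE.
apply/idP/idP => [ia|].
  rewrite ltnS leqNgt; apply/negP => /(before_find 0).
  by rewrite nth_iota // add0n ia.
rewrite ltnS => ik.
have h : pos a i < size (iota 0 n) by rewrite size_iota (leq_ltn_trans ik).
have := h; rewrite -has_find => /(nth_find 0).
rewrite -/(pos a i) nth_iota; last by rewrite size_iota in h.
by rewrite add0n; apply/subsetP/(chain_sub ca).
Qed.

Lemma pos_lt a i : chain F a -> pos a i < n.
Proof.
move=> ca; rewrite -(in_chain i ca (leqnn n)).
have [_ cn] := ca.1 n (leqnn n).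
suff -> : a n = setT by rewrite inE.
by apply/eqP; rewrite eqEcard subsetT cardsT card_ord cn /=.
Qed.

Lemma pos_inj a : chain F a -> injective (pos a).
Proof.
move=> ca i j ij; have pi := pos_lt i ca; have [_ c1] := ca.1 _ (ltnW pi); have [_ c2] := ca.1 _ pi.
have : #|a (pos a i).+1 :\: a (pos a i)| <= 1.
  by rewrite cardsD (setIidPr (chain_sub ca (leqnSn _) pi)) c1 c2 subSnn.
by move/card_le1_eqP; apply; rewrite inE !(in_chain _ ca) ?(ltnW pi) // ?ij ltnn leqnn.
Qed.

Lemma pos_unique a i m : chain F a -> m < n -> (forall l, l <= n -> (i \in a l) = (m < l)) -> pos a i = m.
Proof.
move=> ca mn h; have pn := pos_lt i ca.
apply/eqP; rewrite eqn_leq; apply/andP; split.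
  by rewrite -ltnS -(in_chain i ca mn) h // ltnS.
by rewrite -ltnS -h // (in_chain i ca) // ltnS.
Qed.

(** Measure by which a minimal next chain is selected and the sweep is shown to end. *)
Definition total_weight a := \sum_(k < n.+1) weight (a k).

Definition chain_le a b := forall k, k <= n -> weight (a k) <= weight (b k).

Lemma total_weight_lt a b : chain_le a b -> (exists2 k, k <= n & weight (a k) < weight (b k)) ->
  total_weight a < total_weight b.
Proof.
move=> ab [k kn kab]; have kn' : k < n.+1 by [].
rewrite /total_weight (bigD1 (Ordinal kn')) //= [X in _ < X](bigD1 (Ordinal kn')) //= -addSn leq_add //.
by apply: leq_sum => -[l ln] _; exact: ab.
Qed.

Definition top_chain k := fin n (n - k).

Lemma top_chainP : chain F top_chain.
Proof.
split=> k kn; last by apply/subsetP => i; rewrite !inE; apply: leq_trans; lia.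
split; first by rewrite finF // leq_subr.
have := cardsC (fin n (n - k)); have -> : ~: fin n (n - k) = init n (n - k).
  by apply/setP => i; rewrite !inE -ltnNge.
by rewrite card_init ?leq_subr // card_ord /top_chain; lia.
Qed.

Lemma top_chain_max A : A \in F -> weight A <= weight (top_chain #|A|).
Proof.
move=> AF; rewrite leqNgt; apply/negP => h.
have cA : #|A| <= n by rewrite -[X in _ <= X]card_ord max_card.
have [tF ct] := top_chainP.1 _ cA.
have nA : top_chain #|A| != A by apply: contraTneq h => ->; rewrite ltnn.
have [x [y [xt xA yA yt]]] := same_card_diff ct nA.
have := weight_ltP nF tF AF ct h xt xA yA yt.
by move: xt yt; rewrite !inE -ltnNge; clear; lia.
Qed.

Lemma chain_le_top a : chain F a -> chain_le a top_chain.
Proof. by move=> ca k kn; have [aF {2}<-] := ca.1 k kn; exact: top_chain_max. Qed.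

(** Among the chains above [a] and different from it, one of least total weight is taken: anything
    strictly below it would be lighter. *)
Lemma next_chain_minimal a : chain F a -> (exists2 k, k <= n & weight (a k) < weight (top_chain k)) ->
  exists b, [/\ chain F b, chain_le a b, exists2 k, k <= n & weight (a k) < weight (b k) &
    forall c, chain F c -> chain_le a c -> chain_le c b -> (exists2 k, k <= n & weight (a k) < weight (c k)) ->
      forall k, k <= n -> c k = b k].
Proof.
move=> ca ht.
pose P m := `[< exists b, [/\ chain F b, chain_le a b, exists2 k, k <= n & weight (a k) < weight (b k) &
  total_weight b = m] >].
have exP : exists m, P m.
  exists (total_weight top_chain); apply/asboolP; exists top_chain; split => //.
    exact: top_chainP.
  exact: chain_le_top.
case: (ex_minnP exP) => m /asboolP[b [cb ab hb hm]] min.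
exists b; split => // c cc ac cb' hc k kn.
apply: (chain_eq nF cc cb kn); apply/eqP; rewrite eqn_leq cb' //= leqNgt; apply/negP => lt.
have := total_weight_lt cb' (ex_intro2 _ _ k kn lt); rewrite hm ltnNge => /negP; apply.
by apply: min; apply/asboolP; exists c.
Qed.

Section Block.
Variables (a b : nat -> {set 'I_n}).
Hypotheses (ca : chain F a) (cb : chain F b) (ab : chain_le a b).
Hypothesis min : forall c, chain F c -> chain_le a c -> chain_le c b ->
  (exists2 k, k <= n & weight (a k) < weight (c k)) -> forall k, k <= n -> c k = b k.

Lemma chain_lt k : k <= n -> a k != b k -> weight (a k) < weight (b k).
Proof.
move=> kn nab; rewrite ltn_neqAle ab // andbT; apply: contra nab => /eqP.
by move/(chain_eq nF ca cb kn) => ->.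
Qed.

Lemma block_left k : k <= n -> a k != b k -> exists p, [/\ p < k, a p = b p & forall l, p < l <= k -> a l != b l].
Proof.
elim: k => [|k IH] kn nab.
  have [_ a0] := ca.1 0 kn; have [_ b0] := cb.1 0 kn.
  by move/eqP: a0; move/eqP: b0 nab; rewrite !cards_eq0 => /eqP -> /[swap] /eqP ->; rewrite eqxx.
have [e|ne] := eqVneq (a k) (b k).
  by exists k; split => // l /andP[kl lk]; have -> : l = k.+1 by lia.
have [p [pk e h]] := IH (ltnW kn) ne; exists p; split => //; first exact: ltnW.
move=> l /andP[pl]; rewrite leq_eqVlt => /predU1P[->//|lk]; by apply: h; rewrite pl.
Qed.

Lemma block_right k : k <= n -> a k != b k -> exists q, [/\ k < q, q <= n, a q = b q & forall l, k <= l < q -> a l != b l].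
Proof.
move=> kn; have [m nkm] := ubnP (n - k); elim: m => // m IH in k kn nkm *; move=> nab.
have kn' : k < n.
  rewrite ltn_neqAle kn andbT; apply: contra nab => /eqP ->.
  have [_ a0] := ca.1 n (leqnn n); have [_ b0] := cb.1 n (leqnn n).
  have full X : #|X| = n -> X = setT by move=> cX; apply/eqP; rewrite eqEcard subsetT cardsT card_ord cX /=.
  by rewrite (full _ a0) (full _ b0).
have [e|ne] := eqVneq (a k.+1) (b k.+1).
  by exists k.+1; split => // l /andP[kl lk]; have -> : l = k by lia.
have [|q [kq qn e h]] := IH k.+1 kn' _ ne; first by lia.
exists q; split => //; first exact: ltnW.
move=> l /andP[]; rewrite leq_eqVlt => /predU1P[<- //|kl] lq; by apply: h; rewrite kl.
Qed.

(** A chain through [C], clamped between [a] and [b], must be [b] by minimality unless [C] is on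
    [a]. So no member of [F] is skipped between consecutive chains. *)
Lemma between_eq C : C \in F -> weight (a #|C|) <= weight C -> weight C <= weight (b #|C|) ->
  C = a #|C| \/ C = b #|C|.
Proof.
move=> CF aC Cb; have cn : #|C| <= n by rewrite -[X in _ <= X]card_ord max_card.
have [c0 cc0 c0C] := chain_through nF CF.
have [cm _] := chain_minmax nF cc0 cb; have [_ cM] := chain_minmax nF ca cm.
pose c := chain_max a (chain_min c0 b).
have cC : c #|C| = C by rewrite /c /chain_max /chain_min c0C Cb aC.
have [e|ne] := eqVneq C (a #|C|); [by left|right].
rewrite -[LHS]cC; apply: (min cM _ _ _ cn).
- by move=> k kn; rewrite /chain_max; case: ifP.
- move=> k kn; rewrite /chain_max /chain_min; case: ifP => _; last exact: ab.
  by case: ifP.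
- exists #|C| => //; rewrite -/(c _) cC ltn_neqAle aC andbT.
  apply: contra ne => /eqP e; apply/eqP/esym; have [aF caC] := ca.1 _ cn.
  exact: (weight_inj nF).
Qed.

Variables p q : nat.
Hypotheses (pq : p.+1 < q) (qn : q <= n) (ap : a p = b p) (aq : a q = b q).
Hypothesis nab : forall k, p < k < q -> a k != b k.

(** Following [b] only inside the block already gives a chain above [a], so minimality allows no
    second block. *)
Lemma block_outside k : k <= n -> ~~ (p < k < q) -> a k = b k.
Proof.
move=> kn kpq; pose c k := if p < k < q then b k else a k.
have cc : chain F c.
  split=> l ln; rewrite /c.
    by case: ifP => _; [exact: cb.1|exact: ca.1].
  have Sa := ca.2 l ln; have Sb := cb.2 l ln.
  case: ifP => h; case: ifP => h' //.
    have e : l.+1 = q by lia.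
    by rewrite e aq -e.
  have e : l = p by lia.
  by rewrite e ap -e.
rewrite -[RHS](min cc) //; first by rewrite /c (negbTE kpq).
- by move=> l ln; rewrite /c; case: ifP => // _; exact: ab.
- by move=> l ln; rewrite /c; case: ifP => // _; exact: ab.
- exists p.+1; first by lia.
  rewrite /c ltnSn pq /=; apply: chain_lt; first by lia.
  by apply: nab; rewrite ltnSn.
Qed.

(** A chord would permit switching from [a] to [b] inside the block, giving a different chain
    between the two. *)
Lemma no_chord_ab k : p < k -> k.+1 < q -> ~~ (a k \subset b k.+1).
Proof.
move=> pk kq; apply/negP => s; pose c l := if l <= k then a l else b l.
have cc : chain F c.
  split=> l ln; rewrite /c.
    by case: ifP => _; [exact: ca.1|exact: cb.1].
  have Sa := ca.2 l ln; have Sb := cb.2 l ln.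
  case: (leqP l k) => h; case: (leqP l.+1 k) => h' //; last by lia.
  by have -> : l = k by lia.
have kpq : p < k < q by rewrite pk ltnW.
have /negP nk := nab kpq; apply: nk.
have kn : k <= n by lia.
have <- : c k = a k by rewrite /c leqnn.
apply/eqP/min => //.
- by move=> l ln; rewrite /c; case: ifP => // _; exact: ab.
- by move=> l ln; rewrite /c; case: ifP => // _; exact: ab.
- exists k.+1; first by lia.
  by rewrite /c ltnn; apply: chain_lt; [lia|apply: nab; lia].
Qed.

Lemma no_chord_ba k : p < k -> k.+1 < q -> ~~ (b k \subset a k.+1).
Proof.
move=> pk kq; apply/negP => s; pose c l := if l <= k then b l else a l.
have cc : chain F c.
  split=> l ln; rewrite /c.
    by case: ifP => _; [exact: cb.1|exact: ca.1].
  have Sa := ca.2 l ln; have Sb := cb.2 l ln.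
  case: (leqP l k) => h; case: (leqP l.+1 k) => h' //; last by lia.
  by have -> : l = k by lia.
have kpq : p < k.+1 < q by rewrite kq ltnW.
have /negP nk := nab kpq; apply: nk.
have <- : c k.+1 = a k.+1 by rewrite /c ltnn.
apply/eqP/min => //; last by lia.
- by move=> l ln; rewrite /c; case: ifP => // _; exact: ab.
- by move=> l ln; rewrite /c; case: ifP => // _; exact: ab.
- exists k; first by lia.
  by rewrite /c leqnn; apply: chain_lt; [lia|apply: nab; lia].
Qed.

(* Inside the block the edges of [F] do not cross from [a] to [b]. *)
Lemma walk_leaves_block Z l w : p < l < q -> walk F Z (b l) w ->
  weight Z <= weight (a #|Z|) -> has (fun Y => ~~ (p < #|Y| < q)) (Z :: w).
Proof.
move=> lpq; elim: w Z => [|Z' w IH] Z.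
  have ln : l <= n by lia.
  rewrite walk_nil => /andP[/eqP-> _]; have [_ ->] := cb.1 _ ln.
  by have := chain_lt ln (nab lpq); rewrite ltnNge => /negbTE ->.
rewrite walk_cons => /and3P[ZF ZZ' wZ'] Za.
have [Zpq|] := boolP (p < #|Z| < q); last by move=> h; rewrite /= h.
have Z'F : Z' \in F by apply: (walk_in wZ'); rewrite mem_head.
have [Z'a|Z'a] := leqP (weight Z') (weight (a #|Z'|)).
  by have := IH Z' wZ' Z'a; rewrite /= => ->; rewrite orbT.
have [Z'pq|] := boolP (p < #|Z'| < q); last by move=> h; rewrite /= h orbT.
exfalso.
have Z'n : #|Z'| <= n by lia.
have Zn : #|Z| <= n by lia.
have Z'b : weight (b #|Z'|) <= weight Z'.
  rewrite leqNgt; apply/negP => lt.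
  have [e|e] := between_eq Z'F (ltnW Z'a) (ltnW lt).
    by move: Z'a; rewrite -e ltnn.
  by move: lt; rewrite -e ltnn.
have Zlb : weight (a #|Z|) < weight (b #|Z|) := chain_lt Zn (nab Zpq).
have Z'lb : weight (a #|Z'|) < weight (b #|Z'|) := chain_lt Z'n (nab Z'pq).
have [aF caZ] := ca.1 _ Zn; have [bF cbZ] := cb.1 _ Zn.
have [a'F caZ'] := ca.1 _ Z'n; have [b'F cbZ'] := cb.1 _ Z'n.
have /cube_adjP[x Z'x] := ZZ'.
have [xZ|xZ] := boolP (x \in Z).
- have Z'sub : Z' \subset Z by rewrite Z'x flip_in // subD1set.
  have cZ : #|Z| = #|Z'|.+1 by rewrite Z'x flip_in // (cardsD1 x Z) xZ.
  have aS : a #|Z'| \subset a #|Z| by rewrite cZ; apply: ca.2; rewrite -cZ.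
  have bS : b #|Z'| \subset b #|Z| by rewrite cZ; apply: cb.2; rewrite -cZ.
  have e1 : Z = a #|Z|.
    apply: (weight_inj nF) => //; apply/eqP; rewrite eqn_leq Za /=.
    by apply: (weight_mono nF a'F aF Z'F ZF aS Z'sub) => //; rewrite ?caZ' ?caZ.
  have e2 : Z' = b #|Z'|.
    apply/esym/(weight_inj nF) => //; apply/eqP; rewrite eqn_leq Z'b /= leqNgt; apply/negP => lt.
    have : weight (b #|Z|) <= weight Z.
      by apply: (weight_mono nF b'F bF Z'F ZF bS Z'sub) => //; rewrite ?cbZ' ?cbZ.
    by rewrite leqNgt; move/negP; apply; rewrite [X in weight X < _]e1.
  have h1 : p < #|Z'| by case/andP: Z'pq.
  have h2 : #|Z'|.+1 < q by rewrite -cZ; case/andP: Zpq.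
  have /negP nc := no_chord_ba h1 h2; apply: nc.
  have e1' : a #|Z'|.+1 = Z by move: (esym e1); rewrite {1}cZ.
  have e2' := esym e2.
  by rewrite e1' e2'.
- have Zsub : Z \subset Z' by rewrite Z'x flip_notin // subsetUr.
  have cZ : #|Z'| = #|Z|.+1 by rewrite Z'x flip_notin // cardsU1 xZ.
  have aS : a #|Z| \subset a #|Z'| by rewrite cZ; apply: ca.2; rewrite -cZ.
  have bS : b #|Z| \subset b #|Z'| by rewrite cZ; apply: cb.2; rewrite -cZ.
  have e1 : Z = a #|Z|.
    apply: (weight_inj nF) => //; apply/eqP; rewrite eqn_leq Za /= leqNgt; apply/negP => lt.
    have : weight Z' <= weight (a #|Z'|).
      by apply: (weight_mono nF ZF Z'F aF a'F Zsub aS) => //; rewrite ?caZ' ?caZ.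
    by rewrite leqNgt Z'a.
  have e2 : Z' = b #|Z'|.
    apply/esym/(weight_inj nF) => //; apply/eqP; rewrite eqn_leq Z'b /=.
    apply: (weight_mono nF ZF Z'F bF b'F Zsub bS) => //; rewrite ?cbZ' ?cbZ //.
    by rewrite [X in weight X < _]e1.
  have h1 : p < #|Z| by case/andP: Zpq.
  have h2 : #|Z|.+1 < q by rewrite -cZ; case/andP: Z'pq.
  have /negP nc := no_chord_ab h1 h2; apply: nc.
  have e2' : b #|Z|.+1 = Z' by move: (esym e2); rewrite {1}cZ.
  have e1' := esym e1.
  by rewrite e1' e2'.
Qed.

(** A geodesic of [F] from [a k] to [b l], with [l = p + q - k], leaves the block at some [Z] of
    size at most [p] or at least [q]. As [Z] lies between [a k :&: b l] and [a k :|: b l], the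
    intersection is [a p] or the union is [a q]; since [k + l = p + q], each of these implies the
    other. *)
Lemma block_complement k i : p < k < q -> (i \in b (p + q - k)) = (i \in a p) || (i \in a q) && (i \notin a k).
Proof.
move=> kpq; set l := p + q - k.
have lpq : p < l < q by rewrite /l; lia.
have [kn ln pn] : [/\ k <= n, l <= n & p <= n] by rewrite /l in lpq *; split; lia.
have [akF cak] := ca.1 _ kn; have [blF cbl] := cb.1 _ ln.
have [_ cap] := ca.1 _ pn; have [_ caq] := ca.1 _ qn.
have Xa : a p \subset a k by apply: (chain_sub ca) => //; lia.
have Xb : a p \subset b l by rewrite ap; apply: (chain_sub cb) => //; lia.
have Ya : a k \subset a q by apply: (chain_sub ca) => //; lia.
have Yb : b l \subset a q by rewrite aq; apply: (chain_sub cb) => //; lia.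
have [w wk sw] := steppable_walk sF akF blF.
have : weight (a k) <= weight (a #|a k|) by rewrite cak.
move=> /(walk_leaves_block lpq wk)/hasP[Z Zw Zpq].
have := walk_between wk Zw; rewrite sw => btw.
have bt i' : i' \in sdiff (a k) Z -> i' \notin sdiff Z (b l) by exact: hdist_between.
have UI := cardsUI (a k) (b l); rewrite cak cbl in UI.
have sumE : k + l = p + q by rewrite /l; lia.
have sXI : a p \subset a k :&: b l by rewrite subsetI Xa Xb.
have sUY : a k :|: b l \subset a q by rewrite subUset Ya Yb.
have lowU : #|a k :|: b l| <= q by rewrite -[X in _ <= X]caq subset_leq_card.
have lowI : p <= #|a k :&: b l| by rewrite -[X in X <= _]cap subset_leq_card.
have card : #|a k :&: b l| = p /\ #|a k :|: b l| = q.
  suff [h|h] : #|a k :&: b l| <= p \/ q <= #|a k :|: b l| by move: UI lowU lowI h; clear -sumE; lia.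
  have [Zp|Zq] : #|Z| <= p \/ q <= #|Z| by move: Zpq; clear; lia.
    left; rewrite -[X in _ <= X]cap; apply: subset_leq_card.
    have IZ : a k :&: b l \subset Z.
      apply/subsetP => x; rewrite inE => /andP[xa xb]; have := bt x; rewrite !in_sdiff xa xb.
      by case: (x \in Z) => // /(_ isT).
    have /eqP -> // : a p == Z.
    by rewrite eqEcard cap Zp (subset_trans sXI IZ).
  right; rewrite -[X in X <= _]caq; apply: subset_leq_card.
  have ZU : Z \subset a k :|: b l.
    apply/subsetP => x xZ; rewrite inE; have := bt x; rewrite !in_sdiff xZ.
    by case: (x \in a k) => //=; case: (x \in b l) => // /(_ isT).
  have /eqP <- // : Z == a q.
  by rewrite eqEcard caq Zq (subset_trans ZU sUY).
have eI : a k :&: b l = a p.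
  by apply/esym/eqP; rewrite eqEcard sXI card.1 cap /=.
have eU : a k :|: b l = a q.
  by apply/eqP; rewrite eqEcard sUY card.2 caq /=.
rewrite -eI -eU !inE; case: (i \in b l); case: (i \in a k) => //=.
Qed.

Lemma block_pos_out i : ~~ (p <= pos a i < q) -> pos b i = pos a i.
Proof.
move=> h; apply: (pos_unique cb (pos_lt i ca)) => l ln.
have [lpq|lpq] := boolP (p < l < q); last by rewrite -block_outside // (in_chain i ca ln).
have -> : l = p + q - (p + q - l) by lia.
rewrite block_complement; last by lia.
rewrite !(in_chain i ca) //; try lia.
Qed.

Lemma block_pos_in i : p <= pos a i < q -> pos b i = p + q - 1 - pos a i.
Proof.
move=> h; apply: (pos_unique cb) => [|l ln]; first by lia.
have [lpq|lpq] := boolP (p < l < q).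
  have -> : l = p + q - (p + q - l) by lia.
  rewrite block_complement; last by lia.
  by rewrite !(in_chain i ca) //; lia.
rewrite -block_outside // (in_chain i ca ln); lia.
Qed.

(** At level [p.+1] the comparison of [a] with [b] shows that the first element of the block is
    smaller than the last. Strong separation of [a k] and [b (p + q - k)], where [k] is the position
    of [j], transfers this to [i] and [j]. *)
Lemma block_ascending i j : p <= pos a i -> pos a i < pos a j -> pos a j < q -> i < j.
Proof.
move=> pi ij jq.
have mem k x : k <= n -> (x \in a k) = (pos a x < k) by exact: in_chain.
have memb k x : p < k < q -> (x \in b (p + q - k)) = (pos a x < p) || (pos a x < q) && ~~ (pos a x < k).
  by move=> kpq; rewrite block_complement // !mem //; lia.
have p1 : p < p.+1 < q by rewrite ltnSn.
have pn : p.+1 <= n by lia.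
have bp1 x : (x \in b p.+1) = (pos a x < p) || (pos a x < q) && ~~ (pos a x < q.-1).
  have -> : p.+1 = p + q - q.-1 by lia.
  by apply: memb; lia.
have [aF cap] := ca.1 _ pn; have [bF cbp] := cb.1 _ pn.
have [f [g [fa fb gb ga]]] := same_card_diff (etrans cap (esym cbp)) (nab p1).
have fg := weight_ltP nF aF bF (etrans cap (esym cbp)) (chain_lt pn (nab p1)) fa fb gb ga.
move: fa fb gb ga; rewrite !bp1 !mem // => fa fb gb ga.
pose k := pos a j; have kpq : p < k < q by rewrite /k; lia.
have [kn kn'] : k <= n /\ p + q - k <= n by rewrite /k in kpq *; lia.
have [akF _] := ca.1 _ kn; have [bkF _] := cb.1 _ kn'.
have fpos : pos a f = p by move: fa fb; clear -pq; lia.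
have gpos : pos a g = q.-1 by move: ga gb; clear -pq; lia.
by apply: (separated_lt nF akF bkF _ _ _ _ fg); rewrite ?mem ?memb // ?fpos ?gpos /k; clear -pq pi ij jq kpq; lia.
Qed.

End Block.

Lemma next_chain a : chain F a -> (exists2 k, k <= n & weight (a k) < weight (top_chain k)) ->
  exists b p q, [/\ chain F b, total_weight a < total_weight b,
    forall C, C \in F -> weight (a #|C|) <= weight C -> C = a #|C| \/ weight (b #|C|) <= weight C &
    [/\ q <= n, forall i, ~~ (p <= pos a i < q) -> pos b i = pos a i,
      forall i, p <= pos a i < q -> pos b i = p + q - 1 - pos a i &
      forall i j, p <= pos a i -> pos a i < pos a j -> pos a j < q -> i < j]].
Proof.
move=> ca ht; have [b [cb ab [k kn kab] min]] := next_chain_minimal ca ht.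
have nk : a k != b k by apply: contraTneq kab => ->; rewrite ltnn.
have [p [pk ap hp]] := block_left ca cb kn nk.
have [q [kq qn aq hq]] := block_right ca cb kn nk.
have pq : p.+1 < q by lia.
have nab l : p < l < q -> a l != b l.
  move=> /andP[pl lq]; have [lk|/ltnW kl] := leqP l k; first by apply: hp; rewrite pl.
  by apply: hq; rewrite kl.
exists b, p, q; split => //.
- by apply: total_weight_lt => //; exists k.
- move=> C CF aC; have [Cb|/ltnW] := leqP (weight C) (weight (b #|C|)); last by right.
  by have [e|e] := between_eq ca cb ab min CF aC Cb; [left|right; rewrite -e].
- split => //.
  + exact: (block_pos_out ca cb ab min pq qn ap aq nab).
  + exact: (block_pos_in ca cb ab min pq qn ap aq nab).
  + exact: (block_ascending ca cb ab min pq qn ap aq nab).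
Qed.

End Step.

Definition block_reversal n (c c' : 'I_n -> nat) := exists p q : nat,
  [/\ q <= n, forall i, ~~ (p <= c i < q) -> c' i = c i,
      forall i, p <= c i < q -> c' i = p + q - 1 - c i &
      forall i j, p <= c i -> c i < c j -> c j < q -> i < j].

Definition sweep n (F : {set {set 'I_n}}) N (c : nat -> 'I_n -> nat) :=
  [/\ forall i, c 0 i = i, forall i, c N i = n.-1 - i,
      forall t, t < N -> block_reversal (c t) (c t.+1),
      forall t, t <= N -> injective (c t) /\ forall i, c t i < n &
      forall C, C \in F <-> exists t k, [/\ t <= N, k <= n & C = [set i | c t i < k]]].

Lemma normal_family_sweep n (F : {set {set 'I_n}}) : normal_family F -> exists N c, sweep F N c.
Proof.
move=> nF.
(* Induction on the weight still missing to the top chain. The last clause records that every member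
   of [F] above [a] is met. *)
have main m a : chain F a -> total_weight (@top_chain n) - total_weight a < m ->
  exists N (A : nat -> nat -> {set 'I_n}), [/\ A 0 = a, forall k, k <= n -> A N k = top_chain n k,
    forall t, t <= N -> chain F (A t),
    forall t, t < N -> block_reversal (pos (A t)) (pos (A t.+1)) &
    forall C, C \in F -> weight (a #|C|) <= weight C -> exists2 t, t <= N & C = A t #|C|].
  elim: m a => // m IH a ca am.
  have [ht|ht] := pselect (exists2 k, k <= n & weight (a k) < weight (top_chain n k)).
    have [b [p [q [cb ab hb bp]]]] := next_chain nF ca ht.
    have tb : total_weight b <= total_weight (@top_chain n).
      by apply: leq_sum => -[k kn] _; apply: (chain_le_top nF cb).
    have [|N [A [A0 AN Ac As AC]]] := IH b cb; first by move: am ab tb; clear; lia.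
    exists N.+1, (fun t => if t is t'.+1 then A t' else a); split => //.
    - by case=> // t tN; exact: Ac.
    - case=> [_|t tN]; last exact: As.
      by exists p, q; rewrite A0.
    - move=> C CF aC; have [e|bC] := hb C CF aC; first by exists 0.
      by have [t tN e] := AC C CF bC; exists t.+1.
  have e k : k <= n -> a k = top_chain n k.
    move=> kn; apply: (chain_eq nF ca (top_chainP nF) kn); apply/eqP.
    rewrite eqn_leq (chain_le_top nF ca) //= leqNgt; apply/negP => lt.
    by apply: ht; exists k.
  exists 0, (fun=> a); split => // C CF aC; exists 0 => //.
  have Cn : #|C| <= n by rewrite -[X in _ <= X]card_ord max_card.
  have [aF caC] := ca.1 _ Cn.
  apply: (weight_inj nF) => //; apply/eqP; rewrite eqn_leq aC andbT e //.
  exact: (top_chain_max nF).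
have initF k : k <= n -> init n k \in F by case: nF => _ _ + _; apply.
have ci : chain F (init n).
  split=> k kn; last by apply/subsetP => i; rewrite !inE => /ltnW.
  by rewrite initF // card_init.
have init_min C : C \in F -> weight (init n #|C|) <= weight C.
  move=> CF; rewrite leqNgt; apply/negP => h.
  have cC : #|C| <= n by rewrite -[X in _ <= X]card_ord max_card.
  have ct := card_init cC.
  have nC : C != init n #|C| by apply: contraTneq h => <-; rewrite ltnn.
  have [x [y [xC xi yi yC]]] := same_card_diff (esym ct) nC.
  have := weight_ltP nF CF (initF _ cC) (esym ct) h xC xi yi yC.
  by move: xi yi; rewrite !inE -leqNgt; clear; lia.
have [N [A [A0 AN Ac As AC]]] := main _ _ ci (ltnSn _).
exists N, (fun t => pos (A t)); split => //.
- move=> i; rewrite A0; apply: (pos_unique ci) => // l ln; by rewrite inE.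
- move=> i; have iN := ltn_ord i; apply: (pos_unique (Ac N (leqnn N))); first by lia.
  by move=> l ln; rewrite AN // inE; lia.
- by move=> t tN; split; [exact: pos_inj (Ac t tN)|move=> i; exact: pos_lt (Ac t tN)].
- move=> C; split.
    move=> CF; have [t tN e] := AC C CF (init_min C CF).
    have cC : #|C| <= n by rewrite -[X in _ <= X]card_ord max_card.
    exists t, #|C|; split => //; rewrite [LHS]e; apply/setP => i.
    by rewrite inE (in_chain i (Ac t tN)).
  move=> [t [k [tN kn ->]]]; have [kF _] := (Ac t tN).1 k kn.
  suff -> : [set i | pos (A t) i < k] = A t k by [].
  by apply/setP => i; rewrite inE (in_chain i (Ac t tN)).
Qed.

(** The exceptional graphs K_1 and K_2 are normalized with [n = 0] and [n = 1]. *)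
Lemma pseudo_disk_normal (U : finType) (D : {set {set U}}) : pseudo_disk D ->
  exists n (F : {set {set 'I_n}}), normal_family F /\ graph_iso D F.
Proof.
move=> [/partial_cubeP[_ sD] v2 [[C [cC hull]]|[A DA]|[A [B [/cube_adjP[i Bi] DAB]]]]].
- by have [n [F [_ nF iso _]]] := cycle_hull_normal sD cC v2; exists n, F; rewrite -hull.
- have e0 (X Y : {set 'I_0}) : X = Y by apply/setP => -[].
  exists 0, [set set0]; split; last first.
    exists (fun=> set0); rewrite DA; split.
    + by move=> X Y /set1P-> /set1P->.
    + by rewrite imset_set1.
    + by move=> X Y /set1P-> /set1P->; rewrite !cube_adjE /hdist !sdiffv !cards0.
  split; first by move=> X Y _ _; rewrite (e0 X Y) eqxx.
  + by move=> Y _; rewrite (e0 Y set0) cards0.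
  + by move=> k _; rewrite (e0 (init _ _) set0) set11.
  + by move=> k _; rewrite (e0 (fin _ _) set0) set11.
- pose e (_ : 'I_1) := i.
  have e_inj : injective e by move=> j k _; rewrite (ord1 j) (ord1 k).
  have coord : {in D &, forall X Y j, j \in sdiff X Y -> exists k, e k = j}.
    move=> X Y XD YD j; have [->|ji] := eqVneq j i; first by exists ord0.
    by move: XD YD; rewrite DAB Bi => /set2P[]-> /set2P[]->;
      rewrite !in_sdiff ?in_set1 ?(negbTE ji) ?addbF ?addbb.
  have AD : set0 \in nmap A e @: D.
    apply/imsetP; exists A; first by rewrite DAB set21.
    by apply/setP => k; rewrite in_nmap inE addbb.
  have BD : setT \in nmap A e @: D.
    apply/imsetP; exists B; first by rewrite DAB set22.
    by apply/setP => k; rewrite in_nmap inE Bi in_flip eqxx addbA addbb.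
  have vcA (X : {set 'I_1}) : X = set0 \/ X = setT.
    have [h|h] := boolP (ord0 \in X); [right|left]; apply/setP => k; rewrite inE (ord1 k) //.
    exact/negbTE.
  have all1 (X : {set 'I_1}) : X \in nmap A e @: D by case: (vcA X) => ->.
  exists 1, (nmap A e @: D); split; last exact: nmap_graph_iso.
  split => //; first exact: nmap_steppable.
  by move=> Y _; apply: leq_trans (max_card _) _; rewrite card_ord.
Qed.

(** Serves arrangements of at most one curve: a complete subgraph of a hypercube has at most two
    vertices, for lack of triangles. *)
Lemma complete_pseudo_disk (U : finType) (D : {set {set U}}) : partial_cube D -> vcdim D <= 2 ->
  {in D &, forall A B, A != B -> cube_adj A B} -> pseudo_disk D.
Proof.
move=> pD v2 adj; split => //; have [/set0Pn[A AD] _] := pD.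
have [e|/set0Pn[B]] := eqVneq (D :\ A) set0.
  by constructor 2; exists A; rewrite -(setD1K AD) e setU0.
rewrite !inE => /andP[BA BD].
constructor 3; exists A, B; split; first by apply: adj => //; rewrite eq_sym.
apply/setP => X; rewrite !inE; apply/idP/orP => [XD|[]/eqP-> //].
have [|XA] := eqVneq X A; first by left.
have [|XB] := eqVneq X B; first by right.
by exfalso; apply: (@no_cube_triangle _ A X B); apply: adj => //; rewrite eq_sym.
Qed.

Lemma normal_pseudo_disk (U : finType) (D : {set {set U}}) n (F : {set {set 'I_n}}) :
  partial_cube D -> vcdim D <= 2 -> 1 < n -> normal_family F -> graph_iso F D -> pseudo_disk D.
Proof.
move=> pD v2 n1 nF iso; split => //; constructor 1.
by have /partial_cubeP[_ sD] := pD; exact: normal_isometric_cycle iso.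
Qed.

End CubeGraphs.

From mathcomp Require Import all_algebra ring lra.
From mathcomp Require Import all_classical all_reals all_analysis.
From mathcomp Require Import prodnormedzmodule.
Require Import Defs.
Import CubeGraphs.
Import Order.TTheory GRing.Theory Num.Theory.
Import numFieldNormedType.Exports.
Local Open Scope ring_scope.
Local Open Scope classical_set_scope.

(** * Turning angles in the plane *)

Section Plane.
Variable R : realType.
Implicit Types (u v w z p q : R * R) (A B : set (R * R)) (t : R).

Definition sqnorm v : R := v.1 ^+ 2 + v.2 ^+ 2.
Definition dir v : R * R := (v.1 / Num.sqrt (sqnorm v), v.2 / Num.sqrt (sqnorm v)).
Definition rot t v : R * R :=
  (cos t * v.1 - sin t * v.2, sin t * v.1 + cos t * v.2).
Definition cross u v : R := u.1 * v.2 - u.2 * v.1.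
Definition dot u v : R := u.1 * v.1 + u.2 * v.2.
(** The signed angle from [u] to [v], correct for unit vectors with positive scalar product;
    elsewhere [asin] picks the wrong branch. *)
Definition turn u v : R := asin (cross u v).

Lemma sqnorm_gt0 v : (0 < sqnorm v) = (v != 0).
Proof.
case: v => a b; rewrite /sqnorm /= lt_def addr_ge0 ?sqr_ge0 // andbT.
by rewrite paddr_eq0 ?sqr_ge0 // !sqrf_eq0.
Qed.

Lemma sqnorm_dir v : v != 0 -> sqnorm (dir v) = 1.
Proof.
rewrite -sqnorm_gt0 => v0; rewrite /sqnorm /dir /= !expr_div_n sqr_sqrtr ?ltW //.
by rewrite -mulrDl divff // gt_eqF.
Qed.

Lemma sqnorm_rot t v : sqnorm (rot t v) = sqnorm v.
Proof.
rewrite /sqnorm /rot /=; have := cos2Dsin2 t.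
move=> h; transitivity ((cos t ^+ 2 + sin t ^+ 2) * (v.1 ^+ 2 + v.2 ^+ 2)); first by ring.
by rewrite h mul1r.
Qed.

Lemma rotD s t v : rot (s + t) v = rot s (rot t v).
Proof. by rewrite /rot /= cosD sinD; congr pair; ring. Qed.

Lemma rot0 v : rot 0 v = v.
Proof. by case: v => a b; rewrite /rot cos0 sin0 /=; congr pair; ring. Qed.

Lemma cross_rot t v : sqnorm v = 1 -> cross v (rot t v) = sin t.
Proof.
move=> h; rewrite /cross /rot /=.
transitivity (sin t * sqnorm v); first by rewrite /sqnorm; ring.
by rewrite h mulr1.
Qed.

Lemma dot_rot t v : sqnorm v = 1 -> dot v (rot t v) = cos t.
Proof.
move=> h; rewrite /dot /rot /=.
transitivity (cos t * sqnorm v); first by rewrite /sqnorm; ring.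
by rewrite h mulr1.
Qed.

Lemma cross_dot u v : cross u v ^+ 2 + dot u v ^+ 2 = sqnorm u * sqnorm v.
Proof. by rewrite /cross /dot /sqnorm; ring. Qed.

Lemma cross_lt1 u v : sqnorm u = 1 -> sqnorm v = 1 -> 0 < dot u v ->
  -1 < cross u v < 1.
Proof.
move=> hu hv d0; have := cross_dot u v; rewrite hu hv mulr1 => h.
by rewrite -ltr_norml -(@ltr_pXn2r _ 2) ?nnegrE // expr1n real_normK ?num_real //; nra.
Qed.

Lemma rot_turn u v : sqnorm u = 1 -> sqnorm v = 1 -> 0 < dot u v ->
  rot (turn u v) u = v.
Proof.
move=> hu hv d0; have /andP[c1 c2] := cross_lt1 hu hv d0.
have hc : -1 <= cross u v <= 1 by rewrite !ltW.
rewrite /turn /rot cos_asin // asinK ?in_itv //=.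
have -> : Num.sqrt (1 - cross u v ^+ 2) = dot u v.
  have := cross_dot u v; rewrite hu hv mulr1 => <-.
  by rewrite addrC addKr sqrtr_sqr ger0_norm // ltW.
move: hu; rewrite /dot /cross /sqnorm; case: u v {hv d0 c1 c2 hc} => [a b] [c d] /= hu.
congr pair; [transitivity (c * (a^+2+b^+2))|transitivity (d * (a^+2+b^+2))];
  by [ring | rewrite hu mulr1].
Qed.

Lemma turn_small u v : sqnorm u = 1 -> sqnorm v = 1 -> 0 < dot u v ->
  `|turn u v| < pi / 2.
Proof.
move=> hu hv d0; have /andP[c1 c2] := cross_lt1 hu hv d0.
by rewrite ltr_norml /turn asin_gtNpi2 ?asin_ltpi2 ?c1 ?c2 ?ltW.
Qed.

Lemma rot_small_turn t u : sqnorm u = 1 -> `|t| < pi / 2 -> t = turn u (rot t u).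
Proof.
move=> hu; rewrite ltr_norml => /andP[t1 t2].
by rewrite /turn cross_rot // sinK // in_itv /= !ltW.
Qed.

Lemma dot_dir_gt0 u v : 0 < dot u v -> 0 < dot (dir u) (dir v).
Proof.
move=> d0.
have u0 : 0 < sqnorm u.
  rewrite sqnorm_gt0; apply: contraTneq d0 => ->.
  by rewrite /dot /= !mul0r addr0 ltxx.
have v0 : 0 < sqnorm v.
  rewrite sqnorm_gt0; apply: contraTneq d0 => ->.
  by rewrite /dot /= !mulr0 addr0 ltxx.
rewrite /dot /dir /= mulrACA [X in _ + X]mulrACA -mulrDl.
by rewrite mulr_gt0 // mulr_gt0 // invr_gt0 sqrtr_gt0.
Qed.

(** The norm is the maximum norm [M]: [dot u u] is at least [M ^+ 2], while the two products in
    [dot u (v - u)] together lose less than that, each being limited by [M ^+ 2 / 2]. *)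
Lemma dot_gt0_near u v : u != 0 -> `|v - u| < `|u| / 2 -> 0 < dot u v.
Proof.
case: u v => [a b] [c d] /=; rewrite /dot /= !prod_normE /=.
set M := Num.max `|a| `|b|; rewrite gt_max => u0 /andP[h1 h2].
have M0 : 0 < M.
  rewrite lt_max !normr_gt0; move: u0; apply: contraR.
  by rewrite negb_or !negbK => /andP[/eqP-> /eqP->].
have ha : `|a| <= M by rewrite le_max lexx.
have hb : `|b| <= M by rewrite le_max lexx orbT.
have hM : M ^+ 2 <= a ^+ 2 + b ^+ 2.
  rewrite -(real_normK (num_real a)) -(real_normK (num_real b)) /M.
  by case: (leP `|a| `|b|) => hab; [rewrite lerDr|rewrite lerDl]; exact: sqr_ge0.
have k (x y : R) : `|x| <= M -> `|y| < M / 2 -> - (M * (M/2)) <= x * y.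
  move=> hx hy; have : `|x * y| <= M * (M / 2) by rewrite normrM ler_pM // ltW.
  by rewrite ler_norml => /andP[].
have k' (x y : R) : `|x| <= M -> `|y| < M / 2 -> x != 0 -> - (M * (M/2)) < x * y.
  move=> hx hy x0; have : `|x * y| < M * (M / 2).
    rewrite normrM; apply: (@le_lt_trans _ _ (M * `|y|)); first by rewrite ler_wpM2r.
    by rewrite ltr_pM2l.
  by rewrite ltr_norml => /andP[].
have [a0|a0] := eqVneq a 0.
- have b0 : b != 0 by apply: contraNneq u0 => ->; rewrite a0.
  by have := k' b (d - b) hb h2 b0; have := k a (c - a) ha h1; nra.
- by have := k' a (c - a) ha h1 a0; have := k b (d - b) hb h2; nra.
Qed.

Lemma unit_angle v : sqnorm v = 1 -> exists t, v = rot t (1, 0).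
Proof.
case: v => a b; rewrite /sqnorm /rot /= => h.
have ha : -1 <= a <= 1 by rewrite -ler_norml -(@ler_pXn2r _ 2) ?nnegrE // expr1n real_normK ?num_real //; nra.
have [b0|b0] := leP 0 b.
- exists (acos a); rewrite acosK ?in_itv //= sin_acos // !mulr0 !mulr1 subr0 addr0.
  by congr pair; rewrite -h addrC addKr sqrtr_sqr ger0_norm.
- exists (- acos a); rewrite cosN sinN acosK ?in_itv //= sin_acos // !mulr0 !mulr1 subr0 addr0.
  by congr pair; rewrite -h addrC addKr sqrtr_sqr ltr0_norm // opprK.
Qed.

Lemma rot_eq_near s t v : sqnorm v = 1 -> rot s v = rot t v -> cos (s - t) = 1.
Proof.
move=> hv h; have : rot (s - t) (rot t v) = rot t v by rewrite -rotD subrK.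
set w := rot t v => hw.
have w1 : sqnorm w = 1 by rewrite sqnorm_rot.
by rewrite -(dot_rot (s - t) w1) hw -[RHS]w1 /dot /sqnorm !expr2.
Qed.

End Plane.

Section Plane.
Variable R : realType.
Implicit Types (u v w z p q : R * R) (A B : set (R * R)) (t : R).

Section Cvg.
Variables (T : Type) (F : set_system T).
Hypothesis FF : Filter F.

Lemma cvg_proj1 (f : T -> R * R) v : f x @[x --> F] --> v -> (f x).1 @[x --> F] --> v.1.
Proof. by move=> h; apply: (cvg_comp _ _ h); case: v {h} => a b; exact: cvg_fst. Qed.

Lemma cvg_proj2 (f : T -> R * R) v : f x @[x --> F] --> v -> (f x).2 @[x --> F] --> v.2.
Proof. by move=> h; apply: (cvg_comp _ _ h); case: v {h} => a b; exact: cvg_snd. Qed.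

Lemma cvg_pair2 (f g : T -> R) v : f x @[x --> F] --> v.1 -> g x @[x --> F] --> v.2 ->
  (f x, g x) @[x --> F] --> v.
Proof. by case: v => a b h1 h2; exact: (@cvg_pair _ _ _ F (nbhs a) (nbhs b)). Qed.

Lemma cvg_cross (f g : T -> R * R) u v : f x @[x --> F] --> u -> g x @[x --> F] --> v ->
  cross (f x) (g x) @[x --> F] --> cross u v.
Proof.
move=> h1 h2; have [a b c d] := And4 (cvg_proj1 h1) (cvg_proj2 h1) (cvg_proj1 h2) (cvg_proj2 h2).
exact: (cvgB (cvgM a d) (cvgM b c)).
Qed.

Lemma cvg_dot (f g : T -> R * R) u v : f x @[x --> F] --> u -> g x @[x --> F] --> v ->
  dot (f x) (g x) @[x --> F] --> dot u v.
Proof.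
move=> h1 h2; have [a b c d] := And4 (cvg_proj1 h1) (cvg_proj2 h1) (cvg_proj1 h2) (cvg_proj2 h2).
exact: (cvgD (cvgM a c) (cvgM b d)).
Qed.

Lemma cvg_turn (f g : T -> R * R) u v : sqnorm u = 1 -> sqnorm v = 1 -> 0 < dot u v ->
  f x @[x --> F] --> u -> g x @[x --> F] --> v -> turn (f x) (g x) @[x --> F] --> turn u v.
Proof.
move=> hu hv d0 h1 h2; apply: (@continuous_cvg _ _ _ _ _ (fun x => cross (f x) (g x)) (@asin R)).
  exact: continuous_asin (cross_lt1 hu hv d0).
exact: cvg_cross.
Qed.

Lemma cvg_rot (f : T -> R) (g : T -> R * R) t v : f x @[x --> F] --> t -> g x @[x --> F] --> v ->
  rot (f x) (g x) @[x --> F] --> rot t v.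
Proof.
move=> h1 h2.
have hc : cos (f x) @[x --> F] --> cos t by apply: continuous_cvg => //; exact: continuous_cos.
have hs : sin (f x) @[x --> F] --> sin t by apply: continuous_cvg => //; exact: continuous_sin.
have g1 := cvg_proj1 h2; have g2 := cvg_proj2 h2.
by apply: cvg_pair2; [exact: (cvgB (cvgM hc g1) (cvgM hs g2))|exact: (cvgD (cvgM hs g1) (cvgM hc g2))].
Qed.

Lemma cvg_sqnorm (f : T -> R * R) v : f x @[x --> F] --> v -> sqnorm (f x) @[x --> F] --> sqnorm v.
Proof.
move=> h; have h1 := cvg_proj1 h; have h2 := cvg_proj2 h.
exact: (cvgD (cvgM h1 h1) (cvgM h2 h2)).
Qed.

Lemma cvg_dir (f : T -> R * R) v : v != 0 -> f x @[x --> F] --> v -> dir (f x) @[x --> F] --> dir v.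
Proof.
move=> v0 h; have h1 := cvg_proj1 h; have h2 := cvg_proj2 h.
have hs : (Num.sqrt (sqnorm (f x)))^-1 @[x --> F] --> (Num.sqrt (sqnorm v))^-1.
  apply: cvgV; first by rewrite gt_eqF // sqrtr_gt0 sqnorm_gt0.
  by apply: continuous_cvg; [exact: sqrt_continuous|exact: cvg_sqnorm].
by apply: cvg_pair2; [exact: (cvgM h1 hs)|exact: (cvgM h2 hs)].
Qed.

End Cvg.

(* The unit clamp [t |-> min (max t 0) 1], in a form whose continuity is obvious. *)
Definition clamp01 t : R := (`|t| - `|t - 1| + 1) / 2.

Lemma clamp01_le0 t : t <= 0 -> clamp01 t = 0.
Proof. by move=> t0; rewrite /clamp01 ler0_norm // ler0_norm; lra. Qed.
Lemma clamp01_ge1 t : 1 <= t -> clamp01 t = 1.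
Proof. by move=> t0; rewrite /clamp01 ger0_norm ?ger0_norm; lra. Qed.
Lemma clamp01_id t : 0 <= t <= 1 -> clamp01 t = t.
Proof. by case/andP=> t0 t1; rewrite /clamp01 ger0_norm // ler0_norm; lra. Qed.
Lemma clamp01_bound t : 0 <= clamp01 t <= 1.
Proof.
have [t0|t0] := leP t 0; first by rewrite clamp01_le0 ?lexx ?ler01.
have [t1|t1] := leP 1 t; first by rewrite clamp01_ge1 ?lexx ?ler01.
by rewrite clamp01_id !ltW.
Qed.

Lemma cvg_clamp01 (T : Type) (F : set_system T) (FF : Filter F) (f : T -> R) t :
  f x @[x --> F] --> t -> clamp01 (f x) @[x --> F] --> clamp01 t.
Proof.
move=> h; apply: cvgM; last exact: cvg_cst.
apply: cvgD; last exact: cvg_cst.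
apply: cvgB; first exact: cvg_norm.
by apply: cvg_norm; apply: cvgB => //; exact: cvg_cst.
Qed.

Lemma clopen_R (L : R -> Prop) : (forall r, \forall s \near r, L r <-> L s) ->
  forall r s, L r -> L s.
Proof.
move=> near_L r s Lr.
have oL : open [set x | L x].
  by rewrite openE => x Lx; apply: filterS (near_L x) => y [h _]; exact: h.
have oNL : open [set x | ~ L x].
  by rewrite openE => x Lx; apply: filterS (near_L x) => y [_ h] Ly; exact/Lx/h.
have cR : connected [set: R].
  by apply/connected_intervalP => ? ? ? ? ? ?.
have := cR [set x | L x]; move=> /(_ (ex_intro _ r Lr)) hL.
have : [set x | L x] = [set: R].
  apply: hL; first by exists [set x | L x] => //; rewrite setTI.
  exists [set x | L x]; rewrite ?setTI //.
  by rewrite (_ : [set x | L x] = ~` [set x | ~ L x]);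
    [exact: open_closedC|apply/seteqP; split => x /=; [|move=> /contrapT]; rewrite ?notK].
by move=> /seteqP[_ /(_ s I)].
Qed.

(** [L r] says that the field along the circle of radius [r] about [p] has winding number 0. This
    holds for [r = 0], is locally constant in [r] because the circle is compact, and fails where the
    field is radial. *)
Lemma no_unit_field (f : R * R -> R * R) p M : continuous f ->
  (forall z, sqnorm (f z) = 1) -> (forall z, M <= `|z| -> f z = dir (z - p)) -> False.
Proof.
move=> cf f1 fM.
(* With a clamped parameter the loop is defined on the whole line, while compactness of [[0, 1]]
   controls all of it. *)
pose c t := pi *+ 2 * clamp01 t.
pose F r t := f (p.1 + r * cos (c t), p.2 + r * sin (c t)).
pose L r := exists th : R -> R, [/\ continuous th, forall t, rot (th t) (1, 0) = F r t & th 0 = th 1].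
have cc : continuous c by move=> t; apply: cvgM; [exact: cvg_cst|apply: cvg_clamp01; exact: cvg_id].
have cF : forall r t, F x.1 x.2 @[x --> (r, t)] --> F r t.
  move=> r t; rewrite /F; apply: continuous_cvg; first exact: cf.
  have hr : x.1 @[x --> (r, t)] --> r by exact: cvg_fst.
  have ht : c x.2 @[x --> (r, t)] --> c t by apply: continuous_cvg; [exact: cc|exact: cvg_snd].
  apply: cvg_pair2 => /=; (apply: cvgD; first exact: cvg_cst); apply: cvgM => //.
  - by apply: continuous_cvg => //; exact: continuous_cos.
  - by apply: continuous_cvg => //; exact: continuous_sin.
have cFr r t : F r x @[x --> t] --> F r t.
  apply: (@cvg_comp _ _ _ (fun x => (r, x)) (fun x => F x.1 x.2) _ (nbhs (r, t)) _ _ (cF r t)).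
  by apply: cvg_pair2; [exact: cvg_cst|exact: cvg_id].
have nearF r : \forall s \near r, forall t, 0 < dot (F r t) (F s t).
  have /compact_near_coveringP/(_ R (nbhs r) (fun s t => 0 < dot (F r t) (F s t))) := @segment_compact R 0 1.
  move=> /(_ _) [|]; last first.
    move=> e e0 h; exists e => // s hs t.
    have FE (x : R) : F x t = F x (clamp01 t).
      rewrite /F /c; congr (f (_ + _ * cos (_ * _), _ + _ * sin (_ * _)));
      by rewrite (@clamp01_id (clamp01 t)) // clamp01_bound.
    by rewrite !FE; apply: (h s hs); rewrite /= in_itv /= clamp01_bound.
  move=> t _.
  have h : dot (F r x.1) (F x.2 x.1) @[x --> (t, r)] --> dot (F r t) (F r t).
    apply: cvg_dot.
    - by apply: (@cvg_comp _ _ _ (fun x => x.1) (F r) _ (nbhs t) _ _ (cFr r t)); exact: cvg_fst.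
    - apply: (@cvg_comp _ _ _ (fun x => (x.2, x.1)) (fun x => F x.1 x.2) _ (nbhs (r, t)) _ _ (cF r t)).
      by apply: cvg_pair2; [exact: cvg_snd|exact: cvg_fst].
  have d1 : dot (F r t) (F r t) = 1 by rewrite -(f1 (p.1 + r * cos (c t), p.2 + r * sin (c t))) /dot /sqnorm !expr2.
  rewrite d1 in h.
  by have /cvgr_gt/(_ _ ltr01) := h.
have F01 r : F r 0 = F r 1.
  by rewrite /F /c clamp01_le0 // clamp01_ge1 // mulr0 mulr1 cos0 sin0 cos2pi sin2pi.
have Lstep r s : (forall t, 0 < dot (F r t) (F s t)) -> L r -> L s.
  move=> d0 [th [cth hth th01]]; exists (fun t => turn (F r t) (F s t) + th t); split.
  - move=> t; apply: cvgD; last exact: cth.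
    by apply: cvg_turn; [exact: f1|exact: f1|exact: d0|exact: cFr|exact: cFr].
  - by move=> t; rewrite rotD hth rot_turn // f1.
  - by rewrite !F01 th01.
have dotC u v : dot u v = dot v u by rewrite /dot; ring.
have allL : forall r s, L r -> L s.
  apply: clopen_R => r; apply: filterS (nearF r) => s d0; split; apply: Lstep => // t.
  by rewrite dotC.
have L0 : L 0.
  have [t0 ht0] := unit_angle (f1 p); exists (fun=> t0); split => //; first by move=> ?; exact: cvg_cst.
  by move=> t; rewrite -ht0 /F !mul0r !addr0; case: (p).
(* The cosine or the sine is at least 1/2 in absolute value, hence the doubled norms: the circle
   then stays outside the ball of radius [M]. *)
pose r0 := `|M| *+ 2 + `|p| *+ 2 + 1.
have [th [cth hth th01]] := allL _ r0 L0.
have r00 : 0 < r0 by rewrite /r0 ltr_wpDl // addr_ge0 // mulrn_wge0.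
have r0M (a b : R) : a ^+ 2 + b ^+ 2 = 1 -> M <= `|(p.1 + r0 * a, p.2 + r0 * b)|.
  move=> ab; rewrite prod_normE /= le_max.
  have hp1 : `|p.1| <= `|p| by rewrite prod_normE le_max lexx.
  have hp2 : `|p.2| <= `|p| by rewrite prod_normE le_max lexx orbT.
  have big (x : R) (y : R) : `|y| <= `|p| -> 1/2 <= `|x| -> M <= `|y + r0 * x|.
    move=> hy hx; have : `|r0 * x| <= `|y + r0 * x| + `|y|.
      by rewrite -{1}(addKr y (r0 * x)) addrC (le_trans (ler_normB _ _)).
    rewrite normrM (ger0_norm (ltW r00)) => h.
    have : r0 * (1/2) <= r0 * `|x| by rewrite ler_wpM2l // ltW.
    have := ler_norm M.
    rewrite {1}/r0; lra.
  have [ha|ha] := leP (1/2) `|a|; first by rewrite (big _ _ hp1).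
  rewrite (big _ _ hp2) ?orbT //.
  move: ab ha; rewrite -(real_normK (num_real a)) -(real_normK (num_real b)).
  by have := normr_ge0 a; have := normr_ge0 b; nra.
have thc t : cos (th t - c t) = 1.
  apply: (@rot_eq_near _ _ _ (1, 0)); first by rewrite /sqnorm /= expr0n expr1n addr0.
  rewrite hth /F fM ?r0M ?cos2Dsin2 //.
  rewrite /dir /rot /sqnorm /= !mulr0 !mulr1 subr0 addr0 ![p.1 + _]addrC ![p.2 + _]addrC !addrK.
  rewrite !exprMn -mulrDr cos2Dsin2 mulr1 sqrtr_sqr (ger0_norm (ltW r00)).
  by congr pair; rewrite mulrAC divff ?mul1r // gt_eqF.
have cg : continuous (fun t => th t - c t).
  by move=> t; apply: cvgB; [exact: cth|exact: cc].
have c0 : c 0 = 0 by rewrite /c clamp01_le0 // mulr0.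
have c1 : c 1 = pi *+ 2 by rewrite /c clamp01_ge1 // mulr1.
have pi0 := pi_gt0 R.
(* [th t - c t] is always a multiple of a full turn, yet it loses one full turn in total; halfway
   its cosine would be -1. *)
have [||t _ ht] := @IVT R (fun t => th t - c t) 0 1 (th 0 - pi) ler01.
- exact: continuous_subspaceT.
- rewrite c0 c1 -th01 subr0 ge_min le_max; apply/andP; split; apply/orP; [right|left]; lra.
have := thc t; rewrite ht.
have -> : th 0 - pi = (th 0 - c 0 + pi) - pi *+ 2 by rewrite c0; lra.
have := cosD2pi (th 0 - c 0 + pi - pi *+ 2); rewrite subrK => <-.
by rewrite cosDpi thc; lra.
Qed.
End Plane.

(** * A special case of Janiszewski's theorem *)

Lemma connected_ind (T : topologicalType) (C : set T) (P : T -> Prop) : connected C ->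
  (forall x, C x -> \forall y \near x, C y -> (P x <-> P y)) ->
  forall x y, C x -> C y -> P x -> P y.
Proof.
move=> cC hP x y Cx Cy Px.
pose B := [set z | C z /\ P z].
suff /seteqP[_ /(_ y Cy)[]] : B = C by [].
have near_iff z : C z -> nbhs z [set w | C w -> (P z <-> P w)] by exact: hP.
apply: cC; first by exists x.
- exists ([set w | C w -> P w]^°); first exact: open_interior.
  apply/seteqP; split => z.
  + by move=> [Cz Pz]; split => //; apply: filterS (near_iff z Cz) => w h Cw; exact/(h Cw).
  + by move=> [Cz /nbhs_singleton /(_ Cz)].
- exists (~` [set w | C w -> ~ P w]^°); first exact/open_closedC/open_interior.
  apply/seteqP; split => z.
  + by move=> [Cz Pz]; split => // /nbhs_singleton /(_ Cz).
  + move=> [Cz h]; split => //; apply: contrapT => nPz; apply: h.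
    by apply: filterS (near_iff z Cz) => w hw Cw /(hw Cw).
Qed.

Lemma connected_clopen (T : topologicalType) (C B : set T) x y : connected C ->
  open B -> closure B `&` C `<=` B -> C x -> C y -> B x -> B y.
Proof.
move=> cC oB cB; apply: (connected_ind cC) => z Cz.
have [Bz|nBz] := pselect (B z).
  by apply: filterS (open_nbhs_nbhs (conj oB Bz)) => w Bw _.
have ncB : ~ closure B z by move=> h; apply: nBz; apply: cB.
have : nbhs z (~` closure B).
  by apply: open_nbhs_nbhs; split => //; exact/closed_openC/closed_closure.
by apply: filterS => w nBw _; split => // Bw; exfalso; exact/nBw/subset_closure.
Qed.

Section Plane.
Variable R : realType.
Implicit Types (u v w z p q : R * R) (A B : set (R * R)) (t : R).

Lemma segment_ball z y : exists C : set (R * R), [/\ connected C, C z, C y &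
  forall x, C x -> `|z - x| <= `|z - y|].
Proof.
pose f (t : R) := z + t *: (y - z).
have cf : continuous f.
  by move=> t; apply: cvgD; [exact: cvg_cst|apply: cvgZl; exact: cvg_id].
exists (f @` `[0, 1]%classic); split.
- apply: connected_continuous_connected; first exact: segment_connected.
  exact: continuous_subspaceT.
- by exists 0; rewrite /f ?scale0r ?addr0 //= in_itv /= lexx ler01.
- by exists 1; rewrite /f ?scale1r ?subrKC //= in_itv /= lexx ler01.
- move=> _ [t /= /[!in_itv] /= /andP[t0 t1] <-].
  rewrite /f opprD addrA subrr sub0r normrN normrZ ger0_norm // distrC ler_piMl //.
Qed.

Lemma component_open A x : open A -> open (connected_component A x).
Proof.
rewrite !openE => oA z Az.
have /nbhs_ballP[e /= e0 he] := oA z (connected_component_sub Az).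
apply/nbhs_ballP; exists e => // y zy.
apply: connected_component_trans Az _.
have [C [cC Cz Cy hC]] := segment_ball z y.
exists C => //; split => // w /hC hw; apply: he.
by move: zy; rewrite -ball_normE /=; apply: le_lt_trans.
Qed.

Lemma component_subset A B x y : A `<=` B -> connected_component A x y -> connected_component B x y.
Proof. by move=> AB [C [Cx CA cC] Cy]; exists C => //; split => //; exact: subset_trans AB. Qed.

Lemma closure_component A x z : open A -> A z ->
  closure (connected_component A x) z -> connected_component A x z.
Proof.
move=> oA Az cz.
have : nbhs z (connected_component A z).
  apply: open_nbhs_nbhs; split; first exact: component_open.
  exact: connected_component_refl.
move=> /cz[y [xy zy]]; apply: connected_component_trans xy _.
exact: connected_component_sym.
Qed.

Definition cont_on A (f : R * R -> R) :=
  forall z, A z -> f x @[x --> within A (nbhs z)] --> f z.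

Lemma cont_on_eq A f g : (forall z, A z -> f z = g z) -> cont_on A f -> cont_on A g.
Proof.
move=> fg cf z Az W; rewrite -fg // => Wf; have := cf z Az W Wf.
by apply: (@filterS _ (nbhs z)) => x hx Ax /=; rewrite -fg //; exact: hx.
Qed.

Lemma cont_onU A B f : closed A -> closed B -> cont_on A f -> cont_on B f -> cont_on (A `|` B) f.
Proof.
move=> clA clB /subspace_continuousP cA /subspace_continuousP cB.
by apply/subspace_continuousP; exact: withinU_continuous.
Qed.

Lemma cont_on_cont A f : (forall z, A z -> {for z, continuous f}) -> cont_on A f.
Proof.
move=> h z Az W Wf; have := h z Az W Wf.
by apply: (@filterS _ (nbhs z)) => x hx _.
Qed.

(* A continuous determination on [A], small at infinity, of the angle from [z - q] to [z - p]. By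
   Eilenberg's criterion it exists exactly when the closed set [A] does not separate [p] from [q]. *)
Definition turn_lift A p q (th : R * R -> R) :=
  [/\ cont_on A th, (forall z, A z -> rot (th z) (dir (z - q)) = dir (z - p)) &
  exists M, forall z, A z -> M <= `|z| -> `|th z| < pi / 2].

Definition liftable A p q := exists th, turn_lift A p q th.

Lemma dir_far p q : exists M, forall z, M <= `|z| ->
  [/\ z != p, z != q & 0 < dot (z - q) (z - p)].
Proof.
exists (`|p| + `|q| + `|p - q| *+ 2 + 1) => z hz.
have h1 : `|z| <= `|z - p| + `|p| by rewrite -{1}(subrK p z) ler_normD.
have h2 : `|z| <= `|z - q| + `|q| by rewrite -{1}(subrK q z) ler_normD.
have p0 := normr_ge0 p; have q0 := normr_ge0 q; have pq0 := normr_ge0 (p - q).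
have zp : z != p by apply/eqP => zp; move: hz; rewrite zp; lra.
have zq : z != q by apply/eqP => zq; move: hz; rewrite zq; lra.
split => //; apply: dot_gt0_near; first by rewrite subr_eq0.
have -> : z - p - (z - q) = q - p by rewrite opprB addrC addrA subrK.
by rewrite distrC; lra.
Qed.

Lemma sqnorm_dirB p z : z != p -> sqnorm (dir (z - p)) = 1.
Proof. by move=> zp; rewrite sqnorm_dir // subr_eq0. Qed.

Lemma neq_notin A p z : A z -> ~ A p -> z != p.
Proof. by move=> Az nAp; apply/eqP => zp; apply: nAp; rewrite -zp. Qed.

Lemma cvg_dirB p z : z != p -> dir (x - p) @[x --> z] --> dir (z - p).
Proof.
move=> zp; apply: cvg_dir; first by rewrite subr_eq0.
by apply: cvgB; [exact: cvg_id|exact: cvg_cst].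
Qed.

Lemma liftable_near A p q : ~ A p -> ~ A q -> (forall z, A z -> 0 < dot (z - q) (z - p)) ->
  liftable A p q.
Proof.
move=> nAp nAq d0; exists (fun z => turn (dir (z - q)) (dir (z - p))); split.
- apply: cont_on_cont => z Az.
  have zp := neq_notin Az nAp; have zq := neq_notin Az nAq.
  apply: cvg_turn; rewrite ?sqnorm_dirB //; [exact/dot_dir_gt0/d0|exact: cvg_dirB..].
- move=> z Az; have zp := neq_notin Az nAp; have zq := neq_notin Az nAq.
  by rewrite rot_turn ?sqnorm_dirB //; exact/dot_dir_gt0/d0.
- exists 0 => z Az _; have zp := neq_notin Az nAp; have zq := neq_notin Az nAq.
  by rewrite turn_small ?sqnorm_dirB //; exact/dot_dir_gt0/d0.
Qed.

Lemma cos_gt0_small t : `|t| < pi -> 0 < cos t -> `|t| < pi / 2.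
Proof.
move=> tpi; have -> : cos t = cos `|t|.
  by have [t0|t0] := leP 0 t; [rewrite ger0_norm|rewrite ltr0_norm ?cosN].
have pi0 := pi_gt0 R.
rewrite -(cos_pihalf R) ltr_cos // in_itv /= ?normr_ge0 ?ltW //; lra.
Qed.

(** A sum of lifts is only bounded by half a turn at infinity. But there the directions from [p] and
    [r] have positive scalar product, so the sum is below a quarter turn. *)
Lemma liftable_trans A p q r : ~ A p -> ~ A q -> ~ A r ->
  liftable A p q -> liftable A q r -> liftable A p r.
Proof.
move=> nAp nAq nAr [f [cf hf [M1 hM1]]] [g [cg hg [M2 hM2]]].
have hfg z : A z -> rot (f z + g z) (dir (z - r)) = dir (z - p).
  by move=> Az; rewrite rotD hg // hf.
exists (fun z => f z + g z); split => //.
  by move=> z Az; apply: cvgD; [exact: cf|exact: cg].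
have [M3 hM3] := dir_far p r.
exists (Num.max M1 (Num.max M2 M3)) => z Az; rewrite !ge_max => /and3P[z1 z2 z3].
have [zp zr /dot_dir_gt0] := hM3 z z3.
rewrite -hfg // dot_rot ?sqnorm_dirB // => h; apply: cos_gt0_small => //.
rewrite (le_lt_trans (ler_normD _ _)) //.
by have := hM1 z Az z1; have := hM2 z Az z2; lra.
Qed.

Lemma liftable_sym A p q : liftable A p q -> liftable A q p.
Proof.
move=> [f [cf hf [M1 hM1]]]; exists (fun z => - f z); split.
- by move=> z Az; apply: cvgN; exact: cf.
- by move=> z Az; rewrite -hf // -rotD addNr rot0.
- by exists M1 => z Az /(hM1 z Az); rewrite normrN.
Qed.

(** Easy half of the criterion: for two nearby points the principal angle is a lift, and lifts
    compose, so liftability spreads over the component. *)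
Lemma component_liftable A p q : closed A -> connected_component (~` A) p q -> liftable A p q.
Proof.
move=> clA pq.
have near_lift x : ~ A x -> \forall y \near x, ~ A y /\ liftable A x y.
  move=> nAx.
  have /nbhs_ballP[e /= e0 he] : nbhs x (~` A).
    by apply: open_nbhs_nbhs; split => //; exact: closed_openC.
  (* With [e / 3], points of [A] keep a distance above [2 e / 3] from [y], which is the margin
     required by [dot_gt0_near]. *)
  apply/nbhs_ballP; exists (e / 3); rewrite /= ?divr_gt0 // => y.
  rewrite -ball_normE /= => xy.
  have nAy : ~ A y by apply: he; rewrite -ball_normE /=; move: e0 xy => /=; lra.
  split => //; apply: liftable_near => // z Az.
  have zy : z != y by exact: neq_notin Az nAy.
  apply: dot_gt0_near; first by rewrite subr_eq0.
  have -> : z - x - (z - y) = y - x by rewrite opprB addrC addrA subrK.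
  have xz : e <= `|x - z|.
    by rewrite leNgt; apply/negP => h; apply: (he z) => //; rewrite -ball_normE.
  have : `|x - z| <= `|x - y| + `|z - y|.
    by rewrite [`|z - y|]distrC ler_distD.
  rewrite [`|y - x|]distrC; move: e0 xy => /=; lra.
have Ap : ~ A p by have [C [Cp CA _] _] := pq; exact: CA.
have Aq : ~ A q by have [C [_ CA _] /CA] := pq.
have cC : connected (connected_component (~` A) p) by exact: component_connected.
apply: (@connected_ind _ _ (liftable A p) cC _ p q) => //; last 2 first.
- exact: connected_component_refl.
- by apply: liftable_near => // z Az; rewrite /dot -!expr2 -/(sqnorm _) sqnorm_gt0 subr_eq0 (neq_notin Az).
move=> x /connected_component_sub Ax; apply: filterS (near_lift x Ax) => y [Ay xy] _.
split => h; apply: liftable_trans h _ => //; exact: liftable_sym.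
Qed.

Lemma cvg_if (T U : Type) (F : set_system T) (G : set_system U) (P : T -> Prop) (a b : T -> U) :
  Filter F -> a x @[x --> F] --> G -> b x @[x --> F] --> G ->
  (if pselect (P x) then a x else b x) @[x --> F] --> G.
Proof.
move=> FF ha hb W GW.
apply: (@filterS2 _ F _ _ _ _ _ (ha W GW) (hb W GW)) => x h1 h2 /=.
by case: pselect.
Qed.

Lemma closed_ball_compact M : compact [set z : R * R | `|z| <= M].
Proof.
apply: (@subclosed_compact _ _ (`[- M, M]%classic `*` `[- M, M]%classic)).
- have -> : [set z : R * R | `|z| <= M] = (fun z : R * R => `|z|) @^-1` [set t | t <= M] by [].
  apply: preimage_closed; last exact: closed_le.
  by move=> z _; exact: norm_continuous.
- by apply: compact_setX; exact: segment_compact.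
- by move=> [a b] /=; rewrite prod_normE /= ge_max !in_itv /= -!ler_norml => /andP.
Qed.

Lemma cont_on_bounded A f M : closed A -> cont_on A f ->
  exists K, forall z, A z -> `|z| <= M -> `|f z| <= K.
Proof.
move=> clA cf; pose B := A `&` [set z | `|z| <= M].
have cB : compact B.
  apply: (@subclosed_compact _ _ [set z | `|z| <= M]); [|exact: closed_ball_compact|by move=> z []].
  by apply: closedI => //; apply: compact_closed; [exact: norm_hausdorff|exact: closed_ball_compact].
have : compact (f @` B).
  apply: continuous_compact => //.
  apply: continuous_subspaceW (_ : B `<=` A) _; first by move=> z [].
  exact/subspace_continuousP.
move=> /compact_bounded[N [_ hN]]; exists (N + 1) => z Az zM.
by apply: (hN (N + 1)); [rewrite ltrDl|exists z].
Qed.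

(** Hard half of the criterion. If the component [U] of [p] missed [q], extend the lift to the plane
    by Tietze's theorem. The direction from [q] turned by this extension on the closure of [U], and
    the direction from [p] elsewhere, would form a continuous unit field against [no_unit_field]. *)
Lemma liftable_component A p q : closed A -> ~ A p -> ~ A q -> liftable A p q ->
  connected_component (~` A) p q.
Proof.
move=> clA nAp nAq [th [cth hth [M1 hM1]]].
have [M2 hM2] := dir_far p q.
pose M := Num.max M1 M2.
(* Adding the exterior of a large ball to [A], with the principal angle as lift, makes the lift
   bounded, as the extension theorem requires, and the field radial far away. *)
pose D := [set z : R * R | M <= `|z|].
have clD : closed D.
  have -> : D = (fun z : R * R => `|z|) @^-1` [set t | M <= t] by [].
  apply: preimage_closed; last exact: closed_ge.
  by move=> z _; exact: norm_continuous.
have far z : D z -> [/\ M1 <= `|z|, z != p, z != q & 0 < dot (z - q) (z - p)].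
  by rewrite /D /= ge_max => /andP[h1 /hM2[]].
pose A' := A `|` D.
have clA' : closed A' by exact: closedU.
pose th' z := if z \in D then turn (dir (z - q)) (dir (z - p)) else th z.
have thA z : A z -> th z = th' z.
  move=> Az; rewrite /th'; case: ifPn => // /set_mem /far[zM zp zq d0].
  by rewrite -hth //; apply: rot_small_turn; [exact: sqnorm_dirB|exact: hM1].
have cth' : cont_on A' th'.
  apply: cont_onU => //; first exact: cont_on_eq cth.
  apply: (@cont_on_eq _ (fun z => turn (dir (z - q)) (dir (z - p)))).
    by move=> z Dz; rewrite /th' mem_set.
  apply: cont_on_cont => z /far[zM zp zq d0].
  by apply: cvg_turn; rewrite ?sqnorm_dirB //; [exact: dot_dir_gt0|exact: cvg_dirB..].
have hth' z : A' z -> rot (th' z) (dir (z - q)) = dir (z - p).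
  move=> [Az|Dz]; first by rewrite -thA // hth.
  rewrite /th' mem_set //; have [zM zp zq d0] := far z Dz.
  by rewrite rot_turn ?sqnorm_dirB //; exact: dot_dir_gt0.
have nA'p : ~ A' p by move=> [//|/far[_]]; rewrite eqxx.
have nA'q : ~ A' q by move=> [//|/far[_ _]]; rewrite eqxx.
apply: (@component_subset (~` A')); first by move=> z h Az; apply: h; left.
apply: contrapT => npq.
have oA' : open (~` A') by exact: closed_openC.
set U := connected_component (~` A') p in npq.
have oU : open U by exact: component_open.
have Up : U p by exact: connected_component_refl.
have clU z : closure U z -> U z \/ A' z.
  move=> cz; have [Az|nAz] := pselect (A' z); [by right|left].
  exact: closure_component.
have [K hK] : exists K, forall z, A' z -> `|th' z| <= K.
  have [K hK] := cont_on_bounded M clA' cth'.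
  exists (Num.max K pi) => z Az; rewrite le_max.
  have [zM|zM] := leP `|z| M; first by rewrite hK.
  have [zM1 zp zq d0] := far z (ltW zM).
  apply/orP; right; rewrite /th' mem_set; last exact: ltW.
  have := turn_small (sqnorm_dirB zq) (sqnorm_dirB zp) (dot_dir_gt0 d0).
  by have := pi_gt0 R; lra.
have [g [gA cg _]] : exists g : R * R -> R^o, [/\ {in A', th' =1 g}, continuous g &
    forall x, `|g x| <= Num.max K 1].
  apply: continuous_bounded_extension => //.
  - exact: pseudometric_normal.
  - by rewrite lt_max ltr01 orbT.
  - exact/subspace_continuousP.
  - by move=> z /hK h; rewrite le_max h.
pose f z := if pselect (closure U z) then rot (g z) (dir (z - q)) else dir (z - p).
have nUq : ~ closure U q by move=> /clU[].
have Uq z : closure U z -> z != q by move=> h; exact: neq_notin h nUq.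
have Unp z : ~ U z -> z != p by move=> h; apply: contra_notN h => /eqP ->.
have cfU z : z != q -> rot (g x) (dir (x - q)) @[x --> z] --> rot (g z) (dir (z - q)).
  by move=> zq; apply: cvg_rot; [exact: cg|exact: cvg_dirB].
apply: (@no_unit_field _ f p M).
- move=> z; have [Uz|nUz] := pselect (U z).
    have cUz : closure U z by exact: subset_closure.
    have fz : f z = rot (g z) (dir (z - q)) by rewrite /f; case: pselect.
    rewrite /continuous_at fz; apply: cvg_trans (cfU z (Uq z cUz)); apply: near_eq_cvg.
    apply: filterS (open_nbhs_nbhs (conj oU Uz)) => x Ux /=.
    by rewrite /f; case: pselect => // -[]; exact: subset_closure.
  have [cUz|ncUz] := pselect (closure U z); last first.
    have fz : f z = dir (z - p) by rewrite /f; case: pselect.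
    rewrite /continuous_at fz; apply: cvg_trans (cvg_dirB (Unp z nUz)); apply: near_eq_cvg.
    have : nbhs z (~` closure U).
      by apply: open_nbhs_nbhs; split => //; exact/closed_openC/closed_closure.
    by apply: filterS => x ncUx /=; rewrite /f; case: pselect.
  have A'z : A' z by case: (clU z cUz).
  have fz : f z = dir (z - p).
    by rewrite /f; case: pselect => // ?; rewrite -gA ?mem_set // hth'.
  rewrite /continuous_at fz /f; apply: cvg_if; last exact/cvg_dirB/Unp.
  rewrite -(hth' z A'z) gA ?mem_set //.
  exact/cfU/Uq.
- move=> z; rewrite /f; case: (pselect (closure U z)) => h.
    by rewrite sqnorm_rot sqnorm_dirB //; exact: Uq.
  by rewrite sqnorm_dirB //; apply: Unp => Uz; apply: h; exact: subset_closure.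
- move=> z zM; rewrite /f; case: (pselect (closure U z)) => // ?.
  by rewrite -gA ?hth' // ?mem_set //; right.
Qed.
End Plane.

(** * Lifts along pseudolines and their gluing *)

Section Plane.
Variable R : realType.
Implicit Types (u v w z p q : R * R) (A B : set (R * R)) (t : R) (g : R -> R * R).

Lemma lift_glue A B p q (f f' : R * R -> R) : closed A -> closed B -> turn_lift A p q f -> turn_lift B p q f' ->
  (forall z, A z -> B z -> f z = f' z) -> liftable (A `|` B) p q.
Proof.
move=> clA clB [cf hf [M1 hM1]] [cg hg [M2 hM2]] fg.
pose h z := if pselect (A z) then f z else f' z.
have hA z : A z -> f z = h z by rewrite /h; case: pselect.
have hB z : B z -> f' z = h z by move=> Bz; rewrite /h; case: (pselect (A z)) => // Az; rewrite fg.
exists h; split.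
- by apply: cont_onU => //; [exact: cont_on_eq cf|exact: cont_on_eq cg].
- by move=> z [Az|Bz]; [rewrite -hA // hf|rewrite -hB // hg].
- exists (Num.max M1 M2) => z Cz; rewrite ge_max => /andP[z1 z2].
  by case: Cz => [Az|Bz]; [rewrite -hA // hM1|rewrite -hB // hM2].
Qed.

Lemma rot_cos1 t v : cos t = 1 -> rot t v = v.
Proof.
move=> c1; have s0 : sin t = 0.
  by apply/eqP; rewrite -sqrf_eq0; have := cos2Dsin2 t; rewrite c1 expr1n => h; apply/eqP; lra.
by case: v => a b; rewrite /rot c1 s0 /= !mul0r !mul1r subr0 add0r.
Qed.

Section ProperCurve.
Variable g : R -> R * R.
Hypothesis pg : pseudoline g.

Lemma pseudoline_continuous : continuous g. Proof. by case: pg. Qed.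

Lemma pseudoline_inj : injective g. Proof. by case: pg. Qed.

Lemma pseudoline_proper M : exists2 T, 0 < T & forall t, T <= `|t| -> M <= `|g t|.
Proof.
case: pg => _ _ /cvgryPge/(_ M) [T1 [_ h1]] /cvgryPge/(_ M) [T2 [_ h2]].
exists (Num.max (`|T1| + 1) (`|T2| + 1)); first by rewrite lt_max ltr_wpDl.
move=> t; rewrite ge_max => /andP[t1 t2].
have [t0|t0] := leP 0 t.
- apply: h1; move: t1; rewrite (ger0_norm t0); apply: lt_le_trans.
  by rewrite (le_lt_trans (ler_norm _)) // ltrDl.
- apply: h2; move: t2; rewrite (ltr0_norm t0) lerNr => t2; rewrite (le_lt_trans t2) //.
  by have := lerNnormlW (lexx `|T2|); lra.
Qed.

Lemma pseudoline_closed (C : set R) : closed C -> closed (g @` C).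
Proof.
move=> clC z cz.
have [T T0 hT] := pseudoline_proper (`|z| + 1).
pose K := g @` (C `&` `[- T, T]%classic).
have cK : closed K.
  apply: compact_closed; first exact: norm_hausdorff.
  apply: continuous_compact; first exact/continuous_subspaceT/pseudoline_continuous.
  apply: (@subclosed_compact _ _ `[- T, T]%classic); [|exact: segment_compact|by move=> x []].
  by apply: closedI => //; exact: interval_closed.
suff : K z by move=> [t [Ct _] <-]; exists t.
apply: cK => W zW.
have : nbhs z (ball z 1) by exact: nbhsx_ballx.
move=> /(filterI zW)/cz[_ [[t Ct <-] [Wt]]]; rewrite -ball_normE /= => zt.
exists (g t); split => //; exists t => //; split => //.
rewrite /= in_itv /= -ler_norml leNgt; apply/negP => /ltW/hT.
have : `|g t| <= `|z - g t| + `|z| by rewrite distrC -{1}(subrK z (g t)) ler_normD.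
lra.
Qed.

Lemma ray_closed t : closed (g @` [set s | t <= s]).
Proof. exact/pseudoline_closed/closed_ge. Qed.

Lemma rayN_closed t : closed (g @` [set s | s <= t]).
Proof. exact/pseudoline_closed/closed_le. Qed.

Lemma range_closed : closed (range g).
Proof. exact/pseudoline_closed/closedT. Qed.

(** Far out the principal angle is a lift. A lift on a ray extends backwards over a short arc on
    which directions hardly turn; so the parameters from which a lift exists are open and closed. *)
Lemma ray_liftable p q t : ~ range g p -> ~ range g q -> liftable (g @` [set s | t <= s]) p q.
Proof.
move=> ngp ngq.
have gp s : g s != p by apply/eqP => h; apply: ngp; exists s.
have gq s : g s != q by apply/eqP => h; apply: ngq; exists s.
pose P t := liftable (g @` [set s | t <= s]) p q.
have mono a b : a <= b -> P a -> P b.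
  move=> ab [f [cf hf [M hM]]].
  have sub z : (g @` [set s | b <= s]) z -> (g @` [set s | a <= s]) z.
    by move=> [s /= bs <-]; exists s => //=; exact: le_trans bs.
  exists f; split.
  - move=> z /[dup] Bz /sub Az W Wf; have := cf z Az W Wf.
    by apply: (@filterS _ (nbhs z)) => x hx /sub; exact: hx.
  - by move=> z /sub; exact: hf.
  - by exists M => z /sub; exact: hM.
have local c : exists2 e, 0 < e & forall a b, c - e < a -> a <= b -> b < c + e -> P b -> P a.
  have [s1 e1] := unit_angle (sqnorm_dirB (gq c)).
  have [s2 e2] := unit_angle (sqnorm_dirB (gp c)).
  (* A value of the angle at [g c]; on a short arc around it the principal angle measures the
     deviation from [t0]. *)
  pose t0 := s2 - s1.
  have ht0 : rot t0 (dir (g c - q)) = dir (g c - p) by rewrite e1 -rotD subrK -e2.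
  have cg := pseudoline_continuous (x := c).
  have n1 : \forall s \near c, 0 < dot (rot t0 (dir (g s - q))) (dir (g s - p)).
    have cd r : (forall s, g s != r) -> dir (g x - r) @[x --> c] --> dir (g c - r).
      by move=> gr; apply: cvg_dir; [rewrite subr_eq0|apply: cvgB; [exact: cg|exact: cvg_cst]].
    have : dot (rot t0 (dir (g s - q))) (dir (g s - p)) @[s --> c] --> dot (rot t0 (dir (g c - q))) (dir (g c - p)).
      by apply: cvg_dot; [apply: cvg_rot; [exact: cvg_cst|exact: cd]|exact: cd].
    rewrite ht0 /dot -!expr2 -/(sqnorm _) (sqnorm_dirB (gp c)) => /cvgr_gt; apply; exact: ltr01.
  have n2 : \forall s \near c, `|g s| < `|g c| + 1.
    have : `|g s| @[s --> c] --> `|g c| by apply: cvg_norm; exact: cg.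
    by move/cvgr_lt; apply; rewrite ltrDl.
  have n12 : nbhs c [set s | 0 < dot (rot t0 (dir (g s - q))) (dir (g s - p)) /\ `|g s| < `|g c| + 1].
    exact: filterI n1 n2.
  move/nbhs_ballP : n12 => [e /= e0 he].
  exists e => // a b ca ab bc [f [cf hf [M hM]]].
  have near_ab s : a <= s -> s <= b ->
      0 < dot (rot t0 (dir (g s - q))) (dir (g s - p)) /\ `|g s| < `|g c| + 1.
    move=> as_ sb; have [] // := he s.
    by rewrite -ball_normE /= ltr_norml; apply/andP; split; lra.
  pose thB z := turn (rot t0 (dir (z - q))) (dir (z - p)) + t0.
  pose B := g @` [set s | a <= s <= b].
  have hB z : B z -> exists s, [/\ z = g s, a <= s & s <= b].
    by move=> [s /= /andP[h1 h2] <-]; exists s.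
  have rotB z : B z -> rot (thB z) (dir (z - q)) = dir (z - p).
    move=> /hB[s [-> as_ sb]]; have [d0 _] := near_ab s as_ sb.
    by rewrite rotD rot_turn ?sqnorm_rot ?sqnorm_dirB.
  have Bb : B (g b) by exists b => //=; rewrite ab lexx.
  (* At the common point [g b] the two determinations differ by a multiple of a full turn, by which
     the one on the arc is corrected. *)
  pose d := f (g b) - thB (g b).
  have cd : cos d = 1.
    apply: (@rot_eq_near _ _ _ (dir (g b - q))); first exact: sqnorm_dirB.
    by rewrite rotB // hf //; exists b => //=; exact: lexx.
  have -> : P a = liftable (g @` [set s | b <= s] `|` B) p q.
    rewrite /P; congr (liftable _ p q); apply/seteqP; split => z.
      move=> [s /= as_ <-]; have [bs|sb] := leP b s; [by left; exists s|right].
      by exists s => //=; rewrite as_ ltW.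
    by move=> [[s /= bs <-]|/hB[s [-> as_ _]]]; exists s => //=; exact: le_trans bs.
  apply: (@lift_glue _ _ _ _ f (fun z => d + thB z)).
  - exact: ray_closed.
  - apply: pseudoline_closed.
    have -> : [set s | a <= s <= b] = [set s | a <= s] `&` [set s | s <= b].
      by apply/seteqP; split => s /andP.
    by apply: closedI; [exact: closed_ge|exact: closed_le].
  - by split => //; exists M.
  - split.
    + apply: cont_on_cont => z /hB[s [-> as_ sb]]; have [d0 _] := near_ab s as_ sb.
      apply: cvgD; first exact: cvg_cst.
      apply: cvgD; last exact: cvg_cst.
      apply: cvg_turn; rewrite ?sqnorm_rot ?sqnorm_dirB //; last exact: cvg_dirB.
      by apply: cvg_rot; [exact: cvg_cst|exact: cvg_dirB].
    + by move=> z Bz; rewrite rotD rotB // rot_cos1.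
    + exists (`|g c| + 1) => z /hB[s [-> as_ sb]]; have [_] := near_ab s as_ sb.
      by rewrite ltNge => /negP.
  - move=> z [s /= bs <-] /hB[s' [/pseudoline_inj <- _ sb]].
    have -> : s = b by apply/le_anti/andP.
    by rewrite subrK.
suff : forall r s, P r -> P s.
  have [M hM] := dir_far p q; have [T T0 hT] := pseudoline_proper M.
  move=> /(_ T t); apply; apply: liftable_near.
  - by move=> [s _ h]; apply: ngp; exists s.
  - by move=> [s _ h]; apply: ngq; exists s.
  - move=> z [s /= Ts <-]; have [] // := hM (g s); apply: hT.
    by rewrite ger0_norm // (le_trans (ltW T0)).
apply: clopen_R => c; have [e e0 he] := local c.
apply/nbhs_ballP; exists e => //= s; rewrite -ball_normE /= ltr_norml => /andP[h1 h2].
have [sc|cs] := leP s c; split.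
- by apply: he; lra.
- exact: mono.
- exact/mono/ltW.
- by apply: he; lra.
Qed.

End ProperCurve.

Lemma pseudolineN g : pseudoline g -> pseudoline (g \o -%R).
Proof.
move=> [cg ig g1 g2]; split.
- by move=> t; apply: continuous_comp; [exact: opp_continuous|exact: cg].
- by move=> s t /= /ig /oppr_inj.
- by apply: (@cvg_comp _ _ _ -%R (fun t => `|g t|) _ _ _ _ g2); rewrite ninfty.
- by apply: (@cvg_comp _ _ _ -%R (fun t => `|g t|) _ _ _ _ g1); rewrite ninftyN.
Qed.

Lemma rayN_liftable g p q t : pseudoline g -> ~ range g p -> ~ range g q ->
  liftable (g @` [set s | s <= t]) p q.
Proof.
move=> pg ngp ngq; have -> : g @` [set s | s <= t] = (g \o -%R) @` [set s | - t <= s].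
  apply/seteqP; split => z [s /= h <-]; exists (- s) => /=; rewrite ?opprK //; lra.
apply: ray_liftable; first exact: pseudolineN.
- by move=> [s _ h]; apply: ngp; exists (- s).
- by move=> [s _ h]; apply: ngq; exists (- s).
Qed.

(** Lifts on two disjoint rays glue without any matching condition. *)
Lemma two_rays_component g a b p q : pseudoline g -> a < b -> ~ range g p -> ~ range g q ->
  connected_component (~` (g @` [set s | s <= a] `|` g @` [set s | b <= s])) p q.
Proof.
move=> pg ab ngp ngq; apply: liftable_component.
- by apply: closedU; [exact: rayN_closed|exact: ray_closed].
- by move=> [|] [s _ h]; apply: ngp; exists s.
- by move=> [|] [s _ h]; apply: ngq; exists s.
have [f hf] := rayN_liftable a pg ngp ngq; have [f' hf'] := ray_liftable pg b ngp ngq.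
apply: (lift_glue _ _ hf hf'); [exact: rayN_closed|exact: ray_closed|].
move=> z [s /= sa <-] [s' /= bs' /(pseudoline_inj pg) ss']; move: ab bs' sa; rewrite ss'; lra.
Qed.

Lemma cos1_eq0 t : cos t = 1 -> `|t| < pi -> t = 0.
Proof.
move=> ct tpi; apply/normr0_eq0.
apply: (@cos_inj R); rewrite ?in_itv /= ?normr_ge0 ?lexx ?pi_ge0 ?ltW // cos0.
by have [t0|t0] := leP 0 t; [rewrite ger0_norm|rewrite ltr0_norm ?cosN].
Qed.

(* Lifts on [A] and on [range g] differ by a constant multiple of a turn on each ray of [g] contained in
   [A], and this multiple is zero because both are small at infinity: so they can be glued. *)
Lemma janiszewski A g p q : closed A -> pseudoline g -> ~ A p -> ~ A q ->
  connected_component (~` A) p q -> connected_component (~` range g) p q ->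
  (forall t, A (g t) -> (forall s, s <= t -> A (g s)) \/ (forall s, t <= s -> A (g s))) ->
  connected_component (~` (A `|` range g)) p q.
Proof.
move=> clA pg nAp nAq Apq gpq rays.
have ngp : ~ range g p by have [C [Cp Cg _] _] := gpq; exact: Cg.
have ngq : ~ range g q by have [C [Cp Cg _] /Cg] := gpq.
have clg : closed (range g) by exact: range_closed.
have [f hf] := component_liftable clA Apq.
have [f' hf'] := component_liftable clg gpq.
apply: liftable_component; [exact: closedU|by case|by case|].
apply: (lift_glue clA clg hf hf').
case: hf => cf hf [M1 hM1]; case: hf' => cf' hf' [M2 hM2].
move=> _ /[swap] [[t _ <-]] At.
have cg := pseudoline_continuous pg.
have gq s : g s != q by apply/eqP => h; apply: ngq; exists s.
pose h s := f (g s) - f' (g s).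
have ch s : A (g s) -> cos (h s) = 1.
  move=> As; apply: (@rot_eq_near _ _ _ (dir (g s - q))); first exact: sqnorm_dirB.
  by rewrite hf // hf' //; exists s.
have h_near s : A (g s) -> \forall r \near s, A (g r) -> (h s = 0 <-> h r = 0).
  move=> As.
  have : h r @[r --> within [set r | A (g r)] (nbhs s)] --> h s.
    apply: cvgB.
    + move=> W /(cf _ As) hW; have := cg s _ hW.
      by apply: (@filterS _ (nbhs s)) => r; apply.
    + have gs : range g (g s) by exists s.
      move=> W /(cf' _ gs) hW; have := cg s _ hW.
      by apply: (@filterS _ (nbhs s)) => r hr _; apply: hr; exists r.
  have pi0 := pi_gt0 R.
  have [hs|hs] := eqVneq (h s) 0.
  - move=> /cvgrPdist_lt/(_ pi pi0); apply: (@filterS _ (nbhs s)) => r hr Ar.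
    split => // _; apply: cos1_eq0; first exact: ch.
    by have := hr Ar; rewrite hs sub0r normrN.
  - rewrite -normr_gt0 in hs.
    move=> /cvgrPdist_lt/(_ _ hs); apply: (@filterS _ (nbhs s)) => r hr Ar.
    split => [h0|r0]; first by move: hs; rewrite h0 normr0 ltxx.
    by have := hr Ar; rewrite r0 subr0 ltxx.
have [T T0 hT] := pseudoline_proper pg (Num.max M1 M2).
have far s : T <= `|s| -> A (g s) -> h s = 0.
  move=> /hT; rewrite ge_max => /andP[s1 s2] As; apply: cos1_eq0; first exact: ch.
  have := hM1 _ As s1; have := hM2 (g s) (ex_intro2 _ _ s I erefl) s2.
  by rewrite /h; have := ler_normB (f (g s)) (f' (g s)); lra.
suff : h t = 0 by move/subr0_eq.
have conn (C : set R) s : connected C -> (forall r, C r -> A (g r)) -> C t -> C s -> T <= `|s| -> h t = 0.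
  move=> cC CA Ct Cs Ts; apply: (@connected_ind _ C (fun r => h r = 0) cC _ s t) => //; last first.
    exact/far/CA.
  move=> r Cr; have := h_near r (CA r Cr).
  by apply: (@filterS _ (nbhs r)) => r' hr' /CA.
have [hl|hr] := rays t At.
- apply: (conn [set s | s <= t] (Num.min t (- T))) => //=; rewrite ?lexx ?ge_min ?lexx //.
    by apply/connected_intervalP => x y /= _ yt z /andP[_ zy]; exact: le_trans yt.
  by rewrite ler_normr; apply/orP; right; rewrite lerNr ge_min lexx orbT.
- apply: (conn [set s | t <= s] (Num.max t T)) => //=; rewrite ?lexx ?le_max ?lexx //.
    by apply/connected_intervalP => x y /= tx _ z /andP[xz _]; exact: le_trans xz.
  by rewrite ler_normr; apply/orP; left; rewrite le_max lexx orbT.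
Qed.

End Plane.

(** * Connected sets in the plane *)

Section Plane.
Variable R : realType.
Implicit Types (u v w z p q x : R * R) (A B Q : set (R * R)) (t : R) (g : R -> R * R).

Lemma hsegment_component A a a' b : (forall t, a <= t <= a' \/ a' <= t <= a -> A (t, b)) ->
  connected_component A (a, b) (a', b).
Proof.
wlog aa' : a a' / a <= a'.
  move=> h hA; have [|/ltW] := leP a a'; first by move/h; apply.
  by move=> a'a; apply/connected_component_sym/h => // t [] ?; apply: hA; [right|left].
move=> hA; exists ((fun t => (t, b)) @` `[a, a']%classic).
  split; first by exists a => //=; rewrite in_itv /= lexx.
    by move=> _ [t /= /[!in_itv] /= ta <-]; apply: hA; left.
  apply: connected_continuous_connected; first exact: segment_connected.
  by apply: continuous_subspaceT => t; apply: cvg_pair2; [exact: cvg_id|exact: cvg_cst].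
by exists a' => //=; rewrite in_itv /= lexx aa'.
Qed.

Lemma vsegment_component A a b b' : (forall t, b <= t <= b' \/ b' <= t <= b -> A (a, t)) ->
  connected_component A (a, b) (a, b').
Proof.
wlog bb' : b b' / b <= b'.
  move=> h hA; have [|/ltW] := leP b b'; first by move/h; apply.
  by move=> b'b; apply/connected_component_sym/h => // t [] ?; apply: hA; [right|left].
move=> hA; exists ((fun t => (a, t)) @` `[b, b']%classic).
  split; first by exists b => //=; rewrite in_itv /= lexx.
    by move=> _ [t /= /[!in_itv] /= ta <-]; apply: hA; left.
  apply: connected_continuous_connected; first exact: segment_connected.
  by apply: continuous_subspaceT => t; apply: cvg_pair2; [exact: cvg_cst|exact: cvg_id].
by exists b' => //=; rewrite in_itv /= lexx bb'.
Qed.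

Lemma in_ballE x e a b : ball x e (a, b) <-> (`|x.1 - a| < e) /\ (`|x.2 - b| < e).
Proof. by rewrite -ball_normE /= prod_normE /= gt_max; split => /andP. Qed.

(** The ball is a square: from any point a horizontal and a vertical segment lead to one fixed
    point, taken in the order that avoids the centre. *)
Lemma punctured_ball_component A x e y : 0 < e -> (forall z, ball x e z -> z != x -> A z) ->
  ball x e y -> y != x -> connected_component A y (x.1 + e / 2, x.2 + e / 2).
Proof.
case: x y => [x1 x2] [a b] e0 hA; rewrite in_ballE /= => -[ha hb] yx.
have e2 : `|x1 - (x1 + e / 2)| < e /\ `|x2 - (x2 + e / 2)| < e.
  by split; rewrite ltr_norml; lra.
have mid (c d d' t : R) : `|c - d| < e -> `|c - d'| < e -> d <= t <= d' \/ d' <= t <= d -> `|c - t| < e.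
  by rewrite !ltr_norml; lra.
have [ax|ax] := eqVneq a x1.
- have bx : b != x2 by move: yx; rewrite ax; apply: contra_neq => ->.
  apply: (@connected_component_trans _ _ (x1 + e / 2, b)).
  + apply: hsegment_component => t ht; apply: hA; first by rewrite in_ballE /= (mid _ _ _ _ ha e2.1 ht).
    by apply: contra_neq bx => -[].
  + apply: vsegment_component => t ht; apply: hA; first by rewrite in_ballE /= (mid _ _ _ _ hb e2.2 ht) e2.1.
    by apply/eqP => -[]; move: e0; lra.
- apply: (@connected_component_trans _ _ (a, x2 + e / 2)).
  + apply: vsegment_component => t ht; apply: hA; first by rewrite in_ballE /= (mid _ _ _ _ hb e2.2 ht).
    by apply: contra_neq ax => -[].
  + apply: hsegment_component => t ht; apply: hA; first by rewrite in_ballE /= (mid _ _ _ _ ha e2.1 ht) e2.2.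
    by apply/eqP => -[]; move: e0; lra.
Qed.

Lemma connected_component_connected (T : topologicalType) (A : set T) :
  (forall y y', A y -> A y' -> connected_component A y y') -> connected A.
Proof.
move=> h; have [->|/set0P[y Ay]] := eqVneq A set0; first exact: connected0.
have <- : connected_component A y = A; last exact: component_connected.
by apply/seteqP; split; [exact: connected_component_sub|move=> y'; exact: h].
Qed.

Lemma connected_puncture Q x : open Q -> connected Q -> connected (Q `\ x).
Proof.
move=> oQ cQ; have [Qx|nQx] := pselect (Q x); last first.
  have -> // : Q `\ x = Q.
  by apply/seteqP; split => y; [case|move=> Qy; split => // yx; apply: nQx; rewrite -yx].
have /nbhs_ballP[e /= e0 he] := open_nbhs_nbhs (conj oQ Qx).
have oQx : open (Q `\ x).
  by apply: openI => //; apply: closed_openC; apply: accessible_closed_set1; exact/hausdorff_accessible/norm_hausdorff.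
have hA z : ball x e z -> z != x -> (Q `\ x) z by move=> /he Qz /eqP zx; split.
pose y0 := (x.1 + e / 2, x.2 + e / 2).
suff H p : (Q `\ x) p -> connected_component (Q `\ x) p y0.
  apply: connected_component_connected => p q /H h1 /H h2.
  apply: connected_component_trans h1 _; exact: connected_component_sym.
move=> Qp; apply: contrapT => nK; set K := connected_component (Q `\ x) p in nK.
have : K x.
  apply: (@connected_clopen _ Q K p x cQ) => //; [exact: component_open| |by case: Qp|exact: connected_component_refl].
  move=> z [clz Qz]; have [zx|/eqP zx] := eqVneq z x; last by apply: closure_component.
  exfalso; apply: nK; have : nbhs z (ball x e) by rewrite zx; exact: nbhsx_ballx.
  move=> /clz[w [Kw xw]]; apply: connected_component_trans (Kw) _.
  apply: punctured_ball_component xw _ => //.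
  by apply/eqP; have [] := connected_component_sub Kw.
by move=> /connected_component_sub[_ /(_ erefl)].
Qed.

(** Allows the finitely many crossing points to be removed from a cell, so that a boundary point met
    there is on one curve only. *)
Lemma connected_punctures Q (s : seq (R * R)) : open Q -> connected Q ->
  open (Q `&` [set z | z \notin s]) /\ connected (Q `&` [set z | z \notin s]).
Proof.
move=> oQ cQ; elim: s => [|x s [oI cI]].
  by have -> : Q `&` [set z | z \notin [::]] = Q by apply/seteqP; split => z //=; case.
have -> : Q `&` [set z | z \notin x :: s] = (Q `&` [set z | z \notin s]) `\ x.
  apply/seteqP; split => z /=; rewrite inE negb_or; first by move=> [Qz /andP[/eqP zx zs]].
  by move=> [[Qz zs] /eqP zx]; rewrite zx.
split; last exact: connected_puncture.
by apply: openI => //; apply: closed_openC; apply: accessible_closed_set1; exact/hausdorff_accessible/norm_hausdorff.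
Qed.

(** If the side of [p] stayed away from [g u], it would remain open and closed after a short arc
    about [u] is deleted from the curve. But the two rays left over do not separate [p] from [q]. *)
Lemma pseudoline_closure g p q (u : R) : pseudoline g -> ~ range g p -> ~ range g q ->
  ~ connected_component (~` range g) p q -> closure (connected_component (~` range g) p) (g u).
Proof.
move=> pg ngp ngq npq; apply: contrapT => ncu.
set K := connected_component (~` range g) p in npq ncu.
have og : open (~` range g) by apply: closed_openC; exact: range_closed.
have : nbhs (g u) (~` closure K).
  by apply: open_nbhs_nbhs; split => //; exact/closed_openC/closed_closure.
move=> /(pseudoline_continuous pg) /nbhs_ballP[e /= e0 he].
have ab : u - e / 2 < u + e / 2 by lra.
have Wpq := two_rays_component pg ab ngp ngq; set W := (~` _) in Wpq.
apply: npq; apply: (@connected_clopen _ (connected_component W p) K p q) => //.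
- exact: component_connected.
- exact: component_open.
- move=> z [cz /connected_component_sub Wz].
  have [gz|ngz] := pselect (range g z); last exact: closure_component.
  exfalso; have [s _ hs] := gz; apply: (he s); last by rewrite /= hs.
  rewrite -ball_normE /= ltr_norml; apply/andP; split; rewrite ltNge; apply/negP => h; apply: Wz.
  + by right; exists s => //=; lra.
  + by left; exists s => //=; lra.
- apply: connected_component_refl => -[|] [s _ h]; apply: ngp; by exists s.
- exact: connected_component_refl.
Qed.

End Plane.

(** * Sides of pseudolines *)

Section Arrangement.
Variables (R : realType) (n : nat) (l : 'I_n -> R -> R * R).
Hypothesis arr : pseudoline_arrangement l.
Implicit Types (p q z w : R * R) (i j k : 'I_n) (s : seq 'I_n) (u v t : R).

Local Notation side i p q := (connected_component (~` range (l i)) p q).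
Local Notation compl := (arrangement_complement l).

Definition compl_seq s : set (R * R) := [set z | forall i, i \in s -> ~ range (l i) z].

Lemma arr_pseudoline i : pseudoline (l i). Proof. by case: arr. Qed.

Lemma side_l i p q : side i p q -> ~ range (l i) p.
Proof. by move=> [C [Cp CA _] _]; exact: CA. Qed.

Lemma side_r i p q : side i p q -> ~ range (l i) q.
Proof. exact: connected_component_sub. Qed.

Lemma compl_seqE : compl_seq (enum 'I_n) = compl.
Proof. by apply/seteqP; split => z h i; [apply: h; rewrite mem_enum|move=> _; exact: h]. Qed.

Lemma open_line_compl i : open (~` range (l i)).
Proof. exact/closed_openC/range_closed/arr_pseudoline. Qed.

Lemma open_compl_seq s : open (compl_seq s).
Proof.
elim: s => [|j s IH].
  have -> : compl_seq [::] = setT; last exact: openT.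
  by apply/seteqP; split.
have -> : compl_seq (j :: s) = ~` range (l j) `&` compl_seq s.
  apply/seteqP; split => z.
    by move=> h; split; [apply: h; rewrite mem_head|move=> i si; apply: h; rewrite in_cons si orbT].
  by move=> [h1 h2] i; rewrite in_cons => /predU1P[->|/h2].
by apply: openI => //; exact: open_line_compl.
Qed.

Lemma open_compl : open compl.
Proof. by rewrite -compl_seqE; exact: open_compl_seq. Qed.

Lemma component_side s i p q : i \in s -> connected_component (compl_seq s) p q -> side i p q.
Proof. by move=> si; apply: component_subset => z; exact. Qed.

Lemma crossing i j : i != j -> exists t, [/\ range (l i) (l j t),
  forall u, range (l i) (l j u) -> u = t,
  forall u v, u < t -> v < t -> side i (l j u) (l j v),
  forall u v, t < u -> t < v -> side i (l j u) (l j v) &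
  forall u v, u < t -> t < v -> ~ side i (l j u) (l j v)].
Proof.
move=> ij; have [s [t [st uniq sep]]] := arr.2 i j ij.
have off u : u != t -> ~ range (l i) (l j u).
  by move=> /eqP ut [s' _ /uniq[]].
have conn (C : set R) u v : connected C -> (forall r, C r -> r != t) -> C u -> C v -> side i (l j u) (l j v).
  move=> cC Ct Cu Cv; exists (l j @` C); last by exists v.
  split; first by exists u.
  - by move=> _ [r Cr <-]; exact/off/Ct.
  - by apply: connected_continuous_connected => //; exact/continuous_subspaceT/pseudoline_continuous/arr_pseudoline.
exists t; split.
- by exists s.
- by move=> u [s' _ /uniq[]].
- move=> u v ut vt; apply: (conn [set r | r < t]) => //; last by move=> r /= rt; rewrite lt_eqF.
  by apply/connected_intervalP => x y /= _ yt r /andP[_ zy]; exact: le_lt_trans yt.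
- move=> u v ut vt; apply: (conn [set r | t < r]) => //; last by move=> r /= rt; rewrite gt_eqF.
  by apply/connected_intervalP => x y /= tx _ r /andP[xz _]; exact: lt_le_trans xz.
- by move=> u v ut tv; apply: sep; [exists u|exists v].
Qed.

(** Of the two rays into which the crossing cuts [l j], at most one is on the side of [p]. This is
    the ray condition of [janiszewski]. *)
Lemma not_side_rays i j p t : i != j -> ~ side i p (l j t) ->
  (forall u, u <= t -> ~ side i p (l j u)) \/ (forall u, t <= u -> ~ side i p (l j u)).
Proof.
move=> ij np; have [t0 [_ _ hl hr hlr]] := crossing ij.
apply: contrapT => /not_orP[/existsNP[u /not_implyP[ut /contrapT pu]] /existsNP[v /not_implyP[tv /contrapT pv]]].
have uv : side i (l j u) (l j v) by exact: connected_component_trans (connected_component_sym pu) pv.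
have tu : u < t.
  by rewrite lt_neqAle ut andbT; apply/eqP => tu; apply: np; rewrite -tu.
have tv' : t < v.
  by rewrite lt_neqAle tv andbT; apply/eqP => tv'; apply: np; rewrite tv'.
have [ut0|t0u] := ltP u t0.
- have [vt0|] := ltP v t0.
    by apply: np; apply: connected_component_trans pu (hl _ _ _ _) => //; exact: lt_trans vt0.
  rewrite le_eqVlt => /predU1P[t0v|/(hlr _ _ ut0)//].
  by apply: np; apply: connected_component_trans pu (hl _ _ ut0 _); rewrite t0v.
- apply: np; apply: connected_component_trans pv (hr _ _ _ _); apply: (le_lt_trans t0u) => //.
  exact: lt_trans tv'.
Qed.

(** Induction on the curves: [janiszewski] is applied to the complement of the cell [Q] of the
    curves treated so far, together with the next curve. *)
Lemma sides_component s p q : (forall i, i \in s -> side i p q) -> connected_component (compl_seq s) p q.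
Proof.
elim: s p q => [|j s IH] p q hs.
  have [C [cC Cp Cq _]] := segment_ball p q.
  by exists C => //; split.
have hs' i : i \in s -> side i p q by move=> si; apply: hs; rewrite in_cons si orbT.
have pqj : side j p q by apply: hs; rewrite mem_head.
have pq := IH _ _ hs'.
have [js|js] := boolP (j \in s).
  apply: component_subset pq => z hz i; rewrite in_cons => /predU1P[->|]; exact: hz.
pose Q := connected_component (compl_seq s) p.
have oQ : open Q by exact/component_open/open_compl_seq.
have Qp : Q p by apply: connected_component_refl => i si; exact: side_l (hs' i si).
have := @janiszewski _ (~` Q) (l j) p q.
have CC : ~` (~` Q `|` range (l j)) `<=` compl_seq (j :: s).
  move=> z h i; rewrite in_cons => /predU1P[->|si]; first by move=> hz; apply: h; right.
  have : Q z by apply: contrapT => nQ; apply: h; left.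
  by move/connected_component_sub; apply.
move=> J; apply: component_subset CC _; apply: J => //.
- exact: open_closedC.
- exact: arr_pseudoline.
- by rewrite setCK; exists Q => //; split => //; exact: component_connected.
move=> t nQt.
have [i si nt] : exists2 i, i \in s & ~ side i p (l j t).
  by apply: contrapT => h; apply/nQt/IH => i si; apply: contrapT => nt; apply: h; exists i.
have ij : i != j by apply: contraNneq js => <-.
by have [h|h] := not_side_rays ij nt; [left|right] => u /h nu Qu; exact/nu/(component_side si Qu).
Qed.

Lemma sides_region p q : (forall i, side i p q) -> connected_component compl p q.
Proof. by move=> h; rewrite -compl_seqE; apply: sides_component => i _; exact: h. Qed.

Lemma region_side p q i : connected_component compl p q -> side i p q.
Proof. by rewrite -compl_seqE; apply: component_side; rewrite mem_enum. Qed.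

Lemma near_sides j z : (forall i, i != j -> ~ range (l i) z) ->
  \forall w \near z, forall i, i != j -> side i z w.
Proof.
move=> hz; apply: (@filter_forall _ _ (fun i w => i != j -> side i z w) (nbhs z) _) => i.
have [_|ij] := eqVneq i j; first by near=> w.
have nz := hz i ij.
have : nbhs z (connected_component (~` range (l i)) z).
  apply: open_nbhs_nbhs; split; first exact/component_open/open_line_compl.
  exact: connected_component_refl.
by apply: (@filterS _ (nbhs z)) => w.
Unshelve. all: by end_near. Qed.

(** The side of [q] accumulates at [l j u], and near this point the sides with respect to the other
    curves do not change. *)
Lemma touching_region j q q' u : side j q q -> side j q' q' -> ~ side j q q' ->
  (forall i, i != j -> ~ range (l i) (l j u)) ->
  exists p, [/\ compl p, side j q p & forall i, i != j -> side i (l j u) p].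
Proof.
move=> /side_l nq /side_l nq' nqq hu.
have := @pseudoline_closure _ _ _ _ u (arr_pseudoline j) nq nq' nqq.
move=> /(_ _ (near_sides hu))[p [qp hp]]; exists p; split => // i.
by have [->|/hp] := eqVneq i j; [exact: side_r qp|exact: side_r].
Qed.

Lemma far_time j : exists T, forall i, i != j ->
  [/\ forall u, T <= `|u| -> ~ range (l i) (l j u) & forall u v, u <= - T -> T <= v -> ~ side i (l j u) (l j v)].
Proof.
have [t ht] : exists t : 'I_n -> R, forall i, i != j -> 
    (forall u, range (l i) (l j u) -> u = t i) /\
    (forall u v, u < t i -> t i < v -> ~ side i (l j u) (l j v)).
  suff h i : exists t, i != j -> (forall u, range (l i) (l j u) -> u = t) /\
    (forall u v, u < t -> t < v -> ~ side i (l j u) (l j v)).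
    by exists (fun i => sval (cid (h i))) => i; exact: (svalP (cid (h i))).
  have [_|ij] := eqVneq i j; first by exists 0.
  by have [t [_ t1 _ _ t2]] := crossing ij; exists t => _; split.
pose T := \sum_i `|t i| + 1.
have tT i : `|t i| < T.
  rewrite /T (bigD1 i) //= ltr_pwDr // lerDl.
  by apply: sumr_ge0 => k _; exact: normr_ge0.
exists T => i ij; have [t1 t2] := ht i ij; split.
- by move=> u Tu /t1 ut; have := tT i; rewrite -ut ltNge Tu.
- by move=> u v uT Tv; have := tT i; rewrite ltr_norml => /andP[h1 h2]; apply: t2; lra.
Qed.

Section TwoCurves.
Hypothesis n2 : (1 < n)%N.

Lemma other_curve j : exists i, i != j.
Proof.
case: n j n2 => [|[|m]] // j _.
by have [->|h] := eqVneq j ord0; [exists ord_max|exists ord0; rewrite eq_sym].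
Qed.

(** The two sides are witnessed by another curve, whose ends [l j] separates. *)
Lemma other_side j p : exists2 q, side j q q & ~ side j p q.
Proof.
have [i ij] := other_curve j; rewrite eq_sym in ij.
have [t [_ _ h1 h2 h3]] := crossing ij.
have tm : t - 1 < t by rewrite ltrBlDr ltrDl.
have tp : t < t + 1 by rewrite ltrDl.
have [hp|hp] := pselect (side j p (l i (t - 1))); last by exists (l i (t - 1)) => //; exact: h1.
exists (l i (t + 1)); first exact: h2.
move=> hp'; apply: (h3 _ _ tm tp).
exact: connected_component_trans (connected_component_sym hp) hp'.
Qed.

Lemma separates_regions i p q : compl p -> compl q ->
  separates (l i) (connected_component compl p) (connected_component compl q) <-> ~ side i p q.
Proof.
move=> cp cq; split; first by apply; exact: connected_component_refl.
move=> npq p' q' pp' qq' pq'; apply: npq.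
apply: connected_component_trans (region_side i pp') _.
apply: connected_component_trans pq' _; exact/connected_component_sym/region_side.
Qed.

Lemma region_adjP p q : compl p -> compl q ->
  region_adj l (connected_component compl p) (connected_component compl q) <->
  exists2 i, ~ side i p q & forall k, k != i -> side k p q.
Proof.
move=> cp cq; split.
- move=> [i [/(separates_regions i cp cq) ni u]]; exists i => // k ki.
  by apply: contrapT => /(separates_regions k cp cq) /u ik; rewrite ik eqxx in ki.
- move=> [i ni hk]; exists i; split; first exact/separates_regions.
  move=> k /(separates_regions k cp cq) nk; apply/eqP/negPn/negP => ik.
  by apply/nk/hk; rewrite eq_sym.
Qed.

End TwoCurves.
End Arrangement.

(** * Sign vectors of an arrangement *)

Section Signs.
Variables (R : realType) (n : nat) (l : 'I_n -> R -> R * R).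
Hypothesis arr : pseudoline_arrangement l.
Hypothesis n2 : (1 < n)%N.
Implicit Types (p q z w : R * R) (i j k : 'I_n) (s : seq 'I_n) (u v t : R).

Local Notation side i p q := (connected_component (~` range (l i)) p q).
Local Notation compl := (arrangement_complement l).

Hypothesis no_triangle : forall p q r, compl p -> compl q -> compl r ->
  region_adj l (connected_component compl p) (connected_component compl q) ->
  region_adj l (connected_component compl q) (connected_component compl r) ->
  region_adj l (connected_component compl p) (connected_component compl r) -> False.

(* Every side of [l j] accumulates at every point of [l j], so a third side would give three
   pairwise adjacent regions. *)
Lemma two_sides j p q r : side j p p -> side j q q -> side j r r ->
  ~ side j p q -> ~ side j q r -> side j p r.
Proof.
move=> pp qq rr pq qr; apply: contrapT => pr.
have [T hT] := far_time arr j.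
have off i : i != j -> ~ range (l i) (l j T).
  by move=> ij; have [+ _] := hT i ij; apply; exact: ler_norm.
have qp : ~ side j q p by move=> /connected_component_sym.
have rp : ~ side j r p by move=> /connected_component_sym.
have [p' [cp pp' hp]] := touching_region arr pp qq pq off.
have [q' [cq qq' hq]] := touching_region arr qq pp qp off.
have [r' [cr rr' hr]] := touching_region arr rr pp rp off.
have adj x y x' y' : compl x' -> compl y' -> side j x x' -> side j y y' -> ~ side j x y ->
    (forall i, i != j -> side i (l j T) x') -> (forall i, i != j -> side i (l j T) y') ->
    region_adj l (connected_component compl x') (connected_component compl y').
  move=> cx cy xx yy xy hx hy; apply/region_adjP => //; exists j.
    move=> xy'; apply: xy; apply: connected_component_trans xx _.
    by apply: connected_component_trans xy' _; exact: connected_component_sym.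
  by move=> k kj; apply: connected_component_trans (connected_component_sym (hx k kj)) (hy k kj).
exact: (no_triangle cp cq cr (adj p q _ _ _ _ _ _ _ _ _) (adj q r _ _ _ _ _ _ _ _ _) (adj p r _ _ _ _ _ _ _ _ _)).
Qed.

Lemma base_ex i : exists q, side i q q.
Proof. by have [q qq _] := other_side arr n2 i (0, 0); exists q. Qed.

Definition base i : R * R := sval (cid (base_ex i)).

Lemma base_side i : side i (base i) (base i). Proof. exact: (svalP (cid (base_ex i))). Qed.

Definition signs p : {set 'I_n} := finset (fun i => `[< side i (base i) p >]).

Lemma in_signs p i : (i \in signs p) = `[< side i (base i) p >]. Proof. by rewrite inE. Qed.

Lemma same_sign p q i : side i p p -> side i q q -> (i \in signs p) = (i \in signs q) <-> side i p q.
Proof.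
move=> pp qq; rewrite !in_signs; split => [h|pq]; last first.
  apply/asboolP/asboolP => h; apply: connected_component_trans h _ => //.
  exact: connected_component_sym.
have [bp|nbp] := pselect (side i (base i) p).
  move: h; rewrite (asboolT bp) => /esym/asboolP bq.
  exact: connected_component_trans (connected_component_sym bp) bq.
move: h; rewrite (asboolF nbp) => /esym/asboolPn nbq.
by apply: (two_sides pp (base_side i) qq) => // /connected_component_sym.
Qed.

Lemma compl_side p i : compl p -> side i p p.
Proof. by move=> cp; apply: connected_component_refl; exact: cp. Qed.

Lemma signs_region p q : compl p -> compl q -> signs p = signs q -> connected_component compl p q.
Proof.
move=> cp cq pq; apply: sides_region => // i.
by apply/(same_sign (compl_side i cp) (compl_side i cq)); rewrite pq.
Qed.

Lemma region_signs p q : connected_component compl p q -> signs p = signs q.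
Proof.
move=> pq; apply/setP => i; have s := region_side i pq.
by apply/same_sign => //; apply: connected_component_refl; [exact: side_l s|exact: side_r s].
Qed.

Lemma flip_signs p q j : compl p -> compl q -> ~ side j p q -> (forall i, i != j -> side i p q) ->
  signs q = flip (signs p) j.
Proof.
move=> cp cq nj h; apply/setP => i; rewrite in_flip.
have [->|ij] := eqVneq i j.
  apply/esym; rewrite addbT; case: (boolP (j \in signs q)) => jq; apply/negP.
    by move=> jp; apply/nj/(same_sign (compl_side j cp) (compl_side j cq)); rewrite jp.
  move/negP => jp; apply/nj/(same_sign (compl_side j cp) (compl_side j cq)).
  by rewrite (negbTE jq) (negbTE jp).
rewrite addbF; apply/esym/same_sign; [exact: compl_side|exact: compl_side|exact: h].
Qed.

Lemma signs_adj p q : compl p -> compl q ->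
  cube_adj (signs p) (signs q) <-> 
  region_adj l (connected_component compl p) (connected_component compl q).
Proof.
move=> cp cq; rewrite region_adjP //; split.
  move=> /cube_adjP[j hj]; exists j.
    move=> /(same_sign (compl_side j cp) (compl_side j cq)); rewrite hj in_flip eqxx.
    by case: (_ \in _).
  move=> k kj; apply/(same_sign (compl_side k cp) (compl_side k cq)).
  by rewrite hj in_flip (negbTE kj) addbF.
by move=> [j nj hj]; apply/cube_adjP; exists j; exact: flip_signs.
Qed.

Definition sign_family : {set {set 'I_n}} := finset (fun A => `[< exists2 p, compl p & signs p = A >]).

Lemma in_sign_family A : reflect (exists2 p, compl p & signs p = A) (A \in sign_family).
Proof. by rewrite inE; exact: asboolP. Qed.

(* The curves met by the boundary of the region of [p] cannot all have [p] and [q] on one side: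
   otherwise [q] would lie in the cell cut out by these curves, which the region of [p] exhausts up to
   the crossing points. *)
Lemma sign_family_steppable : steppable sign_family.
Proof.
move=> A B /in_sign_family[p cp <-] /in_sign_family[q cq <-] pq.
apply: contrapT => hstep.
pose W := [seq j <- enum 'I_n | flip (signs p) j \in sign_family].
have pqW : connected_component (compl_seq l W) p q.
  apply: sides_component => // j; rewrite mem_filter => /andP[jW _].
  apply/(same_sign (compl_side j cp) (compl_side j cq)); apply: contrapT => /eqP jpq; apply: hstep.
  by exists j => //; rewrite in_sdiff -negb_eqb; exact: jpq.
have [t ht] : exists t : 'I_n -> 'I_n -> R, forall i j, i != j -> 
    forall u, range (l i) (l j u) -> u = t i j.
  suff h i j : exists t, i != j -> forall u, range (l i) (l j u) -> u = t.
    by exists (fun i j => sval (cid (h i j))) => i j; exact: (svalP (cid (h i j))).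
  have [_|ij] := eqVneq i j; first by exists 0.
  by have [t [_ t1 _ _ t2]] := crossing arr ij; exists t.
pose F := [seq l j (t i j) | i <- enum 'I_n, j <- enum 'I_n].
pose Q := connected_component (compl_seq l W) p.
have oQ : open Q by exact/component_open/open_compl_seq.
have [oQF cQF] := connected_punctures F oQ (@component_connected _ _ _).
have inF z i j : i != j -> range (l i) z -> range (l j) z -> z \in F.
  move=> ij iz [u _ uz]; apply/allpairsP; exists (i, j); rewrite !mem_enum /=; split => //.
  by rewrite -uz; congr (l j _); apply: ht => //; rewrite uz.
have QF z : Q z -> compl z -> (Q `&` [set x | x \notin F]) z.
  move=> Qz cz; split => //=; apply/negP => /allpairsP[[i j] /= [_ _ zE]].
  by apply: (cz j); rewrite zE; exists (t i j).
have Qp : Q p by apply: connected_component_refl => i _; exact: cp.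
pose P := connected_component compl p.
suff : P q by move/region_signs => /eqP; exact/negP.
apply: (@connected_clopen _ _ P p q cQF) => //; [exact/component_open/open_compl| |exact: QF|exact: QF|exact: connected_component_refl].
move=> z [clz [Qz zF]].
have [cz|ncz] := pselect (compl z); first by apply: closure_component => //; exact: open_compl.
(* Away from the crossing points, a boundary point of the region lies on a single curve [l j]. The
   region touching it from beyond shows that [j] belongs to [W], although the cell [Q] avoids all
   curves of [W]. *)
have [j jz] : exists j, range (l j) z by apply: contrapT => h; apply: ncz => j jz; apply: h; exists j.
have iz i : i != j -> ~ range (l i) z by move=> ij iz; move/negP: zF; apply; exact: inF ij iz jz.
exfalso.
have jW : j \notin W by apply/negP => jW; by have := connected_component_sub Qz; move=> /(_ j jW).
have [w [Pw zw]] := clz _ (near_sides arr iz).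
have [p' p'p' pp'] := other_side arr n2 j p.
have p'p : ~ side j p' p by move=> /connected_component_sym.
have [u _ uz] := jz; subst z.
have [q' [cq' pq' hq']] := touching_region arr p'p' (compl_side j cp) p'p iz.
move/negP: jW; apply; rewrite mem_filter mem_enum andbT; apply/in_sign_family; exists q' => //.
apply: flip_signs => // [pq2|i ij].
  by apply: pp'; apply: connected_component_trans pq2 _; exact: connected_component_sym.
apply: connected_component_trans (region_side i Pw) _.
apply: connected_component_trans (connected_component_sym (zw i ij)) _; exact: hq'.
Qed.

(* [l j] changes sides of [l i] and of [l k] once each, so its points show at most three of the four
   sign patterns on [{i, k}]. *)
Lemma sign_family_shatters A : shatters sign_family A -> (#|A| <= 2)%N.
Proof.
move=> sA; rewrite leqNgt; apply/negP => /card_gt2P[i [j [k [[iA jA kA] [ij jk ki]]]]].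
(* Two points with this pattern on [i] and [k] but on different sides of [l j] are joined within
   their cell for [l i] and [l k]; the connecting set has to meet [l j]. *)
have pattern (a b : bool) : exists u, [/\ (i \in signs (l j u)) = a, (k \in signs (l j u)) = b,
    ~ range (l i) (l j u) & ~ range (l k) (l j u)].
  pose X c : {set 'I_n} := finset (fun x => (x == i) && a || (x == k) && b || (x == j) && c).
  have XA c : X c \subset A.
    by apply/fintype.subsetP => x; rewrite inE => /orP[/orP[]|] /andP[/eqP-> _].
  have pt c : exists p, [/\ compl p, (i \in signs p) = a, (j \in signs p) = c & (k \in signs p) = b].
    have [B /in_sign_family[p cp <-] hB] := sA _ (XA c).
    have mem x : x \in A -> (x \in signs p) = (x \in X c) by move=> xA; rewrite -hB finset.in_setI xA.
    exists p; split => //; rewrite mem // inE eqxx /=.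
    - by rewrite (negbTE ij) [i == k]eq_sym (negbTE ki) /= !orbF.
    - by rewrite [j == i]eq_sym (negbTE ij) (negbTE jk).
    - by rewrite (negbTE ki) [k == j]eq_sym (negbTE jk) /= orbF.
  have [p [cp pi pj pk]] := pt true; have [q [cq qi qj qk]] := pt false.
  have pq : connected_component (compl_seq l [:: i; k]) p q.
    apply: sides_component => // x; rewrite !inE => /orP[] /eqP ->.
      by apply/(same_sign (compl_side _ cp) (compl_side _ cq)); rewrite pi qi.
    by apply/(same_sign (compl_side _ cp) (compl_side _ cq)); rewrite pk qk.
  have [C [Cp CA cC] Cq] := pq.
  have [u Cu] : exists u, C (l j u).
    apply: contrapT => h.
    have : side j p q by exists C => //; split => // z Cz [u _ uz]; apply: h; exists u; rewrite uz.
    by move=> /(same_sign (compl_side _ cp) (compl_side _ cq)); rewrite pj qj.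
  have ci x : x \in [:: i; k] -> side x p (l j u).
    by move=> xs; exists C => //; split => // z /CA; apply.
  exists u; have hi := ci i (mem_head _ _); have hk : side k p (l j u) by apply: ci; rewrite !inE eqxx orbT.
  split; [rewrite -pi|rewrite -pk|exact: side_r hi|exact: side_r hk].
    by apply/esym/same_sign => //; [exact: compl_side|exact/connected_component_refl/(side_r hi)].
  by apply/esym/same_sign => //; [exact: compl_side|exact/connected_component_refl/(side_r hk)].
have mono x : x != j -> exists t e, forall u, ~ range (l x) (l j u) ->
    if (x \in signs (l j u)) == e then u < t else t < u.
  move=> xj; have [t [tx _ h1 h2 h3]] := crossing arr xj.
  have off u : ~ range (l x) (l j u) -> u != t by move=> nx; apply: contra_not_neq nx => ->.
  exists t, (x \in signs (l j (t - 1))) => u nu.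
  have tm : t - 1 < t by rewrite ltrBlDr ltrDl.
  have tp : t < t + 1 by rewrite ltrDl.
  have st : side x (l j (t - 1)) (l j (t - 1)) by exact: h1.
  have su : side x (l j u) (l j u) by exact: connected_component_refl.
  case: eqP => [/(same_sign su st) uv|uv].
    rewrite ltNge; apply/negP; rewrite le_eqVlt eq_sym (negbTE (off u nu)) /= => tu.
    by apply: (h3 _ _ tm tu); exact: connected_component_sym.
  rewrite ltNge; apply/negP; rewrite le_eqVlt (negbTE (off u nu)) /= => ut.
  by apply: uv; apply/same_sign => //; exact: h1.
have [ti [ei hi]] := mono i ij.
have kj : k != j by rewrite eq_sym.
have [tk [ek hk]] := mono k kj.
(* [u1] comes before the crossing with [l i] and after the one with [l k]; [u2] requires the reverse
   order of these crossings. *)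
have [u1 [a1 b1 n1 m1]] := pattern ei (~~ ek).
have [u2 [a2 b2 n2' m2]] := pattern (~~ ei) ek.
have nb (b : bool) : (~~ b == b) = false by case: b.
have := hi u1 n1; have := hk u1 m1; have := hi u2 n2'; have := hk u2 m2.
by rewrite a1 b1 a2 b2 !eqxx !nb; lra.
Qed.

(** At the parameters [T] and [- T], beyond all crossings, [l j] is touched from two sides, which
    gives an edge of direction [j] at each end. Which endpoint of the second edge is complementary
    to [signs p1] depends on its [j]-th sign, hence the case distinctions. *)
Lemma sign_family_antipodal : antipodal_edges sign_family.
Proof.
move=> j; have [T0 hT0] := far_time arr j; pose T := `|T0|.
have T0T : T0 <= T by exact: ler_norm.
have offT i : i != j -> ~ range (l i) (l j T).
  by move=> /hT0[+ _]; apply; rewrite (le_trans T0T) // ler_norm.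
have offN i : i != j -> ~ range (l i) (l j (- T)).
  by move=> /hT0[+ _]; apply; rewrite normrN (le_trans T0T) // ler_norm.
have [p pp _] := other_side arr n2 j (0, 0); have [q qq pq] := other_side arr n2 j p.
have qp : ~ side j q p by move=> /connected_component_sym.
have near t : (forall i, i != j -> ~ range (l i) (l j t)) -> exists p1 q1, [/\ compl p1, compl q1,
    signs q1 = flip (signs p1) j & forall i, i != j -> (i \in signs p1) = (i \in signs (l j t))].
  move=> off; have [p1 [cp1 pp1 hp1]] := touching_region arr pp qq pq off.
  have [q1 [cq1 qq1 hq1]] := touching_region arr qq pp qp off.
  exists p1, q1; split => //.
    apply: flip_signs => // [pq1|i ij].
      apply: pq; apply: connected_component_trans pp1 _; apply: connected_component_trans pq1 _.
      exact: connected_component_sym.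
    exact: connected_component_trans (connected_component_sym (hp1 i ij)) (hq1 i ij).
  move=> i ij; apply/esym/same_sign; [exact/connected_component_refl/off|exact: compl_side|exact: hp1].
have [p1 [q1 [cp1 cq1 qf1 h1]]] := near T offT.
have [p2 [q2 [cp2 cq2 qf2 h2]]] := near (- T) offN.
have opp i : i != j -> (i \in signs p2) = (i \notin signs p1).
  move=> ij; rewrite h1 // h2 //.
  have : (i \in signs (l j (- T))) <> (i \in signs (l j T)).
    move=> /same_sign h; have [_ /(_ (- T) T)] := hT0 i ij; apply => //; first by rewrite lerN2.
    by apply: h; apply: connected_component_refl; [exact: offN|exact: offT].
  by do 2 case: (_ \in _).
exists (signs p1).
have S1 : signs p1 \in sign_family by apply/in_sign_family; exists p1.
have S2 : flip (signs p1) j \in sign_family by apply/in_sign_family; exists q1.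
have S3 : signs p2 \in sign_family by apply/in_sign_family; exists p2.
have S4 : flip (signs p2) j \in sign_family by apply/in_sign_family; exists q2.
have fC : ~: flip (signs p1) j = flip (~: signs p1) j.
  by apply/setP => i; rewrite in_flip finset.in_setC in_flip finset.in_setC addNb.
rewrite fC; split => //.
- have [e|e] := boolP ((j \in signs p2) == (j \notin signs p1)).
    have -> // : ~: signs p1 = signs p2.
    apply/setP => i; rewrite finset.in_setC; have [->|/opp->//] := eqVneq i j; exact/esym/eqP.
  have -> // : ~: signs p1 = flip (signs p2) j.
  apply/setP => i; rewrite finset.in_setC in_flip; have [->|/opp->] := eqVneq i j; last by rewrite addbF.
  by move: e; do 2 case: (_ \in _).
- have [e|e] := boolP ((j \in signs p2) == (j \notin signs p1)).
    have -> // : flip (~: signs p1) j = flip (signs p2) j.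
    apply/setP => i; rewrite !in_flip finset.in_setC; have [->|/opp->//] := eqVneq i j.
    by rewrite (eqP e).
  have -> // : flip (~: signs p1) j = signs p2.
  apply/setP => i; rewrite !in_flip finset.in_setC; have [->|/opp->] := eqVneq i j; last by rewrite addbF.
  by move: e; do 2 case: (_ \in _).
Qed.

End Signs.

Lemma disk_sign_family (R : realType) (U : finType) (D : {set {set U}}) (n : nat) (l : 'I_n -> R -> R * R) :
  (1 < n)%N -> pseudoline_arrangement l -> is_region_graph D l ->
  exists S : {set {set 'I_n}}, [/\ graph_iso D S, steppable S, antipodal_edges S &
    forall A, shatters S A -> (#|A| <= 2)%N].
Proof.
move=> n2 arr [phi [[phi_fun phi_inj phi_surj] phi_adj]].
pose compl := arrangement_complement l.
have [pt hpt] : exists pt : {set U} -> R * R, forall A, A \in D ->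
    compl (pt A) /\ connected_component compl (pt A) = phi A.
  suff h A : exists p, A \in D -> compl p /\ connected_component compl p = phi A.
    by exists (fun A => sval (cid (h A))) => A; exact: (svalP (cid (h A))).
  have [AD|_] := boolP (A \in D); last by exists (0, 0).
  by have [p cp hp] := phi_fun A AD; exists p.
have pt_surj p : compl p -> exists2 A, A \in D & connected_component compl p = phi A.
  move=> cp; have [|A AD hA] := phi_surj (connected_component compl p); first by exists p.
  by exists A.
have tri p q r : compl p -> compl q -> compl r ->
  region_adj l (connected_component compl p) (connected_component compl q) ->
  region_adj l (connected_component compl q) (connected_component compl r) ->
  region_adj l (connected_component compl p) (connected_component compl r) -> False.
  move=> /pt_surj[A AD ->] /pt_surj[B BD ->] /pt_surj[C CD ->].
  move=> /phi_adj-/(_ AD BD) AB /phi_adj-/(_ BD CD) BC /phi_adj-/(_ AD CD) AC.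
  exact: no_cube_triangle AB BC AC.
exists (sign_family arr n2); split.
- exists (fun A => signs arr n2 (pt A)); split.
  + move=> A B AD BD AB; apply: phi_inj; rewrite ?inE //.
    have [cA <-] := hpt A AD; have [cB <-] := hpt B BD.
    apply: same_connected_component; exact: (signs_region tri).
  + apply/setP => X; apply/imsetP/(in_sign_family arr n2) => [[A AD ->]|[p cp <-]].
      by exists (pt A) => //; case: (hpt A AD).
    have [A AD pA] := pt_surj p cp; exists A => //.
    apply: (region_signs arr n2 tri); have [cA e] := hpt A AD.
    by rewrite -/compl pA -e; exact: connected_component_refl.
  + move=> A B AD BD; have [cA eA] := hpt A AD; have [cB eB] := hpt B BD.
    by apply/idP/idP => [/(signs_adj arr n2 tri cA cB)|AB]; [|apply/(signs_adj arr n2 tri cA cB)];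
      rewrite -/compl eA eB; [move/phi_adj; apply|apply/phi_adj].
- exact: (@sign_family_steppable _ _ _ arr n2 tri).
- exact: (@sign_family_antipodal _ _ _ arr n2 tri).
- exact: (@sign_family_shatters _ _ _ arr n2 tri).
Qed.

(** * Arrangements of graphs *)

Section Between.
Variable R : realType.

Lemma seq_max (s : seq R) : s != [::] -> exists2 m, m \in s & {in s, forall x, x <= m}.
Proof.
elim: s => // a s IH _; have [->|s0] := eqVneq s [::].
  by exists a; rewrite ?mem_head // => x; rewrite inE => /eqP ->.
have [m ms hm] := IH s0; have [am|ma] := leP a m.
- exists m; first by rewrite in_cons ms orbT.
  by move=> x; rewrite in_cons => /predU1P[->//|]; exact: hm.
- exists a; first exact: mem_head.
  by move=> x; rewrite in_cons => /predU1P[->//|/hm/le_trans]; apply; exact: ltW.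
Qed.

Lemma seq_between (s t : seq R) : {in s & t, forall a b, a < b} ->
  exists y, {in s, forall a, a < y} /\ {in t, forall b, y < b}.
Proof.
move=> st.
have low : exists m, {in s, forall a, a <= m} /\ {in t, forall b, m < b}.
  have [s0|/seq_max[m ms hm]] := eqVneq s [::]; last by exists m; split => // b; exact: st.
  have [t0|] := eqVneq [seq - x | x <- t] [::].
    exists 0; rewrite s0; split => // b; move: t0; case: (t) => //.
  move/seq_max => [m _ hm]; exists (- m - 1); rewrite s0; split => // b bt.
  by have := hm (- b) (map_f _ bt); lra.
have [m [sm mt]] := low.
have [t0|] := eqVneq [seq - x | x <- t] [::].
  exists (m + 1); split => [a /sm|b]; first by lra.
  by move: t0; case: (t).
move/seq_max => [_ /mapP[b bt ->] hm]; have mb := mt b bt.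
exists ((m + b) / 2); split => [a /sm|b' b't]; first by lra.
by have := hm (- b') (map_f _ b't); lra.
Qed.

Lemma fin_between (I : finType) (P Q : pred I) (f : I -> R) :
  (forall i j, P i -> Q j -> f i < f j) ->
  exists y, (forall i, P i -> f i < y) /\ (forall j, Q j -> y < f j).
Proof.
move=> h; have [|y [h1 h2]] := @seq_between [seq f i | i <- enum P] [seq f j | j <- enum Q].
  by move=> _ _ /mapP[i + ->] /mapP[j + ->]; rewrite !mem_enum; exact: h.
by exists y; split => i Pi; [apply: h1|apply: h2]; rewrite map_f // mem_enum.
Qed.

End Between.

Section Monotone.
Variables (R : realType) (n : nat) (f : 'I_n -> R -> R).
Hypothesis cf : forall i, continuous (f i).

Definition crosses_up i j := exists tau, [/\ f i tau = f j tau,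
  forall x, x < tau -> f i x < f j x & forall x, tau < x -> f j x < f i x].

Hypothesis cross : forall i j, i != j -> crosses_up i j \/ crosses_up j i.

Definition graph_curve i (t : R) : R * R := (t, f i t).
Definition lower_set (A : {set 'I_n}) x := forall i j, i \in A -> j \notin A -> f i x < f j x.
Definition cell (P Q : pred 'I_n) : set (R * R) :=
  [set z | (forall i, P i -> f i z.1 < z.2) /\ (forall i, Q i -> z.2 < f i z.1)].

Lemma cell_open P Q : open (cell P Q).
Proof.
rewrite openE => z [hP hQ].
have cz i : f i w.1 @[w --> z] --> f i z.1.
  by apply: continuous_cvg; [exact: cf|apply: cvg_proj1; exact: cvg_id].
have c2 : w.2 @[w --> z] --> z.2 by apply: cvg_proj2; exact: cvg_id.
have gt0 (h : R * R -> R) (y : R) : h w @[w --> z] --> y -> 0 < y -> \forall w \near z, 0 < h w.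
  by move=> hy y0; exact: (cvgr_gt _ hy).
have nP : \forall w \near z, forall i, P i -> f i w.1 < w.2.
  apply: (@filter_forall _ _ (fun i w => P i -> f i w.1 < w.2) (nbhs z) _) => i.
  have [/hP Pi|nPi] := boolP (P i); last by near=> w.
  have hd : (w.2 - f i w.1) @[w --> z] --> z.2 - f i z.1 by apply: cvgB.
  have := gt0 _ _ hd; rewrite subr_gt0 => /(_ Pi).
  by apply: (@filterS _ (nbhs z)) => w; rewrite /= subr_gt0.
have nQ : \forall w \near z, forall i, Q i -> w.2 < f i w.1.
  apply: (@filter_forall _ _ (fun i w => Q i -> w.2 < f i w.1) (nbhs z) _) => i.
  have [/hQ Qi|nQi] := boolP (Q i); last by near=> w.
  have hd : (f i w.1 - w.2) @[w --> z] --> f i z.1 - z.2 by apply: cvgB.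
  have := gt0 _ _ hd; rewrite subr_gt0 => /(_ Qi).
  by apply: (@filterS _ (nbhs z)) => w; rewrite /= subr_gt0.
by apply: (@filterS2 _ (nbhs z) _ _ _ _ _ nP nQ) => w.
Unshelve. all: by end_near. Qed.

Lemma lt_between i j a b x : f i a < f j a -> f i b < f j b -> a <= x <= b -> f i x < f j x.
Proof.
move=> ha hb /andP[ax xb]; have [e|ij] := eqVneq i j; first by move: ha; rewrite e ltxx.
have [[t [et lt gt]]|[t [et lt gt]]] := cross ij.
- have bt : b < t.
    by rewrite ltNge; apply/negP; rewrite le_eqVlt => /predU1P[tb|/gt]; [move: hb; rewrite -tb et ltxx|move/(lt_trans hb); rewrite ltxx].
  exact/lt/(le_lt_trans xb).
- have ta : t < a.
    by rewrite ltNge; apply/negP; rewrite le_eqVlt => /predU1P[tb|/lt]; [move: ha; rewrite tb et ltxx|move/(lt_trans ha); rewrite ltxx].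
  exact/gt/(lt_le_trans ta).
Qed.

(** Vertical fibres of a cell are intervals, and between the abscissae of two points of the cell
    none is empty, because inequalities valid at both ends persist in between. So one can pass from
    fibre to fibre. *)
Lemma cell_component P Q p q : cell P Q p -> cell P Q q -> connected_component (cell P Q) p q.
Proof.
wlog pq : p q / p.1 <= q.1.
  by move=> h hp hq; have [/h|/ltW/h] := leP p.1 q.1; [apply|move=> /(_ hq hp)/connected_component_sym].
move=> hp hq; set W := cell P Q in hp hq *.
have fiber x y y' : W (x, y) -> W (x, y') -> connected_component W (x, y) (x, y').
  move=> [h1 h2] [h3 h4]; apply: vsegment_component => t ht; split=> i Pi /=.
    by have := h1 i Pi; have := h3 i Pi => /=; case: ht => /andP[]; lra.
  by have := h2 i Pi; have := h4 i Pi => /=; case: ht => /andP[]; lra.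
pose T x := exists2 y, W (x, y) & connected_component W p (x, y).
suff : T q.1.
  move=> [y Wy py]; apply: connected_component_trans py _.
  by rewrite [X in connected_component _ _ X]surjective_pairing; apply: fiber; rewrite -?surjective_pairing.
have := @connected_ind _ `[p.1, q.1]%classic T (@segment_connected _ _ _) _ p.1 q.1.
apply; rewrite /= ?in_itv /= ?lexx ?pq //; last first.
  by exists p.2; rewrite -surjective_pairing //; exact: connected_component_refl.
move=> x; rewrite in_itv /= => xpq.
have [y [yP yQ]] : exists y, (forall i, P i -> f i x < y) /\ (forall i, Q i -> y < f i x).
  apply: (fin_between (f := fun i => f i x)) => i j Pi Qj.
  by apply: (@lt_between _ _ p.1 q.1) => //; [exact: lt_trans (hp.1 i Pi) (hp.2 j Qj)|exact: lt_trans (hq.1 i Pi) (hq.2 j Qj)].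
have Wxy : W (x, y) by [].
have /nbhs_ballP[e /= e0 he] := open_nbhs_nbhs (conj (@cell_open P Q) Wxy).
apply/nbhs_ballP; exists e => // x' xx' _.
have bx' : ball (x, y) e (x', y).
  by apply/in_ballE; rewrite /= subrr normr0; split => //; move: xx'; rewrite -ball_normE.
have Wx' : W (x', y) by exact: he.
have xx'c : connected_component W (x, y) (x', y).
  have [C [cC C1 C2 hC]] := segment_ball (x, y) (x', y).
  exists C => //; split => // z /hC hz; apply: he.
  by move: bx'; rewrite -ball_normE /=; exact: le_lt_trans.
split => -[y' Wy' py']; exists y => //; apply: connected_component_trans py' _.
  by apply: connected_component_trans (fiber _ _ _ Wy' Wxy) xx'c.
apply: connected_component_trans (fiber _ _ _ Wy' Wx') _; exact: connected_component_sym.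
Qed.

Lemma range_graph i z : range (graph_curve i) z <-> z.2 = f i z.1.
Proof.
split; first by move=> [t _ <-].
by move=> h; exists z.1 => //; rewrite /graph_curve -h -surjective_pairing.
Qed.

Lemma off_graph i z : ~ range (graph_curve i) z <-> f i z.1 < z.2 \/ z.2 < f i z.1.
Proof.
rewrite range_graph; split => [/eqP|].
  by rewrite neq_lt => /orP[]; [right|left].
by move=> [] h e; move: h; rewrite e ltxx.
Qed.

Lemma same_side i p q : ~ range (graph_curve i) p -> ~ range (graph_curve i) q ->
  connected_component (~` range (graph_curve i)) p q <-> (f i p.1 < p.2) = (f i q.1 < q.2).
Proof.
move=> np nq; split.
- move=> [C [Cp CA cC] Cq].
  pose h (z : R * R) := z.2 - f i z.1.
  have ch : continuous h.
    move=> z; apply: cvgB; first by apply: cvg_proj2; exact: cvg_id.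
    by apply: continuous_cvg; [exact: cf|apply: cvg_proj1; exact: cvg_id].
  have : is_interval (h @` C).
    by apply/connected_intervalP; apply: connected_continuous_connected => //; exact: continuous_subspaceT.
  move=> intC.
  have nz u v : C u -> C v -> f i u.1 < u.2 -> v.2 < f i v.1 -> False.
    move=> Cu Cv hu hv; have [|||z Cz hz] := intC (h v) (h u) _ _ 0.
    - by exists v.
    - by exists u.
    - by rewrite /h; apply/andP; split; lra.
    - by apply: (CA z Cz); apply/range_graph/eqP; rewrite -subr_eq0; apply/eqP.
  have /off_graph[hp|hp] := np; have /off_graph[hq|hq] := nq.
  + by rewrite hp hq.
  + by case: (nz p q).
  + by case: (nz q p).
  + by rewrite (lt_gtF hp) (lt_gtF hq).
- have sub1 : cell (pred1 i) pred0 `<=` ~` range (graph_curve i).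
    by move=> z [/(_ i (eqxx i)) h _]; apply/off_graph; left.
  have sub2 : cell pred0 (pred1 i) `<=` ~` range (graph_curve i).
    by move=> z [_ /(_ i (eqxx i)) h]; apply/off_graph; right.
  have /off_graph[hp|hp] := np; have /off_graph[hq|hq] := nq.
  + move=> _; apply: component_subset sub1 _; apply: cell_component; split => // j /eqP -> //.
  + by rewrite hp (lt_gtF hq).
  + by rewrite hq (lt_gtF hp).
  + move=> _; apply: component_subset sub2 _; apply: cell_component; split => // j /eqP -> //.
Qed.

Lemma graph_arrangement : pseudoline_arrangement graph_curve.
Proof.
split=> [i|i j ij].
- split.
  + by move=> t; apply: cvg_pair2; [exact: cvg_id|exact: cf].
  + by move=> s t [].
  + apply/cvgryPge => A; near=> t; rewrite /graph_curve prod_normE /= le_max.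
    by apply/orP; left; rewrite (le_trans _ (ler_norm _)) //; near: t; exact: nbhs_pinfty_ge.
  + apply/cvgryPge => A; near=> t; rewrite /graph_curve prod_normE /= le_max.
    apply/orP; left; rewrite -normrN (le_trans _ (ler_norm _)) // lerNr; near: t.
    by exists (- A); split; [exact: num_real|move=> x /ltW].
- have [t [et sgn]] : exists t, f i t = f j t /\ forall u v, u < t -> t < v ->
      (f i u < f j u) <> (f i v < f j v) /\ f i u != f j u /\ f i v != f j v.
    have [[t [et lt gt]]|[t [et lt gt]]] := cross ij; exists t; split => // u v ut tv.
      by rewrite (lt u ut) (lt_gtF (gt v tv)) lt_eqF ?lt // gt_eqF ?gt.
    by rewrite (gt v tv) (lt_gtF (lt u ut)) gt_eqF ?lt // lt_eqF ?gt.
  exists t, t; split.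
  + by rewrite /graph_curve et.
  + move=> s' t' [-> e]; suff -> : t' = t by [].
    have t1 : t - 1 < t by rewrite ltrBlDr ltrDl.
    have t2 : t < t + 1 by rewrite ltrDl.
    by case: (ltgtP t' t) => // h; [have [_ []] := sgn _ _ h t2|have [_ [_]] := sgn _ _ t1 h]; rewrite e eqxx.
  + move=> _ _ [u ut <-] [v tv <-] /[dup] h [C [Cp CA cC] Cq].
    move/(same_side (CA _ Cp) (CA _ Cq)) : h => /=.
    by have [] := sgn u v ut tv.
Unshelve. all: by end_near. Qed.

Definition cell_of (A : {set 'I_n}) := cell (fun i => i \in A) (fun i => i \notin A).

Lemma cell_of_compl A z : cell_of A z -> arrangement_complement graph_curve z.
Proof.
move=> [h1 h2] i; apply/off_graph.
by have [/h1|/h2] := boolP (i \in A); [left|right].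
Qed.

Lemma cell_of_mem A z i : cell_of A z -> (i \in A) = (f i z.1 < z.2).
Proof.
by move=> [h1 h2]; have [/h1 ->//|/h2 h] := boolP (i \in A); rewrite (lt_gtF h).
Qed.

Lemma cell_ofE A p : cell_of A p ->
  connected_component (arrangement_complement graph_curve) p = cell_of A.
Proof.
move=> Ap; apply/seteqP; split => z.
- move=> pz; have nz := connected_component_sub pz.
  have mem i : (i \in A) = (f i z.1 < z.2).
    have np := cell_of_compl Ap; rewrite (cell_of_mem i Ap); apply/(same_side (np i) (nz i)).
    by apply: component_subset pz => w; exact.
  split=> i; rewrite mem // => h; by have /off_graph[e|//] := nz i; rewrite e in h.
- move=> Az; apply: component_subset (cell_component Ap Az) => w; exact: cell_of_compl.
Qed.

Lemma graph_region_graph (F : {set {set 'I_n}}) :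
  (forall A, A \in F <-> exists x, lower_set A x) -> is_region_graph F graph_curve.
Proof.
move=> hF.
have pt A : A \in F -> exists p, cell_of A p.
  move=> /hF[x lA]; have [y [y1 y2]] := fin_between lA.
  by exists (x, y).
exists cell_of; split; first split.
- by move=> A AF; have [p Ap] := pt A AF; exists p; [exact: cell_of_compl Ap|exact: cell_ofE].
- move=> A B; rewrite !inE => /pt[p Ap] /pt[q Bq] AB; apply/setP => i.
  by rewrite (cell_of_mem i Ap) -(@cell_of_mem B p i) // -AB.
- move=> _ [p cp <-]; pose A : {set 'I_n} := finset (fun i => f i p.1 < p.2).
  have Ap : cell_of A p.
    by split=> i; rewrite inE // => h; have /off_graph[e|//] := cp i; rewrite e in h.
  exists A; last exact/esym/cell_ofE.
  rewrite /= hF; exists p.1 => i j iA jA; exact: lt_trans (Ap.1 i iA) (Ap.2 j jA).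
- move=> A B /pt[p Ap] /pt[q Bq].
  have sep i : separates (graph_curve i) (cell_of A) (cell_of B) <-> i \in sdiff A B.
    have off C z : cell_of C z -> ~ range (graph_curve i) z by move=> /cell_of_compl; apply.
    rewrite in_sdiff; split.
      move=> /(_ p q Ap Bq) h; apply: contraT; rewrite -negb_eqb negbK => /eqP e; exfalso; apply: h.
      by apply/(same_side (off _ _ Ap) (off _ _ Bq)); rewrite -(cell_of_mem i Ap) -(cell_of_mem i Bq).
    move=> h p' q' Ap' Bq' /(same_side (off _ _ Ap') (off _ _ Bq')).
    rewrite -(cell_of_mem i Ap') -(cell_of_mem i Bq') => e.
    by move: h; rewrite e addbb.
  split.
  + move=> /cube_adjP[i Bi]; exists i; split.
      by apply/sep; rewrite in_sdiff Bi in_flip eqxx; case: (_ \in _).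
    move=> j /sep; rewrite in_sdiff Bi in_flip addbA addbb /= => /eqP; exact: esym.
  + move=> [i [/sep hi u]]; apply/cube_adjP; exists i; rewrite /flip.
    have -> : [set i]%SET = sdiff A B; last by rewrite sdiffK.
    apply/setP => j; rewrite inE; apply/eqP/idP => [->//|/sep/u->//].
Qed.

End Monotone.

(** * Piecewise linear curves of a sweep *)

Section Interp.
Variable R : realType.
Implicit Types (c d : nat -> R) (N t : nat) (x : R).

(** Piecewise linear interpolation at the integers, constant outside [[0, N]]; written as a sum of
    ramps, it is visibly continuous. *)
Definition interp N c x : R := c 0%N + \sum_(t < N) (c t.+1 - c t) * clamp01 (x - t%:R).

Lemma interpS N c x : interp N.+1 c x = interp N c x + (c N.+1 - c N) * clamp01 (x - N%:R).
Proof. by rewrite /interp big_ord_recr /= addrA. Qed.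

Lemma interp_ge N c x : N%:R <= x -> interp N c x = c N.
Proof.
elim: N => [|N IH] Nx; first by rewrite /interp big_ord0 addr0.
rewrite interpS IH; last by apply: le_trans Nx; rewrite ler_nat.
by rewrite clamp01_ge1; [rewrite mulr1 addrC subrK|move: Nx; rewrite -natr1; lra].
Qed.

Lemma interp_le0 N c x : x <= 0 -> interp N c x = c 0%N.
Proof.
move=> x0; elim: N => [|N IH]; first by rewrite /interp big_ord0 addr0.
by rewrite interpS IH clamp01_le0 ?mulr0 ?addr0 // subr_le0 (le_trans x0).
Qed.

Lemma interp_mid N c t x : (t < N)%N -> t%:R <= x <= t.+1%:R ->
  interp N c x = c t + (c t.+1 - c t) * (x - t%:R).
Proof.
move=> + /andP[tx xt]; elim: N => // N IH; rewrite ltnS leq_eqVlt => /predU1P[e|tN].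
  rewrite -e interpS interp_ge // clamp01_id // subr_ge0 tx /=.
  by move: xt; rewrite -natr1; lra.
rewrite interpS IH // clamp01_le0 ?mulr0 ?addr0 // subr_le0.
by apply: le_trans xt _; rewrite ler_nat.
Qed.

Lemma interp_nat N c t : (t <= N)%N -> interp N c t%:R = c t.
Proof.
rewrite leq_eqVlt => /predU1P[->|tN]; first exact: interp_ge.
by rewrite (interp_mid _ tN) ?subrr ?mulr0 ?addr0 // lexx ler_nat /=.
Qed.

Lemma interpB N c d x : interp N (fun t => c t - d t) x = interp N c x - interp N d x.
Proof.
elim: N => [|N IH]; first by rewrite /interp !big_ord0 !addr0.
by rewrite !interpS IH; ring.
Qed.

Lemma interp_continuous N c : continuous (interp N c).
Proof.
elim: N => [|N IH] x.
  rewrite (_ : interp 0 c = fun=> c 0%N); first exact: cvg_cst.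
  by apply/funext => y; rewrite /interp big_ord0 addr0.
rewrite (_ : interp N.+1 c = (fun y => interp N c y + (c N.+1 - c N) * clamp01 (y - N%:R))); last first.
  by apply/funext => y; rewrite interpS.
apply: cvgD; first exact: IH.
apply: cvgM; first exact: cvg_cst.
by apply: cvg_clamp01; apply: cvgB; [exact: cvg_id|exact: cvg_cst].
Qed.

Lemma nat_segment N x : 0 < x -> x < N%:R -> exists2 t, (t < N)%N & t%:R <= x <= t.+1%:R.
Proof.
move=> x0; elim: N => [|N IH] xN; first by have := lt_trans x0 xN; rewrite ltxx.
have [Nx|/IH[t tN h]] := leP N%:R x; first by exists N; rewrite // Nx ltW.
by exists t => //; exact: ltnW.
Qed.

Lemma lerp_gt0 (a b s : R) : 0 < a -> 0 < b -> 0 <= s <= 1 -> 0 < a + (b - a) * s.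
Proof.
move=> a0 b0 /andP[s0 s1]; have : 0 <= a * (1 - s) by apply: mulr_ge0; lra.
have : 0 <= b * s by apply: mulr_ge0; lra.
have [s2|s2] := leP s (1 / 2).
  have : a * (1 / 2) <= a * (1 - s) by apply: ler_wpM2l; lra.
  by lra.
have : b * (1 / 2) <= b * s by apply: ler_wpM2l; lra.
by lra.
Qed.

Lemma lerp_lt0 (a b s : R) : a < 0 -> b < 0 -> 0 <= s <= 1 -> a + (b - a) * s < 0.
Proof.
move=> a0 b0 hs; have := @lerp_gt0 (- a) (- b) s.
by rewrite !oppr_gt0 => /(_ a0 b0 hs); lra.
Qed.

Lemma lerp_opp (a s : R) : a + (- a - a) * s = a * (1 - 2 * s).
Proof. by ring. Qed.

Lemma mulr_gt0_cases (a b : R) : 0 < a * b -> (0 < a /\ 0 < b) \/ (a < 0 /\ b < 0).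
Proof.
have [a0|a0|->] := ltgtP a 0; last by rewrite mul0r ltxx.
- by rewrite nmulr_rgt0 //; right.
- by rewrite pmulr_rgt0 //; left.
Qed.

(* Between consecutive indices the sign either stays or is reversed by a negation, which the linear
   interpolation realizes at the midpoint. *)
Definition negating N d := forall t, (t < N)%N -> 0 < d t * d t.+1 \/ d t.+1 = - d t.

(** The nearest integer serves for all [d] at once, because every negation has its zero at the
    midpoint. *)
Lemma interp_index N x : exists2 t, (t <= N)%N & forall d, negating N d ->
  (0 < interp N d x -> 0 < d t) /\ (interp N d x < 0 -> d t < 0).
Proof.
have [x0|x0] := leP x 0; first by exists 0%N => // d _; rewrite interp_le0.
have [xN|xN] := leP N%:R x; first by exists N => // d _; rewrite interp_ge.
have [t tN tx] := nat_segment x0 xN; have /andP[h1 h2] := tx.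
rewrite -natr1 in h2.
have [half|half] := leP x (t%:R + 1 / 2).
- exists t; first exact: ltnW.
  move=> d /(_ t tN) neg; rewrite (interp_mid _ tN) //.
  have hs : 0 <= x - t%:R <= 1 by lra.
  case: neg => [/mulr_gt0_cases[[p q]|[p q]]|->].
  + by have := lerp_gt0 p q hs; split => // ?; lra.
  + by have := lerp_lt0 p q hs; split => // ?; lra.
  + rewrite lerp_opp; have [?|?|->] := ltgtP (d t) 0; split => // hx; nra.
- exists t.+1 => // d /(_ t tN) neg; rewrite (interp_mid _ tN) //.
  have hs : 0 <= x - t%:R <= 1 by lra.
  case: neg => [/mulr_gt0_cases[[p q]|[p q]]|->].
  + by have := lerp_gt0 p q hs; split => // ?; lra.
  + by have := lerp_lt0 p q hs; split => // ?; lra.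
  + rewrite lerp_opp; have [?|?|->] := ltgtP (d t) 0; split => // hx; nra.
Qed.

(** A negative sign never becomes positive again, so there is one change, between some [T] and
    [T.+1]. It must be a negation, hence the zero [T + 1 / 2]. *)
Lemma interp_cross N d : negating N d -> 0 < d 0%N -> d N < 0 ->
  (forall t, (t < N)%N -> d t < 0 -> d t.+1 < 0) -> (forall t, (t <= N)%N -> d t != 0) ->
  exists tau, [/\ 0 < tau < N%:R, interp N d tau = 0, forall x, x < tau -> 0 < interp N d x &
    forall x, tau < x -> interp N d x < 0].
Proof.
move=> neg d0 dN stay nz.
have [T [TN dT dT1]] : exists T, [/\ (T < N)%N, 0 < d T & d T.+1 < 0].
  elim: N {neg stay} dN nz => [|N IH] dN nz; first by have := lt_trans d0 dN; rewrite ltxx.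
  have := nz N (leqnSn N); rewrite neq_lt => /orP[h|h]; last by exists N.
  have [|T [TN h1 h2]] := IH h; first by move=> t tN; apply: nz; exact: leq_trans tN _.
  by exists T; split => //; exact: ltnW.
have eT : d T.+1 = - d T by case: (neg T TN) => // h; nra.
have posd t : (t <= T)%N -> 0 < d t.
  move=> tT; have tN : (t <= N)%N by apply: leq_trans tT (ltnW TN).
  have := nz t tN; rewrite neq_lt => /orP[h|//]; exfalso.
  have : forall s, (t + s <= T)%N -> d (t + s)%N < 0.
    elim=> [|s IH] ts; first by rewrite addn0.
    rewrite addnS; apply: stay; last by apply: IH; apply: ltnW; rewrite -addnS.
    by rewrite addnS in ts; apply: leq_trans ts (ltnW TN).
  by move=> /(_ (T - t)%N); rewrite subnKC // leqnn => /(_ isT); rewrite ltNge ltW.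
have negd t : (T < t)%N -> (t <= N)%N -> d t < 0.
  elim: t => // t IH; rewrite ltnS leq_eqVlt => /predU1P[<- //|Tt] tN.
  by apply: stay => //; apply: IH => //; exact: ltnW.
have T0 : (0 : R) <= T%:R by rewrite ler0n.
have TN' : (T%:R + 1 : R) <= N%:R by rewrite natr1 ler_nat.
exists (T%:R + 1 / 2); split.
- by apply/andP; split; lra.
- rewrite (interp_mid _ TN); last by rewrite -[T.+1%:R]natr1; lra.
  by rewrite eT; field.
- move=> x xt; have [x0|x0] := leP x 0; first by rewrite interp_le0.
  have xN : x < N%:R by lra.
  have [t tN tx] := nat_segment x0 xN; have /andP[h1 h2] := tx; rewrite -natr1 in h2.
  rewrite (interp_mid _ tN) //.
  case: (ltngtP t T) => tT.
  + by apply: (lerp_gt0 (posd t (ltnW tT)) (posd t.+1 tT)); lra.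
  + have : (T.+1%:R : R) <= t%:R by rewrite ler_nat.
    by rewrite -natr1; lra.
  + by subst t; rewrite eT lerp_opp pmulr_rgt0 //; lra.
- move=> x xt; have [xN|xN] := leP N%:R x; first by rewrite interp_ge.
  have x0 : 0 < x by lra.
  have [t tN tx] := nat_segment x0 xN; have /andP[h1 h2] := tx; rewrite -natr1 in h2.
  rewrite (interp_mid _ tN) //.
  case: (ltngtP t T) => tT.
  + have : (t.+1%:R : R) <= T%:R by rewrite ler_nat.
    by rewrite -natr1; lra.
  + by apply: (lerp_lt0 (negd t tT (ltnW tN)) (negd t.+1 (ltnW tT) tN)); lra.
  + by subst t; rewrite eT lerp_opp pmulr_rlt0 //; lra.
Qed.

End Interp.

(** A sweep without its family, so that it also covers the sweep extended by a line at infinity. *)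
Definition half_turn n N (c : nat -> 'I_n -> nat) :=
  [/\ forall i, c 0%N i = i, forall i, c N i = (n.-1 - i)%N,
      forall t, (t < N)%N -> block_reversal (c t) (c t.+1) &
      forall t, (t <= N)%N -> injective (c t) /\ forall i, (c t i < n)%N].

Section SweepCurves.
Variables (R : realType) (n : nat) (N : nat) (c : nat -> 'I_n -> nat).
Hypothesis sw : half_turn N c.
Implicit Types (i j : 'I_n) (t : nat).

Definition gap i j t : R := (c t j)%:R - (c t i)%:R.

Lemma gap_gt0 i j t : (0 < gap i j t) = (c t i < c t j)%N.
Proof. by rewrite subr_gt0 ltr_nat. Qed.

Lemma gap_lt0 i j t : (gap i j t < 0) = (c t j < c t i)%N.
Proof. by rewrite subr_lt0 ltr_nat. Qed.

Lemma gapC i j t : gap i j t = - gap j i t.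
Proof. by rewrite opprB. Qed.

Lemma gap_neq0 i j t : i != j -> (t <= N)%N -> gap i j t != 0.
Proof.
move=> ij tN; have [_ _ _ /(_ t tN)[inj _]] := sw.
by rewrite subr_eq0 eqr_nat; apply: contra ij => /eqP/inj ->.
Qed.

(** Only elements of the same block change their order, and reversing the block negates their
    gap. *)
Lemma block_reversal_order t i j : (t < N)%N -> (c t i < c t j)%N ->
  (c t.+1 i < c t.+1 j)%N \/
  [/\ gap i j t.+1 = - gap i j t & (i < j)%N].
Proof.
move=> tN ij; have [_ _ /(_ t tN)[p [q [qn out blk up]]] _] := sw.
have [pi|pi] := boolP (p <= c t i < q)%N; last first.
  left; rewrite (out i pi); have [pj|pj] := boolP (p <= c t j < q)%N; last by rewrite (out j pj).
  rewrite (blk j pj); move: pi pj ij; clear; lia.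
have [pj|pj] := boolP (p <= c t j < q)%N; last first.
  left; rewrite (out j pj) (blk i pi); move: pi pj ij; clear; lia.
right; split; last by apply: up ij _; case/andP: pi pj => ? _ /andP[].
rewrite /gap (blk i pi) (blk j pj) !natrB; first ring; by move: pi pj; clear; lia.
Qed.

Lemma gap_negating i j : i != j -> negating N (gap i j).
Proof.
move=> ij t tN; have := gap_neq0 ij (ltnW tN).
have [h|h|->] := ltgtP (gap i j t) 0; rewrite ?eqxx // => _.
- rewrite gap_lt0 in h; have [h'|[e _]] := block_reversal_order tN h; last first.
    by right; rewrite gapC e gapC opprK.
  by left; rewrite nmulr_rgt0 gap_lt0.
- rewrite gap_gt0 in h; have [h'|[e _]] := block_reversal_order tN h; last by right.
  by left; rewrite pmulr_rgt0 gap_gt0.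
Qed.

Definition sweep_curve i (x : R) : R := interp N (fun t => (c t i)%:R) x.

Lemma sweep_curve_continuous i : continuous (sweep_curve i).
Proof. exact: interp_continuous. Qed.

Lemma sweep_curveB i j x : sweep_curve j x - sweep_curve i x = interp N (gap i j) x.
Proof. by rewrite -interpB. Qed.

Lemma sweep_curve_nat i t : (t <= N)%N -> sweep_curve i t%:R = (c t i)%:R.
Proof. exact: interp_nat. Qed.

Lemma sweep_curve_cross i j : (i < j)%N -> exists tau : R,
  [/\ 0 < tau < N%:R, sweep_curve i tau = sweep_curve j tau,
     forall x, x < tau -> sweep_curve i x < sweep_curve j x &
     forall x, tau < x -> sweep_curve j x < sweep_curve i x].
Proof.
move=> ij; have nij : i != j by rewrite neq_ltn ij.
have [c0 cN _ _] := sw.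
have [|||t tN h||tau [t1 t2 t3 t4]] := @interp_cross R N (gap i j).
- exact: gap_negating.
- by rewrite gap_gt0 !c0.
- rewrite gap_lt0 !cN; have := ltn_ord j; move: ij; clear; lia.
- rewrite gap_lt0 in h; have [h'|[_]] := block_reversal_order tN h; first by rewrite gap_lt0.
  by rewrite ltnNge (ltnW ij).
- by move=> t; exact: gap_neq0.
exists tau; split => // [|x /t3|x /t4]; rewrite -?sweep_curveB ?subr_gt0 ?subr_lt0 //.
by apply/esym/eqP; rewrite -subr_eq0 sweep_curveB t2.
Qed.

Lemma order_of_initial t (A : {set 'I_n}) : (t <= N)%N ->
  (forall i j, i \in A -> j \notin A -> (c t i < c t j)%N) ->
  exists2 k, (k <= n)%N & A = [set i | (c t i < k)%N]%SET.
Proof.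
move=> tN h; have [_ _ _ /(_ t tN)[_ bd]] := sw.
have [j jA|AT] := pickP [pred j | j \notin A]; last first.
  exists n => //; apply/setP => i; rewrite inE bd.
  by have := AT i; rewrite /= => /negbFE.
have [k kA kmin] := arg_minnP (c t) jA.
exists (c t k); first exact: ltnW.
apply/setP => i; rewrite inE; apply/idP/idP => [iA|]; first exact: h.
by apply: contraTT => iA; rewrite -leqNgt; exact: kmin.
Qed.

Lemma lower_set_sweep (A : {set 'I_n}) : (exists x : R, lower_set sweep_curve A x) <->
  exists t k, [/\ (t <= N)%N, (k <= n)%N & A = [set i | (c t i < k)%N]%SET].
Proof.
split => [[x xA]|[t [k [tN kn ->]]]].
  have [t tN ht] := interp_index N x.
  have [|k kn ->] := @order_of_initial t A tN; last by exists t, k.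
  move=> i j iA jA; have ij : i != j by apply: contra jA => /eqP <-.
  have [+ _] := ht _ (gap_negating ij); rewrite gap_gt0; apply.
  by rewrite -sweep_curveB subr_gt0; exact: xA.
exists t%:R => i j; rewrite !inE -leqNgt => ik kj.
by rewrite !sweep_curve_nat // ltr_nat (leq_trans ik).
Qed.

Lemma half_turn_region_graph (F : {set {set 'I_n}}) :
  (forall A, A \in F <-> exists t k, [/\ (t <= N)%N, (k <= n)%N & A = [set i | (c t i < k)%N]%SET]) ->
  pseudoline_arrangement (graph_curve sweep_curve) /\ is_region_graph F (graph_curve sweep_curve).
Proof.
move=> FE.
have crs i j : i != j -> crosses_up sweep_curve i j \/ crosses_up sweep_curve j i.
  by rewrite neq_ltn => /orP[]/sweep_curve_cross[tau [_ ? ? ?]]; [left|right]; exists tau.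
split; first exact: (graph_arrangement sweep_curve_continuous crs).
apply: (graph_region_graph sweep_curve_continuous crs) => A.
by rewrite FE lower_set_sweep.
Qed.

End SweepCurves.

Lemma sweep_half_turn n F N (c : nat -> 'I_n -> nat) : sweep F N c -> half_turn N c.
Proof. by case. Qed.

Lemma is_region_graph_iso (R : realType) (U V : finType) (G : {set {set U}}) (H : {set {set V}})
    n (l : 'I_n -> R -> R * R) : graph_iso G H -> is_region_graph H l -> is_region_graph G l.
Proof.
move=> [phi [inj im adj]] [psi [[ps1 ps2 ps3] pa]].
have mem A : A \in G -> phi A \in H by move=> AG; rewrite -im imset_f.
exists (psi \o phi); split; last by move=> A B AG BG /=; rewrite -adj // pa ?mem.
split.
- by move=> A /= AG; apply: ps1; exact: mem.
- move=> A B; rewrite !inE => AG BG /= e; apply: inj => //.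
  by apply: (ps2 _ _ _ _ e); rewrite inE /=; exact: mem.
- move=> P /ps3[B /=]; rewrite -im => /imsetP[A AG ->] <-; by exists A.
Qed.

Lemma normal_family_disk (R : realType) (U : finType) (D : {set {set U}}) n (F : {set {set 'I_n}}) :
  partial_cube D -> normal_family F -> graph_iso D F -> disk R D.
Proof.
move=> pD /normal_family_sweep[N [c sF]] iso; split => //.
have [_ _ _ _ FE] := sF.
have [ar rg] := @half_turn_region_graph R n N c (sweep_half_turn sF) F FE.
by exists n, (graph_curve (@sweep_curve R n N c)); split => //; exact: is_region_graph_iso rg.
Qed.

(** * Pseudo-disks are disks *)

(** By [sides_region] distinct regions are separated by some curve, and there is only one
    candidate. *)
Lemma few_curves_complete (R : realType) (U : finType) (D : {set {set U}}) n (l : 'I_n -> R -> R * R) :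
  (n <= 1)%N -> pseudoline_arrangement l -> is_region_graph D l ->
  {in D &, forall A B, A != B -> cube_adj A B}.
Proof.
move=> n1 arr [phi [[phi_fun phi_inj _] adj]] A B AD BD AB; apply/adj => //.
have [p cp ep] := phi_fun A AD; have [q cq eq] := phi_fun B BD; rewrite -ep -eq.
apply/(region_adjP cp cq).
have [i ni] : exists i, ~ connected_component (~` range (l i)) p q.
  apply: contrapT => h; move/eqP: AB; apply; apply: phi_inj; rewrite ?inE //.
  rewrite -ep -eq; apply: same_connected_component; apply: (sides_region arr) => i.
  by apply: contrapT => ni; apply: h; exists i.
exists i => // k; rewrite -val_eqE /= => ki; exfalso.
by move: ki (ltn_ord i) (ltn_ord k) n1; clear; lia.
Qed.

Lemma pseudo_disk_iff_disk (R : realType) m (D : {set {set 'I_m}}) :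
  partial_cube D -> (vcdim D <= 2)%N -> (pseudo_disk D <-> disk R D).
Proof.
move=> pD v2; split => [/pseudo_disk_normal[n [F [nF iso]]]|[_ [n [l [arr rg]]]]].
  exact: normal_family_disk nF iso.
have [n1|n1] := leqP n 1.
  by apply: complete_pseudo_disk => //; exact: few_curves_complete rg.
have [S [iso sS aS vS]] := disk_sign_family n1 arr rg.
have [F [nF isoF]] := normal_iso (ltnW n1) sS aS vS.
by apply: (normal_pseudo_disk pD v2 n1 nF); apply: graph_iso_sym; exact: graph_iso_trans iso isoF.
Qed.

(** * Sign vectors of single-crossing curves *)

Section Signs.
Variable R : realType.
Implicit Types r s : R.

Definition sg r : 'F_3 := if 0 < r then 1 else if r < 0 then -1 else 0.

Lemma sg_eq1 r : (sg r == 1) = (0 < r).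
Proof. by rewrite /sg; case: (ltgtP 0 r). Qed.

Lemma sg_eqN1 r : (sg r == -1) = (r < 0).
Proof. by rewrite /sg; case: (ltgtP 0 r). Qed.

Lemma sg_eq0 r : (sg r == 0) = (r == 0).
Proof. by rewrite /sg; case: (ltgtP 0 r) => // <-; rewrite eqxx. Qed.

Lemma sgN r : sg (- r) = - sg r.
Proof. by rewrite /sg oppr_gt0 oppr_lt0; case: (ltgtP r 0) => // _; rewrite ?opprK ?oppr0. Qed.

Lemma F3_cases (u : 'F_3) : [\/ u = 1, u = -1 | u = 0].
Proof.
case: u => -[|[|[|//]]] h; [constructor 3|constructor 1|constructor 2]; exact/val_inj.
Qed.

Lemma sg_mulN1 r s : (sg r * sg s == -1) = ((0 < r) && (s < 0)) || ((r < 0) && (0 < s)).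
Proof. by rewrite /sg; case: (ltgtP 0 r) => _; case: (ltgtP 0 s). Qed.

End Signs.

(** * Curves crossing at most once over a window *)

Section Window.
Variables (R : realType) (I : finType) (f : I -> R -> R) (a b : R).
Hypothesis cf : forall e, continuous (f e).
Hypothesis ab : a < b.
(** Weak hypotheses at [u] and [v] with a strict conclusion in between: this includes that two
    curves never meet twice, even at the ends of the window. *)
Definition single_crossing := forall e g u v x, e != g -> a <= u -> v <= b -> f e u <= f g u -> f e v <= f g v ->
  u < x < v -> f e x < f g x.
Hypothesis win : single_crossing.
Implicit Types (e g p q z : I) (x y : R).

Lemma curves_meet e g u v : u <= v -> f e u < f g u -> f g v < f e v ->
  exists2 x, u < x < v & f e x = f g x.
Proof.
move=> uv hu hv.
have cd : continuous (fun x => f g x - f e x) by move=> x; apply: cvgB; exact: cf.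
have [|x xuv h] := @IVT _ _ _ _ 0 uv (continuous_subspaceT cd).
  by rewrite ge_min le_max; apply/andP; split; apply/orP; [right|left]; lra.
move: xuv; rewrite in_itv /= => /andP[ux xv].
exists x; last by lra.
by rewrite !lt_neqAle ux xv !andbT; apply/andP; split; apply/eqP => e'; subst x; lra.
Qed.

Lemma between_unique z z' : f z a = f z' a -> f z b = f z' b -> z = z'.
Proof.
move=> ha hb; apply/eqP/negPn/negP => zz'.
have hm : a < (a + b) / 2 < b by have h := ab; lra.
have := win zz' (lexx a) (lexx b) _ _ hm; rewrite ha hb !lexx => /(_ isT isT).
have := @win z' z a b ((a + b) / 2) _ (lexx a) (lexx b) _ _ hm.
by rewrite ha hb !lexx eq_sym => /(_ zz' isT isT); lra.
Qed.

Lemma near_order u : a <= u <= b -> exists2 x, a < x < b & forall p q, f p u < f q u -> f p x < f q x.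
Proof.
move=> /andP[au ub]; have ab' := ab.
have h p q : \forall x \near u, f p u < f q u -> f p x < f q x.
  have [h|h] := ltP (f p u) (f q u); last by near=> x.
  have cd : continuous (fun x => f q x - f p x) by move=> x; apply: cvgB; exact: cf.
  have : \forall x \near u, 0 < f q x - f p x.
    by apply: (cvgr_gt _ (cd u)); rewrite subr_gt0.
  by apply: filterS => x; rewrite subr_gt0.
have h' p := @filter_forall R I _ _ (nbhs_filter u) (h p).
have /nbhs_ballP[d /= d0 hd] := @filter_forall R I _ _ (nbhs_filter u) h'.
have [ub'|ub'] := eqVneq u b.
  have [x [xab xd]] : exists x, a < x < b /\ b - d / 2 <= x.
    have [h0|h0] := leP (b - d / 2) ((a + b) / 2); [exists ((a + b) / 2)|exists (b - d / 2)]; lra.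
  by exists x => //; apply: hd; rewrite /ball /= ub' ger0_norm; lra.
have {}ub : u < b by rewrite lt_neqAle ub' ub.
have [x [xab xd]] : exists x, a < x < b /\ u <= x <= u + d / 2.
  have [h0|h0] := leP (u + d / 2) ((u + b) / 2); [exists (u + d / 2)|exists ((u + b) / 2)]; lra.
by exists x => //; apply: hd; rewrite /ball /= distrC ger0_norm; lra.
Unshelve. all: by end_near.
Qed.

(** A point of the curve [e] is sought that lies above the curves passing weakly below [(a, y1)] and
    [(b, y2)] and below those passing weakly above both. If a curve runs through both points, its
    meeting with [e] serves. Otherwise a low curve [p] is below [e] from [lo p] on, a high curve [q]
    is above [e] until [up q], and [lo p < up q] since [p] stays below [q]. *)
Lemma window_elim e y1 y2 : f e a < y1 -> y2 < f e b -> exists x, [/\ a < x < b,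
  forall g, f g a = y1 -> f g b = y2 -> f g x = f e x,
  forall g, f g a <= y1 -> f g b <= y2 -> f g a < y1 \/ f g b < y2 -> f g x < f e x &
  forall g, y1 <= f g a -> y2 <= f g b -> y1 < f g a \/ y2 < f g b -> f e x < f g x].
Proof.
move=> ea eb; have ab' := ab.
have [[z [za zb]]|nz] := pselect (exists z, f z a = y1 /\ f z b = y2).
  have [|||x xab fx] := @curves_meet e z a b; [exact: ltW|lra|lra|].
  exists x; split => //.
  - by move=> g ga gb; rewrite fx; congr (f _ x); apply: between_unique; lra.
  - move=> g ga gb h; rewrite fx; apply: (win _ (lexx a) (lexx b)) => //; try lra.
    by apply/eqP => gz; subst g; lra.
  - move=> g ga gb h; rewrite fx; apply: (win _ (lexx a) (lexx b)) => //; try lra.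
    by apply/eqP => gz; subst g; lra.
have low g : exists t, f g b <= y2 -> [/\ a <= t < b, a < t -> f g t = f e t,
    forall x, a < x < t -> f e x < f g x & forall x, t < x < b -> f g x < f e x].
  have [gb|] := leP (f g b) y2; last by move=> h; exists a => h1; exfalso; lra.
  have ge : g != e by apply/eqP => h; subst g; lra.
  have [h|h] := leP (f g a) (f e a).
    exists a => _; split=> [||x|x xab]; rewrite ?ltxx ?lexx //; first lra.
    by apply: (win ge (lexx a) (lexx b)) => //; lra.
  have [|||t tab ft] := @curves_meet e g a b; [exact: ltW|lra|lra|].
  exists t => _; split => // [|x xt|x xt]; first lra.
  - by rewrite eq_sym in ge; apply: (win ge (lexx a) _ _ _ xt); lra.
  - by apply: (win ge _ (lexx b) _ _ xt); lra.
have upp g : exists t, y1 <= f g a -> [/\ a < t <= b, t < b -> f g t = f e t &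
    forall x, a < x < t -> f e x < f g x].
  have [ga|] := leP y1 (f g a); last by move=> h; exists a => h1; exfalso; lra.
  have ge : e != g by apply/eqP => h; subst g; lra.
  have [h|h] := leP (f e b) (f g b).
    exists b => _; split=> [||x xab]; rewrite ?ltxx ?lexx ?ab //.
    by apply: (win ge (lexx a) (lexx b)) => //; lra.
  have [|||t tab ft] := @curves_meet e g a b; [exact: ltW|lra|lra|].
  exists t => _; split => // [|x xt]; first lra.
  by apply: (win ge (lexx a) _ _ _ xt); lra.
have [lo hlo] := choice low; have [up hup] := choice upp.
pose P := [pred g | (f g a <= y1) && (f g b <= y2)].
pose Q := [pred g | (y1 <= f g a) && (y2 <= f g b)].
have [|x [h1 h2]] := @seq_between R (a :: [seq lo g | g <- enum P]) (b :: [seq up g | g <- enum Q]).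
  move=> s t; rewrite !in_cons => /orP[/eqP->|/mapP[p + ->]] /orP[/eqP->|/mapP[q + ->]] //.
  - by rewrite mem_enum => /andP[/hup[]]; lra.
  - by rewrite mem_enum => /andP[_ /hlo[]]; lra.
  rewrite !mem_enum => /andP[pa pb] /andP[qa qb].
  have [u1 u2 u3 u4] := hlo p pb; have [v1 v2 v3] := hup q qa.
  have pq : p != q by apply/eqP => h; subst q; apply: nz; exists p; split; lra.
  have lt x : a < x < b -> f p x < f q x.
    by move=> xab; apply: (win pq (lexx a) (lexx b)) => //; lra.
  have [//|] := ltP (lo p) (up q); rewrite le_eqVlt => /orP[/eqP h|h].
    have := v2; have := u2; have := lt (up q); rewrite h; lra.
  have := v2; have := u3 (up q); have := lt (up q); lra.
have ax : a < x by apply: h1; rewrite mem_head.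
have xb : x < b by apply: h2; rewrite mem_head.
exists x; split; first by rewrite ax.
- by move=> g ga gb; exfalso; apply: nz; exists g.
- move=> g ga gb _; have [_ _ _ u4] := hlo g gb; apply: u4; rewrite xb andbT.
  by apply: h1; rewrite in_cons map_f ?orbT // mem_enum /= inE ga gb.
- move=> g ga gb _; have [_ _ v3] := hup g ga; apply: v3; rewrite ax /=.
  by apply: h2; rewrite in_cons map_f ?orbT // mem_enum /= inE ga gb.
Qed.

End Window.

Section SignVectors.
Variables (R : realType) (I : finType) (f : I -> R -> R).
Implicit Types (e g p q z : I) (x y u v : R).

Definition sigma x y : signvec I := [ffun e => sg (y - f e x)].

(** The hypotheses say that [W] cuts the vertical order at [x]. The height is that of the zero
    curves, which all agree, or else lies in the gap between the two classes. *)
Lemma realize x (W : signvec I) :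
  (forall p q, W p = 1 -> W q = -1 -> f p x < f q x) ->
  (forall p z, W p = 1 -> W z = 0 -> f p x < f z x) ->
  (forall z q, W z = 0 -> W q = -1 -> f z x < f q x) ->
  (forall z z', W z = 0 -> W z' = 0 -> f z x = f z' x) -> exists y, W = sigma x y.
Proof.
move=> h1 h2 h3 h4; have [z /eqP Wz|W0] := pickP [pred z | W z == 0].
  exists (f z x); apply/ffunP => p; rewrite ffunE; apply/esym/eqP.
  case: (F3_cases (W p)) => Wp; rewrite Wp.
  - by rewrite sg_eq1 subr_gt0; exact: h2.
  - by rewrite sg_eqN1 subr_lt0; exact: h3.
  - by rewrite sg_eq0 subr_eq0 (h4 z p).
have [|y [hy1 hy2]] := @fin_between R I [pred p | W p == 1] [pred p | W p == -1] (f ^~ x).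
  by move=> p q /eqP Wp /eqP Wq; exact: h1.
exists y; apply/ffunP => p; rewrite ffunE; apply/esym/eqP.
case: (F3_cases (W p)) => Wp; rewrite Wp.
- by rewrite sg_eq1 subr_gt0; apply: hy1; rewrite /= Wp.
- by rewrite sg_eqN1 subr_lt0; apply: hy2; rewrite /= Wp.
- by have := W0 p; rewrite /= Wp eqxx.
Qed.

Lemma comp_eq1 u v y y' p : sv_comp (sigma u y) (sigma v y') p = 1 ->
  f p u < y \/ (f p u = y /\ f p v < y').
Proof.
rewrite !ffunE; case: ifP => [_ /eqP|/negbFE]; first by rewrite sg_eq1; left; lra.
by rewrite sg_eq0 subr_eq0 => /eqP -> /eqP; rewrite sg_eq1; right; split=> //; lra.
Qed.

Lemma comp_eqN1 u v y y' p : sv_comp (sigma u y) (sigma v y') p = -1 ->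
  y < f p u \/ (f p u = y /\ y' < f p v).
Proof.
rewrite !ffunE; case: ifP => [_ /eqP|/negbFE]; first by rewrite sg_eqN1; left; lra.
by rewrite sg_eq0 subr_eq0 => /eqP -> /eqP; rewrite sg_eqN1; right; split=> //; lra.
Qed.

Lemma comp_eq0 u v y y' p : sv_comp (sigma u y) (sigma v y') p = 0 -> f p u = y /\ f p v = y'.
Proof.
rewrite !ffunE; case: ifP => [/eqP//|/negbFE].
by rewrite sg_eq0 subr_eq0 => /eqP -> /eqP; rewrite sg_eq0 subr_eq0 => /eqP ->.
Qed.

(** Composition moves the point slightly from [u] towards [v]: strict orders at [u] persist nearby,
    and curves meeting at [u] separate according to their order at [v]. *)
Lemma window_comp a b u v y y' : (forall e, continuous (f e)) -> a < b -> single_crossing f a b ->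
  (u = a /\ v = b) \/ (u = b /\ v = a) ->
  exists x (z : R), a < x < b /\ sv_comp (sigma u y) (sigma v y') = sigma x z.
Proof.
move=> cf ab win uv.
have [|x xab ord] := near_order cf ab (_ : a <= u <= b); first by case: uv => -[-> _]; lra.
have win' p q : p != q -> f p u = f q u -> f p v <= f q v -> f p x < f q x.
  move=> pq h1 h2; apply: (win p q a b x pq); rewrite ?lexx // .
    by case: uv h1 h2 => -[-> ->]; lra.
  by case: uv h1 h2 => -[-> ->]; lra.
suff [z hz] : exists z : R, sv_comp (sigma u y) (sigma v y') = sigma x z by exists x, z.
apply: realize.
- move=> p q /comp_eq1 hp /comp_eqN1 hq.
  have [h|h] := ltP (f p u) (f q u); first exact: ord.
  have pq : p != q by apply/eqP => pq; subst q; lra.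
  by apply: win' => //; lra.
- move=> p q /comp_eq1 hp /comp_eq0 hq.
  have [h|h] := ltP (f p u) (f q u); first exact: ord.
  have pq : p != q by apply/eqP => pq; subst q; lra.
  by apply: win' => //; lra.
- move=> p q /comp_eq0 hp /comp_eqN1 hq.
  have [h|h] := ltP (f p u) (f q u); first exact: ord.
  have pq : p != q by apply/eqP => pq; subst q; lra.
  by apply: win' => //; lra.
- move=> p q /comp_eq0 [p1 p2] /comp_eq0[q1 q2]; have [->//|pq] := eqVneq p q.
  have := win' p q pq; have := win' q p; rewrite eq_sym pq p1 p2 q1 q2 !lexx.
  by move=> /(_ isT erefl isT) h1 /(_ erefl isT); lra.
Qed.

Lemma vertical_comp x y y' : exists z : R, sv_comp (sigma x y) (sigma x y') = sigma x z.
Proof.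
apply: realize.
- by move=> p q /comp_eq1 hp /comp_eqN1 hq; lra.
- by move=> p q /comp_eq1 hp /comp_eq0 hq; lra.
- by move=> p q /comp_eq0 hp /comp_eqN1 hq; lra.
- by move=> p q /comp_eq0 hp /comp_eq0 hq; lra.
Qed.

Lemma antipodal_comp x y y' : exists z : R, sv_comp (sigma x y) (sv_opp (sigma x y')) = sigma x z.
Proof.
have E p : sv_comp (sigma x y) (sv_opp (sigma x y')) p =
    if f p x == y then sg (f p x - y') else sg (y - f p x).
  by rewrite !ffunE sg_eq0 subr_eq0 eq_sym; case: eqP => //= _; rewrite -sgN opprB.
have e1 p : sv_comp (sigma x y) (sv_opp (sigma x y')) p = 1 -> f p x < y \/ (f p x = y /\ y' < f p x).
  by rewrite E; case: eqP => [h|h] /eqP; rewrite sg_eq1; lra.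
have eN1 p : sv_comp (sigma x y) (sv_opp (sigma x y')) p = -1 -> y < f p x \/ (f p x = y /\ f p x < y').
  by rewrite E; case: eqP => [h|h] /eqP; rewrite sg_eqN1; lra.
have e0 p : sv_comp (sigma x y) (sv_opp (sigma x y')) p = 0 -> f p x = y /\ y' = f p x.
  by rewrite E; case: eqP => [h|h] /eqP; rewrite sg_eq0 => /eqP; lra.
apply: realize.
- by move=> p q /e1 hp /eN1 hq; lra.
- by move=> p q /e1 hp /e0 hq; lra.
- by move=> p q /e0 hp /eN1 hq; lra.
- by move=> p q /e0 hp /e0 hq; lra.
Qed.

Lemma mulN1_sigma u v y y' g : sigma u y g * sigma v y' g = -1 <->
  (f g u < y /\ y' < f g v) \/ (y < f g u /\ f g v < y').
Proof.
rewrite !ffunE; split=> [/eqP|h]; first by rewrite sg_mulN1; lra.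
by apply/eqP; rewrite sg_mulN1; lra.
Qed.

Lemma window_elim_sigma a b y1 y2 e : (forall e, continuous (f e)) -> a < b -> single_crossing f a b ->
  f e a < y1 -> y2 < f e b -> exists2 x, a < x < b &
    forall g, sigma a y1 g * sigma b y2 g <> -1 ->
      sigma x (f e x) g = sv_comp (sigma a y1) (sigma b y2) g.
Proof.
move=> cf ab win ea eb; have [x [xab h0 h1 hN]] := window_elim cf ab win ea eb.
exists x => // g /mulN1_sigma hg; rewrite [LHS]ffunE; apply/eqP.
case: (F3_cases (sv_comp (sigma a y1) (sigma b y2) g)) => hW; rewrite hW.
- by rewrite sg_eq1 subr_gt0; apply: h1; have := comp_eq1 hW; lra.
- by rewrite sg_eqN1 subr_lt0; apply: hN; have := comp_eqN1 hW; lra.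
- by rewrite sg_eq0 subr_eq0; have [u v] := comp_eq0 hW; rewrite (h0 g u v).
Qed.

End SignVectors.

(** * The oriented matroid of a circular family *)

Section SignOperations.
Variable I : finType.
Implicit Types X Y : signvec I.

Lemma sv_oppK X : sv_opp (sv_opp X) = X.
Proof. by apply/ffunP => e; rewrite !ffunE opprK. Qed.

Lemma sv_opp_comp X Y : sv_comp (sv_opp X) (sv_opp Y) = sv_opp (sv_comp X Y).
Proof. by apply/ffunP => e; rewrite !ffunE oppr_eq0; case: ifP. Qed.

Definition sv0 : signvec I := [ffun=> 0].

Lemma sv_opp0 : sv_opp sv0 = sv0.
Proof. by apply/ffunP => e; rewrite !ffunE oppr0. Qed.

Lemma sv_comp0l X : sv_comp sv0 X = X.
Proof. by apply/ffunP => e; rewrite !ffunE eqxx. Qed.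

Lemma sv_comp0r X : sv_comp X sv0 = X.
Proof. by apply/ffunP => e; rewrite !ffunE; case: eqP. Qed.

Lemma sv_comp_sym X Y g : X g * Y g <> -1 -> sv_comp X Y g = sv_comp Y X g.
Proof.
rewrite !ffunE; case: (F3_cases (X g)) => ->; case: (F3_cases (Y g)) => -> // h.
- by case: h; apply/eqP.
- by case: h; apply/eqP.
Qed.

End SignOperations.

Section CircularFamily.
Variables (R : realType) (I : finType).

Definition crosses (f : I -> R -> R) (M : R) e g := exists tau,
  [/\ 0 < tau < M, f e tau = f g tau, forall x, 0 <= x < tau -> f e x < f g x &
    forall x, tau < x <= M -> f g x < f e x].

(* Gluing the ends of [0, M] x R with a change of sign gives a Moebius strip, on which the curves [f e]
   are pseudolines of the projective plane. *)
Definition circular_family (f : I -> R -> R) (M : R) :=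
  [/\ 0 < M, forall e, continuous (f e), forall e x, 0 <= x <= M -> f e (x + M) = - f e x &
    forall e g, e != g -> crosses f M e g \/ crosses f M g e].

Lemma circular_opp f M : circular_family f M -> circular_family (fun e x => - f e x) M.
Proof.
move=> [M0 cf anti cr]; split => //.
- by move=> e x; apply: cvgN; exact: cf.
- by move=> e x h; rewrite anti.
- by move=> e g /cr[] [t [h1 h2 h3 h4]]; [right|left]; exists t; split=> // [|x /h3|x /h4];
    rewrite ?ltrN2 // h2.
Qed.

(** Two curves change order at some [t] and change back at [t + M]; a window shorter than [M]
    contains at most one of these parameters. *)
Lemma circular_single_crossing f M a b : circular_family f M ->
  0 <= a -> b < a + M -> b <= 2 * M -> single_crossing f a b.
Proof.
move=> [M0 cf anti cr] a0 baM b2M e g u v x eg au vb hu hv xuv.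
have antiD p x' : M <= x' -> x' <= 2 * M -> f p x' = - f p (x' - M).
  by move=> h1 h2; rewrite -[x' in LHS](subrK M) anti; lra.
have y2M (y : R) : 0 <= y <= 2 * M -> y <= 2 * M by case/andP.
have [] := cr e g eg => -[t [tM et h1 h2]].
- have pos y : 0 <= y <= 2 * M -> t < y < t + M -> f g y < f e y.
    move=> y2 ty; have [yM|yM] := leP y M; first by apply: h2; lra.
    by rewrite (antiD e y (ltW yM) (y2M _ y2)) (antiD g y (ltW yM) (y2M _ y2)) ltrN2; apply: h1; move: ty yM; clear=> ty yM; lra.
  have neg y : 0 <= y <= 2 * M -> y < t \/ t + M < y -> f e y < f g y.
    move=> y2 ty; have [yM|yM] := leP y M; first by apply: h1; lra.
    by rewrite (antiD e y (ltW yM) (y2M _ y2)) (antiD g y (ltW yM) (y2M _ y2)) ltrN2; apply: h2; move: ty yM y2 tM; clear => ty yM y2 tM; lra.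
  apply: neg; first lra.
  have [ut|ut] := leP u t.
    have [vt|vt] := leP v t; first by left; lra.
    by have := pos v; lra.
  have [ut'|ut'] := ltP u (t + M); last by right; lra.
  by have := pos u; lra.
- have neg y : 0 <= y <= 2 * M -> t < y < t + M -> f e y < f g y.
    move=> y2 ty; have [yM|yM] := leP y M; first by apply: h2; lra.
    by rewrite (antiD e y (ltW yM) (y2M _ y2)) (antiD g y (ltW yM) (y2M _ y2)) ltrN2; apply: h1; move: ty yM; clear=> ty yM; lra.
  have pos y : 0 <= y <= 2 * M -> y < t \/ t + M < y -> f g y < f e y.
    move=> y2 ty; have [yM|yM] := leP y M; first by apply: h1; lra.
    by rewrite (antiD e y (ltW yM) (y2M _ y2)) (antiD g y (ltW yM) (y2M _ y2)) ltrN2; apply: h2; move: ty yM y2 tM; clear => ty yM y2 tM; lra.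
  apply: neg; first lra.
  have tu : t <= u by have := pos u; lra.
  have tv : v <= t + M by have := pos v; lra.
  lra.
Qed.

Section Covectors.
Variables (f : I -> R -> R) (M : R).
Hypothesis cF : circular_family f M.
Implicit Types (e g : I) (x y : R) (X Y Z : signvec I).

(** Abscissae over two half turns represent both signs of each point of the strip: [(x, y)] and
    [(x + M, - y)] give opposite vectors. *)
Definition covectors : {set signvec I} :=
  [set X | (X == sv0 I) || `[< exists x y, 0 <= x < 2 * M /\ X = sigma f x y >]]%SET.

Lemma covectorsP X : X \in covectors <-> X = sv0 I \/ exists x y, 0 <= x < 2 * M /\ X = sigma f x y.
Proof.
rewrite inE; split=> [/orP[/eqP->|/asboolP h]|[->|h]]; [by left|by right|by rewrite eqxx|].
by apply/orP; right; apply/asboolP.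
Qed.

Lemma sigma_covector x y : 0 <= x < 2 * M -> sigma f x y \in covectors.
Proof. by move=> h; apply/covectorsP; right; exists x, y. Qed.

Lemma sigma_shift x y : 0 <= x <= M -> sv_opp (sigma f x y) = sigma f (x + M) (- y).
Proof.
move=> h; have [_ _ anti _] := cF.
by apply/ffunP => e; rewrite !ffunE anti // -sgN; congr (sg _); ring.
Qed.

Lemma sigma_unshift x y : M <= x <= 2 * M -> sv_opp (sigma f x y) = sigma f (x - M) (- y).
Proof.
move=> h; rewrite -[x in LHS](subrK M) -[y in LHS]opprK -sigma_shift ?sv_oppK //; lra.
Qed.

Lemma covectors_opp X : X \in covectors -> sv_opp X \in covectors.
Proof.
have [M0 _ _ _] := cF.
move/covectorsP => [->|[x [y [hx ->]]]]; first by rewrite sv_opp0; apply/covectorsP; left.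
have [xM|xM] := ltP x M; [rewrite sigma_shift|rewrite sigma_unshift]; try lra;
  by apply: sigma_covector; lra.
Qed.

(** Points whose abscissae differ by more than [M] are replaced by their opposites, which are closer
    than [M]. Besides windows, only equal and exactly antipodal abscissae remain. *)
Lemma covector_pair (P : signvec I -> signvec I -> Prop) :
  (forall X Y, P (sv_opp X) (sv_opp Y) -> P X Y) ->
  (forall X, X \in covectors -> P (sv0 I) X /\ P X (sv0 I)) ->
  (forall x y y', 0 <= x < 2 * M -> P (sigma f x y) (sigma f x y') /\ P (sigma f x y) (sv_opp (sigma f x y'))) ->
  (forall a b y y', 0 <= a -> a < b -> b < a + M -> b < 2 * M ->
    P (sigma f a y) (sigma f b y') /\ P (sigma f b y') (sigma f a y)) ->
  {in covectors &, forall X Y, P X Y}.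
Proof.
have [M0 _ _ _] := cF.
move=> Popp P0 Pv Pw X Y XL YL.
have [->|[x [y [hx eX]]]] := (covectorsP X).1 XL; first exact: (P0 Y YL).1.
have [->|[x' [y' [hx' eY]]]] := (covectorsP Y).1 YL; first exact: (P0 X XL).2.
rewrite eX eY; have [xx'|xx'|<-] := ltgtP x x'; last exact: (Pv _ _ _ hx).1.
- have [h|h|h] := ltgtP x' (x + M).
  + by case: (Pw x x' y y') => //; lra.
  + apply: Popp; rewrite sigma_shift ?sigma_unshift; [|lra..].
    by case: (Pw (x' - M) (x + M) (- y') (- y)) => //; lra.
  + rewrite h -[y']opprK -sigma_shift; last lra.
    exact: (Pv _ _ _ hx).2.
- have [h|h|h] := ltgtP x (x' + M).
  + by case: (Pw x' x y' y) => //; lra.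
  + apply: Popp; rewrite sigma_unshift ?sigma_shift; [|lra..].
    by case: (Pw (x - M) (x' + M) (- y) (- y')) => //; lra.
  + apply: Popp; rewrite [x in sigma f x y]h -[y]opprK -sigma_shift ?sv_oppK; last lra.
    exact: (Pv _ _ _ hx').2.
Qed.

Lemma covectors_comp : {in covectors &, forall X Y, sv_comp X Y \in covectors}.
Proof.
have [M0 cf _ _] := cF.
apply: covector_pair.
- by move=> X Y; rewrite sv_opp_comp => /covectors_opp; rewrite sv_oppK.
- by move=> X XL; rewrite sv_comp0l sv_comp0r.
- move=> x y y' hx; have [z ->] := vertical_comp f x y y'; have [z' ->] := antipodal_comp f x y y'.
  by split; exact: sigma_covector.
- move=> a b y y' a0 ab baM b2M.
  have win := circular_single_crossing cF a0 baM (ltW b2M).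
  have [x [z [xab ->]]] := window_comp y y' cf ab win (or_introl (conj erefl erefl)).
  have [x' [z' [xab' ->]]] := window_comp y' y cf ab win (or_intror (conj erefl erefl)).
  by split; apply: sigma_covector; lra.
Qed.

Definition eliminable X Y := forall e, X e * Y e = -1 -> exists Z,
  [/\ Z \in covectors, Z e = 0 & forall g, X g * Y g <> -1 -> Z g = sv_comp X Y g].

Lemma eliminable_sym X Y : eliminable X Y -> eliminable Y X.
Proof.
move=> h e; rewrite mulrC => /h[Z [ZL Ze Zg]]; exists Z; split => // g hg.
by rewrite Zg; [apply: sv_comp_sym|]; rewrite mulrC.
Qed.

Lemma eliminable_opp X Y : eliminable (sv_opp X) (sv_opp Y) -> eliminable X Y.
Proof.
move=> h e XY; have mulE g : sv_opp X g * sv_opp Y g = X g * Y g by rewrite !ffunE mulrNN.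
have [|Z [ZL Ze Zg]] := h e; first by rewrite mulE.
exists (sv_opp Z); split; [exact: covectors_opp|by rewrite ffunE Ze oppr0|].
by move=> g hg; rewrite [LHS]ffunE Zg ?mulE // sv_opp_comp [X in - X]ffunE opprK.
Qed.

Lemma eliminable_vertical x y y' : 0 <= x < 2 * M -> eliminable (sigma f x y) (sigma f x y').
Proof.
move=> hx e /mulN1_sigma he; exists (sigma f x (f e x)); split; first exact: sigma_covector.
  by rewrite ffunE subrr /sg ltxx.
move=> g /mulN1_sigma hg; rewrite [LHS]ffunE; apply/eqP.
case: (F3_cases (sv_comp (sigma f x y) (sigma f x y') g)) => hW; rewrite hW.
- by rewrite sg_eq1; have := comp_eq1 hW; lra.
- by rewrite sg_eqN1; have := comp_eqN1 hW; lra.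
- by have := comp_eq0 hW; lra.
Qed.

(** The constrained curves have heights between [y] and [y'] and all compose to the same sign, while
    [e] lies outside this interval. So the point of [e] on the vertical line, or its opposite,
    serves. *)
Lemma eliminable_antipodal x y y' : 0 <= x < 2 * M -> eliminable (sigma f x y) (sv_opp (sigma f x y')).
Proof.
move=> hx e; have E g : sigma f x y g * sv_opp (sigma f x y') g = -1 <->
   (f g x < y /\ f g x < y') \/ (y < f g x /\ y' < f g x).
  rewrite !ffunE -sgN; split => [/eqP|h]; first by rewrite sg_mulN1; lra.
  by apply/eqP; rewrite sg_mulN1; lra.
move=> /E he; have [yy'|yy'|yy'] := ltgtP y y'.
- have comp g : sigma f x y g * sv_opp (sigma f x y') g <> -1 ->
      y <= f g x <= y' /\ sv_comp (sigma f x y) (sv_opp (sigma f x y')) g = -1.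
    move=> /E hg; split; first lra.
    rewrite !ffunE; case: ifP => [|/negbFE]; first by rewrite sg_eq0 => /eqP h; apply/eqP; rewrite sg_eqN1; lra.
    by rewrite sg_eq0 => /eqP h; rewrite -sgN; apply/eqP; rewrite sg_eqN1; lra.
  have [ey|ey] := ltP (f e x) y.
    exists (sigma f x (f e x)); split; [exact: sigma_covector|by rewrite ffunE subrr /sg ltxx|].
    by move=> g /comp[hg ->]; rewrite ffunE; apply/eqP; rewrite sg_eqN1; lra.
  exists (sv_opp (sigma f x (f e x))); split.
  + by apply: covectors_opp; exact: sigma_covector.
  + by rewrite !ffunE subrr /sg ltxx oppr0.
  + by move=> g /comp[hg ->]; rewrite !ffunE -sgN; apply/eqP; rewrite sg_eqN1; lra.
- have comp g : sigma f x y g * sv_opp (sigma f x y') g <> -1 ->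
      y' <= f g x <= y /\ sv_comp (sigma f x y) (sv_opp (sigma f x y')) g = 1.
    move=> /E hg; split; first lra.
    rewrite !ffunE; case: ifP => [|/negbFE]; first by rewrite sg_eq0 => /eqP h; apply/eqP; rewrite sg_eq1; lra.
    by rewrite sg_eq0 => /eqP h; rewrite -sgN; apply/eqP; rewrite sg_eq1; lra.
  have [ey|ey] := ltP y (f e x).
    exists (sigma f x (f e x)); split; [exact: sigma_covector|by rewrite ffunE subrr /sg ltxx|].
    by move=> g /comp[hg ->]; rewrite ffunE; apply/eqP; rewrite sg_eq1; lra.
  exists (sv_opp (sigma f x (f e x))); split.
  + by apply: covectors_opp; exact: sigma_covector.
  + by rewrite !ffunE subrr /sg ltxx oppr0.
  + by move=> g /comp[hg ->]; rewrite !ffunE -sgN; apply/eqP; rewrite sg_eq1; lra.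
(* The two vectors are opposite, and elimination gives zero. *)
- exists (sv0 I); split; [by apply/covectorsP; left|by rewrite ffunE|].
  move=> g /E hg; have h : f g x = y by move: hg yy'; clear => hg yy'; lra.
  by rewrite [LHS]ffunE ffunE [sigma f x y g]ffunE [sv_opp _ g]ffunE [sigma f x y' g]ffunE -yy' h subrr /sg ltxx eqxx oppr0.
Qed.

End Covectors.

Lemma sigma_opp f x y : sigma (fun e x => - f e x) x y = sv_opp (@sigma R I f x (- y)).
Proof. by apply/ffunP => e; rewrite !ffunE -sgN; congr (sg _); ring. Qed.

Section OrientedMatroid.
Variables (f : I -> R -> R) (M : R).
Hypothesis cF : circular_family f M.

Lemma eliminable_window a b y y' : 0 <= a -> a < b -> b < a + M -> b < 2 * M ->
  eliminable f M (sigma f a y) (sigma f b y').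
Proof.
move=> a0 ab baM b2M e /mulN1_sigma[[ea eb]|[ea eb]].
  have [_ cf _ _] := cF; have win := circular_single_crossing cF a0 baM (ltW b2M).
  have [x xab hx] := window_elim_sigma cf ab win ea eb.
  exists (sigma f x (f e x)); split => //; first by apply: sigma_covector; lra.
  by rewrite ffunE subrr /sg ltxx.
(* When [e] is above the first point and below the second, reflecting the heights restores the
   situation of [window_elim_sigma]. *)
have cF' := circular_opp cF; have [_ cf _ _] := cF'.
have win := circular_single_crossing cF' a0 baM (ltW b2M).
have [||x xab] := @window_elim_sigma R I (fun e x => - f e x) a b (- y) (- y') e cf ab win; try lra.
rewrite !sigma_opp !opprK sv_opp_comp => hx.
exists (sigma f x (f e x)); split => //; first by apply: sigma_covector; lra.
  by rewrite ffunE subrr /sg ltxx.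
move=> g hg; have := hx g; rewrite [sv_opp (sigma f a y) g]ffunE [sv_opp (sigma f b y') g]ffunE mulrNN.
by move=> /(_ hg); rewrite [LHS]ffunE [RHS]ffunE => /oppr_inj.
Qed.

Lemma covectors_oriented_matroid : oriented_matroid (covectors f M).
Proof.
split.
- by apply/set0Pn; exists (sv0 I); apply/covectorsP; left.
- exact: covectors_comp.
- apply/setP => X; apply/imsetP/idP => [[Y YL ->]|XL]; first exact: covectors_opp.
  by exists (sv_opp X); [exact: covectors_opp|rewrite sv_oppK].
- apply: (covector_pair cF); first by move=> X Y; exact: eliminable_opp.
  + by move=> X _; split=> e; rewrite ffunE ?mul0r ?mulr0 => /eqP.
  + by move=> x y y' hx; split; [exact: eliminable_vertical|exact: eliminable_antipodal].
  + move=> a b y y' a0 ab baM b2M; have h := eliminable_window a0 ab baM b2M.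
    by split; [exact: h|apply: eliminable_sym; exact: h].
Qed.

End OrientedMatroid.

End CircularFamily.

(** * Simplicity and topes *)

Section Topes.
Variables (R : realType) (I : finType) (f : I -> R -> R) (M : R).
Hypothesis cF : circular_family f M.
Let L := covectors f M.
Implicit Types (e g : I) (x y : R) (X Y : signvec I).

Lemma circular_neq0 e g : e != g -> f e 0 != f g 0.
Proof.
have [M0 _ _ cr] := cF.
by move=> /cr[] [t [tM _ h _]]; have := h 0; rewrite lexx neq_lt => ->; rewrite ?orbT //; lra.
Qed.

Lemma sigma0_covector y : sigma f 0 y \in L.
Proof. by have [M0 _ _ _] := cF; apply: sigma_covector; rewrite lexx; lra. Qed.

Lemma covectors_simple : simple_om L.
Proof.
split.
- move=> e; apply/setP => u; rewrite !inE.
  apply/imsetP/idP => [[X _ ->]|_]; first by case: (F3_cases (X e)) => ->; rewrite eqxx ?orbT.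
  case: (F3_cases u) => ->.
  + exists (sigma f 0 (f e 0 + 1)); first exact: sigma0_covector.
    by rewrite ffunE; apply/esym/eqP; rewrite sg_eq1; lra.
  + exists (sigma f 0 (f e 0 - 1)); first exact: sigma0_covector.
    by rewrite ffunE; apply/esym/eqP; rewrite sg_eqN1; lra.
  + exists (sigma f 0 (f e 0)); first exact: sigma0_covector.
    by rewrite ffunE; apply/esym/eqP; rewrite sg_eq0 subrr.
- move=> e g eg.
  exists (sigma f 0 (`|f e 0| + `|f g 0| + 1)), (sigma f 0 ((f e 0 + f g 0) / 2)).
  split; [exact: sigma0_covector|exact: sigma0_covector|].
  have -> : sigma f 0 ((f e 0 + f g 0) / 2) e * sigma f 0 ((f e 0 + f g 0) / 2) g = -1.
    rewrite !ffunE; apply/eqP; rewrite sg_mulN1; have := circular_neq0 eg; rewrite neq_lt => /orP[] h; lra.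
  have h1 := ler_norm (f e 0); have h2 := ler_norm (f g 0).
  have h3 := normr_ge0 (f e 0); have h4 := normr_ge0 (f g 0).
  have /eqP : sigma f 0 (`|f e 0| + `|f g 0| + 1) e == 1 by rewrite ffunE sg_eq1; lra.
  have /eqP : sigma f 0 (`|f e 0| + `|f g 0| + 1) g == 1 by rewrite ffunE sg_eq1; lra.
  by move=> -> ->; rewrite mulr1.
Qed.

(** Composing with a point above all curves turns every zero into +1, so a maximal covector has no
    zero. *)
Lemma topesP X : X \in topes L <-> X \in L /\ forall e, X e != 0.
Proof.
rewrite inE; split => [/andP[XL /forall_inP mx]|[XL Xn]].
  split=> // e; have [|y [hy _]] := @fin_between R I predT pred0 (f ^~ 0) => //.
  have TL := sigma0_covector y.
  have := mx _ (covectors_comp cF XL TL).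
  have -> : sv_le X (sv_comp X (sigma f 0 y)).
    by apply/forallP => g; rewrite !ffunE; case: (X g =P 0) => //= _; rewrite eqxx.
  move=> /eqP <-; rewrite !ffunE; case: ifP => //.
  by rewrite sg_eq0; have := hy e isT; lra.
rewrite XL; apply/forall_inP => Y YL; apply/implyP => /forallP h; apply/eqP/ffunP => e.
by have := h e; rewrite (negbTE (Xn e)) => /eqP.
Qed.

Lemma tope_graphP (e0 : I) (A : {set I}) : A \in tope_graph L <->
  exists x y, [/\ 0 <= x < 2 * M, forall e, f e x != y & A = [set e | f e x < y]%SET].
Proof.
have supp x y : [set e | sigma f x y e == 1]%SET = [set e | f e x < y]%SET.
  by apply/setP => e; rewrite !inE ffunE sg_eq1 subr_gt0.
split.
- move=> /imsetP[X /topesP[/covectorsP[->|[x [y [hx ->]]]] Xn] ->].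
    by have := Xn e0; rewrite ffunE eqxx.
  exists x, y; split => // e; have := Xn e.
  by rewrite ffunE sg_eq0 subr_eq0 eq_sym.
- move=> [x [y [hx hy ->]]]; apply/imsetP; exists (sigma f x y); last by rewrite supp.
  apply/topesP; split; first exact: sigma_covector.
  by move=> e; rewrite ffunE sg_eq0 subr_eq0 eq_sym.
Qed.

Lemma tope_graph_halves (e0 : I) (A : {set I}) : A \in tope_graph L <->
  exists x y, [/\ 0 <= x <= M, forall e, f e x != y &
    A = [set e | f e x < y]%SET \/ A = (~: [set e | f e x < y])%SET].
Proof.
have [M0 _ anti _] := cF.
have cmpl x y : (forall e, f e x != y) -> [set e | y < f e x]%SET = (~: [set e | f e x < y])%SET.
  by move=> h; apply/setP => e; rewrite !inE -leNgt lt_neqAle eq_sym h.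
rewrite (tope_graphP e0); split => [[x [y [hx hy ->]]]|[x [y [hx hy [->|->]]]]].
- have [xM|xM] := leP x M; first by exists x, y; split; [lra|by []|left].
  have hx' : 0 <= x - M <= M by lra.
  have fE e : f e x = - f e (x - M) by rewrite -anti ?subrK.
  have hy' e : f e (x - M) != - y by rewrite -eqr_oppLR -fE.
  exists (x - M), (- y); split => //; right; rewrite -cmpl //.
  by apply/setP => e; rewrite !inE fE ltrNl.
- by exists x, y; split => //; lra.
- have [xM|xM] := ltP x M.
    exists (x + M), (- y); split; first lra.
      by move=> e; rewrite anti // eqr_opp.
    by rewrite -cmpl //; apply/setP => e; rewrite !inE anti // ltrN2.
  (* Here [x + M] would be the excluded end [2 * M], which is represented by the abscissa 0. *)
  have {}xM : x = M by lra.
  have f0 e : f e 0 = - f e x by rewrite xM -[in RHS](add0r M) anti ?opprK // lexx ltW.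
  exists 0, (- y); split; first lra.
    by move=> e; rewrite f0 eqr_opp.
  by rewrite -cmpl //; apply/setP => e; rewrite !inE f0 ltrN2.
Qed.

End Topes.

(** * The circular family of a half turn *)

Section HalfTurnFamily.
Variables (R : realType) (n N : nat) (c : nat -> 'I_n.+1 -> nat).
Hypothesis hc : half_turn N c.
Hypothesis N0 : (0 < N)%N.
Implicit Types (i j : 'I_n.+1) (t : nat) (x y : R).

(* The positions are centred at 0, so that reversing the order negates them. *)
Definition centred i t : R := (c t i)%:R - n%:R / 2.

Definition wrapped i t : R := if (t <= N)%N then centred i t else - centred i (t - N)%N.

Definition circular_curve i : R -> R := interp (2 * N) (wrapped i).

Lemma wrapped_anti i t : (t <= N)%N -> wrapped i (t + N)%N = - wrapped i t.
Proof.
move=> tN; rewrite /wrapped tN addnK; case: t tN => [|t] tN; last first.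
  by rewrite ifF //; apply/negbTE; rewrite -ltnNge; lia.
(* At the joint [t = 0] the change of sign comes from the reversal reached at time [N], by
   centring. *)
rewrite leqnn /centred; have [-> -> _ _] := hc.
by rewrite /= natrB ?leq_ord //; field.
Qed.

Lemma nat_segment_closed x : 0 <= x <= N%:R -> exists2 t, (t < N)%N & t%:R <= x <= t.+1%:R.
Proof.
move=> /andP[x0 xN]; have [x0'|x0'] := leP x 0.
  by exists 0%N => //; rewrite x0 (le_trans x0') // ler01.
have [xN'|xN'] := ltP x N%:R; first exact: nat_segment.
by exists N.-1; rewrite ?prednK // xN andbT (le_trans _ xN') // ler_nat leq_pred.
Qed.

Lemma circular_curve_anti i x : 0 <= x <= N%:R -> circular_curve i (x + N%:R) = - circular_curve i x.
Proof.
move=> /nat_segment_closed[t tN tx]; rewrite /circular_curve.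
rewrite (@interp_mid _ _ _ (t + N)%N); last 2 first.
- lia.
- by rewrite -addSn !natrD; lra.
rewrite (@interp_mid _ _ _ t) //; last lia.
by rewrite -addSn !wrapped_anti ?(ltnW tN) // natrD; ring.
Qed.

Lemma circular_curveE i x : 0 <= x <= N%:R ->
  circular_curve i x = sweep_curve N c i x - n%:R / 2.
Proof.
move=> /nat_segment_closed[t tN tx]; rewrite /circular_curve /sweep_curve !(@interp_mid _ _ _ t) //; last lia.
by rewrite /wrapped (ltnW tN) tN /centred; ring.
Qed.

Lemma half_turn_circular_family : circular_family circular_curve N%:R.
Proof.
split; first by rewrite ltr0n.
- by move=> i; exact: interp_continuous.
- exact: circular_curve_anti.
- move=> i j; rewrite neq_ltn => /orP[] ij; [left|right];
    have [t [tN et h1 h2]] := sweep_curve_cross R hc ij; exists t.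
  + split=> // [|x hx|x hx]; rewrite !circular_curveE ?et //; try lra.
      by rewrite ltrD2r h1; lra.
    by rewrite ltrD2r h2; lra.
  + split=> // [|x hx|x hx]; rewrite !circular_curveE ?et //; try lra.
      by rewrite ltrD2r h1; lra.
    by rewrite ltrD2r h2; lra.
Qed.

Lemma half_turn_topes (A : {set 'I_n.+1}) : A \in tope_graph (covectors circular_curve N%:R) <->
  exists t k, [/\ (t <= N)%N, (k <= n.+1)%N &
    A = [set i | (c t i < k)%N]%SET \/ A = (~: [set i | (c t i < k)%N])%SET].
Proof.
rewrite (tope_graph_halves half_turn_circular_family ord0); split.
- move=> [x [y [hx hy hA]]].
  have [|t [k [tN kn e]]] := (lower_set_sweep R hc [set i | circular_curve i x < y]%SET).1.
    exists x => i j; rewrite !inE -leNgt => h1 h2.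
    by have := lt_le_trans h1 h2; rewrite !circular_curveE // ltrD2r.
  by exists t, k; rewrite e in hA.
- move=> [t [k [tN kn hA]]].
  have ht : 0 <= (t%:R : R) <= N%:R by rewrite ler0n ler_nat.
  (* The centred height halfway between the positions [k - 1] and [k]. *)
  exists t%:R, (k%:R - 1 / 2 - n%:R / 2); split => //.
    move=> i; rewrite circular_curveE // sweep_curve_nat //.
    have [h|h] := ltnP (c t i) k.
      by have : (c t i).+1%:R <= k%:R :> R; [rewrite ler_nat|rewrite -[_.+1%:R]natr1; lra].
    by have : k%:R <= (c t i)%:R :> R; [rewrite ler_nat|lra].
  suff -> : [set i | circular_curve i t%:R < k%:R - 1 / 2 - n%:R / 2]%SET = [set i | (c t i < k)%N]%SET by [].
  apply/setP => i; rewrite !inE circular_curveE // sweep_curve_nat //.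
  have [h|h] := ltnP (c t i) k.
    by have : (c t i).+1%:R <= k%:R :> R; [rewrite ler_nat|rewrite -[_.+1%:R]natr1; lra].
  by have : k%:R <= (c t i)%:R :> R; [rewrite ler_nat|lra].
Qed.

End HalfTurnFamily.

(** * The affine oriented matroid of a normalized family *)

Local Open Scope set_scope.
Local Open Scope nat_scope.

Lemma imset_graph_iso (U V : finType) (h : U -> V) (F : {set {set U}}) : injective h ->
  graph_iso F [set h @: (B : {set U}) | B in F].
Proof.
move=> hI; exists (fun B : {set U} => h @: B); split => //.
  by move=> A B _ _; exact: imset_inj.
move=> A B _ _; rewrite !cube_adjE /hdist.
suff -> : sdiff (h @: A) (h @: B) = h @: sdiff A B by rewrite card_imset.
apply/setP => v; rewrite in_sdiff; have [/codomP[u ->]|v_out] := boolP (v \in codom h).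
  by rewrite !mem_imset // in_sdiff.
have out (C : {set U}) : (v \in h @: C) = false.
  by apply: contraNF v_out => /imsetP[u _ ->]; exact: codom_f.
by rewrite !out.
Qed.

Lemma lift0P n (i : 'I_n.+1) : (exists j : 'I_n, i = lift ord0 j) \/ i = ord0.
Proof. by case: (unliftP ord0 i) => [j ->|->]; [left; exists j|right]. Qed.

Section ExtendedHalfTurn.
Variables (n N : nat) (c : nat -> 'I_n -> nat).
Hypothesis hc : half_turn N c.

(* The line at infinity, of index [ord0], first sweeps over all the other curves. *)
Definition extended t (i : 'I_n.+1) : nat :=
  if unlift ord0 i is Some j then (if t < n then (if j < t then nat_of_ord j else j.+1) else c (t - n) j)
  else minn t n.

Lemma extended0 t : extended t ord0 = minn t n.
Proof. by rewrite /extended unlift_none. Qed.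

Lemma extended_lift t (j : 'I_n) : extended t (lift ord0 j) =
  if t < n then (if j < t then nat_of_ord j else j.+1) else c (t - n) j.
Proof. by rewrite /extended liftK. Qed.

Lemma extended_half_turn : half_turn (n + N) extended.
Proof.
have [c0 cN cb ci] := hc; split.
- move=> i; case: (lift0P i) => [[j ->]|->]; rewrite ?extended0 ?extended_lift ?min0n //.
  by case: ifP => // /negbT; have := ltn_ord j; lia.
- move=> i; case: (lift0P i) => [[j ->]|->]; rewrite ?extended0 ?extended_lift.
    by rewrite ltnNge leq_addr /= addKn cN /bump /=; have := ltn_ord j; lia.
  by rewrite (minn_idPr _) ?leq_addr // subn0.
- move=> t tN; have [tn|tn] := ltnP t n.
    have step (j : 'I_n) : extended t.+1 (lift ord0 j) = if j < t.+1 then nat_of_ord j else j.+1.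
      rewrite extended_lift; have [//|h] := ltnP t.+1 n.
      by rewrite (_ : t.+1 - n = 0) ?c0; have := ltn_ord j; [case: ifP|]; lia.
    (* A block of two: the line at infinity, in position [t], is exchanged with the curve just after
       it. *)
    exists t, t.+2; split.
    + by rewrite ltnS.
    + move=> i; case: (lift0P i) => [[j ->]|->]; rewrite ?extended0 ?step ?extended_lift ?tn.
        by case: (ltngtP j t) => h; repeat case: ifP; lia.
      by rewrite (minn_idPl (ltnW tn)); lia.
    + move=> i; case: (lift0P i) => [[j ->]|->]; rewrite ?extended0 ?step ?extended_lift ?tn.
        by case: (ltngtP j t) => h; repeat case: ifP; lia.
      by rewrite (minn_idPl (ltnW tn)) (minn_idPl tn); lia.
    + move=> i j; case: (lift0P j) => [[k ->]|->]; rewrite ?extended0 ?extended_lift ?tn.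
        case: (lift0P i) => [[k' ->]|->]; rewrite ?extended0 ?extended_lift ?tn ?lift0 //.
        by case: ifP; case: ifP; lia.
      by rewrite (minn_idPl (ltnW tn)); lia.
  have [|p [q [qn out blk up]]] := cb (t - n); first by lia.
  have E : (t < n) = false by lia.
  have E' : (t.+1 < n) = false by lia.
  have S : t.+1 - n = (t - n).+1 by lia.
  exists p, q; split; first exact: leqW.
  + move=> i; case: (lift0P i) => [[j ->]|->]; rewrite ?extended0 ?extended_lift ?E ?E' ?S; first exact: out.
    by rewrite !(minn_idPr _) //; exact: leqW.
  + move=> i; case: (lift0P i) => [[j ->]|->]; rewrite ?extended0 ?extended_lift ?E ?E' ?S; first exact: blk.
    by rewrite (minn_idPr _) //; lia.
  + move=> i j; case: (lift0P j) => [[k ->]|->]; rewrite ?extended0 ?extended_lift ?E.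
      case: (lift0P i) => [[k' ->]|->]; rewrite ?extended0 ?extended_lift ?E ?lift0 // ltnS.
      exact: up.
    by rewrite (minn_idPr _) //; lia.
- move=> t tN; have [tn|tn] := ltnP t n.
    split=> [i j|i]; last first.
      case: (lift0P i) => [[k ->]|->]; rewrite ?extended0 ?extended_lift ?tn; last by lia.
      by have := ltn_ord k; case: ifP; lia.
    case: (lift0P j) => [[k ->]|->]; case: (lift0P i) => [[k' ->]|->];
      rewrite ?extended0 ?extended_lift ?tn ?(minn_idPl (ltnW tn)) //.
    + move=> h; suff /ord_inj -> : k' = k :> nat by []. by move: h; case: ifP; case: ifP; lia.
    + by case: ifP; lia.
    + by case: ifP; lia.
  have E : (t < n) = false by lia.
  have [|inj bd] := ci (t - n); first by lia.
  split=> [i j|i]; last first.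
    case: (lift0P i) => [[k ->]|->]; rewrite ?extended0 ?extended_lift ?E; last by rewrite ltnS geq_minr.
    by rewrite ltnS ltnW.
  case: (lift0P j) => [[k ->]|->]; case: (lift0P i) => [[k' ->]|->];
    rewrite ?extended0 ?extended_lift ?E ?(minn_idPr tn) //.
  + by move=> /inj ->.
  + by have := bd k; lia.
  + by have := bd k'; lia.
Qed.

End ExtendedHalfTurn.

(** While the line at infinity sweeps, prefixes avoiding it are initial segments, and complements of
    prefixes containing it are final segments; both are in [F] by normality. Afterwards it comes
    last, and the prefixes avoiding it are those of the sweep of [F]. *)
Lemma normal_family_AOM (R : realType) n (F : {set {set 'I_n}}) : 0 < n -> normal_family F -> AOM F.
Proof.
move=> n0 nF; have [_ _ Fi Ff] := nF; have [N [c sF]] := normal_family_sweep nF.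
have [_ _ _ _ FE] := sF; have hc := sweep_half_turn sF.
have ht := extended_half_turn hc.
have N0 : 0 < n + N by rewrite addn_gt0 n0.
have cF := half_turn_circular_family R ht N0.
have tE := half_turn_topes R ht N0.
pose L := covectors (@circular_curve R n (n + N) (extended c)) (n + N)%:R%R.
have oL : oriented_matroid L by exact: covectors_oriented_matroid.
have siL : simple_om L by exact: covectors_simple.
have halfE A : A \in [set A in tope_graph L | ord0 \notin A] <-> exists2 B, B \in F & A = [set lift ord0 j | j in B].
  have liftE t k : ord0 \notin [set i | extended c t i < k] -> 
      [set i | extended c t i < k] = [set lift ord0 j | j in [set j : 'I_n | extended c t (lift ord0 j) < k]].
    move=> h; apply/setP => i; case: (lift0P i) => [[j ->]|->].
      by rewrite mem_imset ?inE //; exact: lift_inj.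
    rewrite (negbTE h); apply/esym/negbTE/imsetP => -[j _ /eqP]; apply/negP; exact: neq_lift.
  have liftCE t k : ord0 \notin ~: [set i | extended c t i < k] ->
      ~: [set i | extended c t i < k] = [set lift ord0 j | j in [set j : 'I_n | k <= extended c t (lift ord0 j)]].
    move=> h; apply/setP => i; case: (lift0P i) => [[j ->]|->].
      by rewrite mem_imset ?inE -?leqNgt //; exact: lift_inj.
    rewrite (negbTE h); apply/esym/negbTE/imsetP => -[j _ /eqP]; apply/negP; exact: neq_lift.
  rewrite inE; split=> [/andP[/tE[t [k [tN kn [->|->]]]]]|[B /FE[t [k [tN kn ->]]] ->]].
  - move=> h; rewrite (liftE t k h); eexists; last by [].
    move: h; rewrite inE extended0 -leqNgt => kt.
    have [tn|tn] := ltnP t n.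
      rewrite (_ : [set j | _] = init n k); first by apply: Fi; lia.
      apply/setP => j; rewrite !inE extended_lift tn.
      by case: ifP; lia.
    apply/FE; exists (t - n), k; split; [lia|lia|].
    by apply/setP => j; rewrite !inE extended_lift (_ : (t < n) = false) //; lia.
  - move=> h; rewrite (liftCE t k h); eexists; last by [].
    move: h; rewrite !inE negbK extended0 => kt.
    have [tn|tn] := ltnP t n.
      (* Of the [k] positions of the prefix one is taken by the line at infinity. *)
      rewrite (_ : [set j | _] = fin n k.-1); first by apply: Ff; lia.
      apply/setP => j; rewrite !inE extended_lift tn.
      by case: ifP; lia.
    rewrite (_ : [set j | _] = init n 0); first exact: Fi.
    apply/setP => j; rewrite !inE extended_lift (ltnNge t) tn /=.
    have [_ _ _ /(_ (t - n))[|_ /(_ j)]] := hc; first by lia.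
    by lia.
  - have E (i : 'I_n.+1) : (i \in [set lift ord0 j | j in [set j : 'I_n | c t j < k]]) = (extended c (n + t) i < k).
      case: (lift0P i) => [[j ->]|->].
        rewrite mem_imset; last exact: lift_inj.
        by rewrite inE extended_lift (_ : (n + t < n) = false) ?addKn; last by lia.
      rewrite extended0 (minn_idPr _) ?leq_addr // ltnNge kn /=.
      apply/negbTE/imsetP => -[j _ /eqP]; apply/negP; exact: neq_lift.
    rewrite E extended0 (minn_idPr _) ?leq_addr // -leqNgt kn andbT.
    apply/tE; exists (n + t), k; split; [lia|lia|left].
    by apply/setP => i; rewrite E inE.
pose H := [set A in tope_graph L | ord0 \notin A].
exists ('I_n.+1 : finType), L, H; split => //.
- exists ord0; split; last by right.
  + apply/set0Pn; exists [set i | extended c 0 i < 1]; rewrite inE; apply/andP; split.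
      by apply/tE; exists 0, 1; split => //; left.
    by rewrite inE extended0 min0n.
  + apply/set0Pn; exists [set lift ord0 j | j in init n 0]; apply/halfE.
    by exists (init n 0) => //; exact: Fi.
- rewrite (_ : H = [set lift ord0 @: (B : {set 'I_n}) | B in F]); first by apply: imset_graph_iso; exact: lift_inj.
  apply/setP => A; apply/idP/imsetP => [/halfE//|h]; exact/halfE.
Qed.

Lemma cycle_hull_AOM (R : realType) m (G C : {set {set 'I_m}}) :
  partial_cube G -> vcdim G <= 2 -> isometric_cycle G C -> AOM_of_rank 2 (conv G C).
Proof.
move=> /partial_cubeP[_ sG] v2 cC; have [n [F [n1 nF iso v2']]] := cycle_hull_normal sG cC v2.
split.
  have [V [L [H [h1 h2 h3 h4]]]] := normal_family_AOM R (ltnW n1) nF.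
  by exists V, L, H; split => //; exact: graph_iso_trans iso h4.
apply/eqP; rewrite eqn_leq v2' andbT; apply/vcdim_leq => A sA.
move/vcdim_leq: v2; apply => X XA; have [B BC AB] := sA X XA; exists B => //.
have CG : C \subset G by case: cC => _ [].
by apply: (fintype.subsetP (conv_sub sG CG)) BC.
Qed.

Theorem proposition27 (R : realType) :
  (forall (m : nat) (D : {set {set 'I_m}}),
     partial_cube D -> (vcdim D <= 2)%N -> (pseudo_disk D <-> disk R D)) /\
  (forall (m : nat) (G C : {set {set 'I_m}}),
     partial_cube G -> (vcdim G <= 2)%N -> isometric_cycle G C ->
     AOM_of_rank 2 (conv G C)).
Proof. by split => [m D|m G C]; [exact: pseudo_disk_iff_disk|exact: cycle_hull_AOM]. Qed.
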